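(* Suppose that: (A1) every first-order stationary point $\mathbf{x}$ of $f=\sum_{i=1}^m f_i$ satisfies either $\lambda_{\min}(\nabla^2 f(\mathbf{x}))>0$ or $\lambda_{\min}(\nabla^2 f(\mathbf{x}))<0$; (A2) each $f_i$ has $L_{f_i}^g$-Lipschitz continuous gradient on $\mathbb{R}^n$; (A3) each $f_i$ has $L_{f_i}^H$-Lipschitz continuous Hessian on $\mathbb{R}^n$; (A4) each $f_i$ is coercive (its sublevel sets are compact) and proper (not everywhere infinite); (A5) the undirected graph $\mathcal{G}(\mathcal{V},\mathcal{E})$ is connected. Given $\Delta_1>0$ and $0<\zeta<1$, also suppose the following. 1) There exist $\epsilon>0$, $\gamma\in(0,L_F^g]$, $\mu\in(0,L_F^g]$, $\delta>0$ and $\alpha\in(0,\hat{\alpha}(\Delta_1,\zeta)]$ such that $$\mathcal{L}^1_{\alpha,\epsilon}\cup\mathcal{L}^2_{\alpha,\gamma}\cup\mathcal{L}^3_{\alpha,\mu,\delta}=(\mathbb{R}^n)^m,$$ where $$\hat{\alpha}(\Delta_1,\zeta):=\min\left\{\bar{\alpha}(\Delta_1),\ \frac{\sqrt{2}-1}{L_F^g},\ \frac{\lambda_{\min}(\mathbf{W})}{L_F^g\cdot\max\{1,\log(\zeta^{-1})\}}\right\}>0.$$ 2) The random perturbations $\xi_i^k$ in the NDGD algorithm (run with this step-size $\alpha$) are i.i.d. and zero mean with variance $\sigma^2\le\sigma_{\max}^2(\epsilon):=\frac{\lambda_{\min}(\mathbf{W})\epsilon^2}{mn}$. 3) The generated sequence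 $\{Q_\alpha(\hat{\mathbf{x}}^k)\}$ is bounded. Then, with probability at least $1-\zeta$, after $K(\alpha,\zeta)=\mathcal{O}(\alpha^{-2}\log\zeta^{-1})$ iterations, the NDGD algorithm reaches a point $\hat{\mathbf{x}}^{K(\alpha,\zeta)}\in(\mathbb{R}^n)^m$ that is $\Delta_2(\alpha,\zeta)$-close to $\hat{\mathcal{X}}^*_{Q_\alpha}$, where $\Delta_2(\alpha,\zeta)=\mathcal{O}(\sqrt{\alpha\log(\alpha^{-1}\zeta^{-1})})$. Moreover, the point $\hat{\mathbf{x}}^*$ attaining $\inf_{\hat{\mathbf{x}}\in\hat{\mathcal{X}}^*_{Q_\alpha}}\|\hat{\mathbf{x}}^{K(\alpha,\zeta)}-\hat{\mathbf{x}}\|$ is such that each component $\hat{\mathbf{x}}_i^*$ is $\Delta_1$-close to $\mathcal{X}_f^*$, whereby for all $i\in\mathcal{V}$, $$\mathrm{dist}(\hat{\mathbf{x}}_i^{K(\alpha,\zeta)},\mathcal{X}_f^* )\le\Delta_1+\Delta_2(\alpha,\zeta).$$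
   Context: Setting: $f_1,\dots,f_m:\mathbb{R}^n\to\mathbb{R}$ are smooth, possibly non-convex functions; $f=\sum_{i=1}^m f_i$ on $\mathbb{R}^n$. For $\hat{\mathbf{x}}=[\hat{\mathbf{x}}_1^T,\dots,\hat{\mathbf{x}}_m^T]^T\in(\mathbb{R}^n)^m$, $F(\hat{\mathbf{x}})=\sum_{i=1}^m f_i(\hat{\mathbf{x}}_i)$. $L_F^g=\max_i L_{f_i}^g$. A point $\mathbf{x}$ is first-order stationary for $h$ if $\nabla h(\mathbf{x})=0$. Network: $\mathcal{G}(\mathcal{V},\mathcal{E})$ is an undirected graph with $\mathcal{V}=\{1,\dots,m\}$. The mixing matrix $\mathbf{W}\in\mathbb{R}^{m\times m}$ is symmetric, doubly stochastic and strictly diagonally dominant ($\mathbf{W}_{ii}>\sum_{j\ne i}\mathbf{W}_{ij}$ for all $i$), with $\mathbf{W}_{ii}>0$ for all $i$ and, for $i\neq j$, $\mathbf{W}_{ij}>0$ if $(i,j)\in\mathcal{E}$ and $\mathbf{W}_{ij}=0$ otherwise. $\hat{\mathbf{W}}=\mathbf{W}\otimes\mathbf{I}_n$. Auxiliary function: for $\alpha>0$, $Q_\alpha(\hat{\mathbf{x}})=F(\hat{\mathbf{x}})+\frac{1}{2\alpha}\hat{\mathbf{x}}^T(\mathbf{I}_{mn}-\hat{\mathbf{W}})\hat{\mathbf{x}}$. A local minimizer of a twice differentiable $h$ means a point with $\nabla h=0$ and $\nabla^2h\succ0$. The sets of local minimizers are $\mathcal{X}_f^*=\{\mathbf{x}\in\mathbb{R}^n:\nabla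 f(\mathbf{x})=0,\ \nabla^2f(\mathbf{x})\succ0\}$ and $\hat{\mathcal{X}}^*_{Q_\alpha}=\{\hat{\mathbf{x}}\in(\mathbb{R}^n)^m:\nabla Q_\alpha(\hat{\mathbf{x}})=0,\ \nabla^2Q_\alpha(\hat{\mathbf{x}})\succ0\}$. $\bar{\alpha}(\Delta_1)>0$ denotes a threshold with the following property (such a threshold exists under (A1)-(A5)): if $0<\alpha\le\bar{\alpha}(\Delta_1)$ and $\hat{\mathbf{x}}^*$ is a local minimizer of $Q_\alpha$, then $\mathrm{dist}(\hat{\mathbf{x}}_i^*,\mathcal{X}_f^* )\le\Delta_1$ for each $i\in\mathcal{V}$. Region sets: $\mathcal{L}^1_{\alpha,\epsilon}=\{\hat{\mathbf{x}}:\|\nabla F(\hat{\mathbf{x}})+\alpha^{-1}(\mathbf{I}_{mn}-\hat{\mathbf{W}})\hat{\mathbf{x}}\|\ge\epsilon\}$; $\mathcal{L}^2_{\alpha,\gamma}=\{\hat{\mathbf{x}}:\lambda_{\min}(\nabla^2F(\hat{\mathbf{x}}))\le-\gamma-\alpha^{-1}\}$; $\mathcal{L}^3_{\alpha,\mu,\delta}=\{\hat{\mathbf{x}}:\lambda_{\min}(\nabla^2F(\hat{\mathbf{x}}))\ge\mu,\ \mathrm{dist}(\hat{\mathbf{x}},\hat{\mathcal{X}}')\le\delta\}$, where $\hat{\mathcal{X}}'=\{\hat{\mathbf{x}}:\|\nabla F(\hat{\mathbf{x}})+\alpha^{-1}(\mathbf{I}_{mn}-\hat{\mathbf{W}})\hat{\mathbf{x}}\|=0,\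 \lambda_{\min}(\nabla^2F(\hat{\mathbf{x}}))>0\}$. NDGD algorithm (Noisy Distributed Gradient Descent) with constant step-size $\alpha>0$: from an initial $\hat{\mathbf{x}}^0$, for $k=0,1,\dots$ and each $i\in\mathcal{V}$, sample i.i.d. noise $\xi_i^k\in\mathbb{R}^n$ and set $\hat{\mathbf{x}}_i^{k+1}=\sum_{j=1}^m\mathbf{W}_{ij}\hat{\mathbf{x}}_j^k-\alpha(\nabla f_i(\hat{\mathbf{x}}_i^k)+\xi_i^k)$. Zero mean with variance $\sigma^2$ means $\mathbb{E}[\xi_i^k]=0$ and $\mathbb{E}[\xi_i^k(\xi_i^k)^T]=\sigma^2\mathbf{I}_n$. Notation: $\mathrm{dist}(\mathbf{x},\mathcal{Y})=\inf_{\mathbf{y}\in\mathcal{Y}}\|\mathbf{x}-\mathbf{y}\|$; a point is $\delta$-close to a set if its distance to the set is at most $\delta$. The $\mathcal{O}(\cdot)$ notation displays only the dependence on $\alpha$ and $\zeta$, hiding factors with polynomial dependence on all other parameters (including $\Delta_1,\epsilon,\gamma,\mu,\delta,\sigma$).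
   Formalization: In both rates the logarithm is replaced by max(1, log): as displayed, the bound on K forces K=0 as ζ→1, and log(α⁻¹ζ⁻¹) can be negative; the hidden O-factor is polynomial in the other parameters, their inverses, and the almost sure bound on |Q_α|. *)

(* Defs.v *)
From HB Require Import structures.
From mathcomp Require Export all_boot all_order all_algebra.
From mathcomp Require Export mxtens.
From mathcomp Require Export all_classical all_reals all_analysis.
Set Implicit Arguments.
Unset Strict Implicit.
Unset Printing Implicit Defensive.
Export Order.TTheory GRing.Theory Num.Theory.
Export numFieldNormedType.Exports.
Local Open Scope classical_set_scope.
Local Open Scope ring_scope.

(* Vectors are rows ('rV), following the convention of the library.           *)

(* The library norm `|x| on 'rV is the sup norm; this is the Euclidean one.   *)
Definition norm2 (R : realType) (n : nat) (x : 'rV[R]_n) : R :=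
  Num.sqrt (\sum_(j < n) x 0 j ^+ 2).

(* The spectral norm.  Rows are multiplied on the right; A and A^T have the   *)
(* same spectral norm.                                                        *)
Definition mxnorm2 (R : realType) (n : nat) (A : 'M[R]_n) : R :=
  sup [set norm2 (v *m A) | v in [set v : 'rV[R]_n | norm2 v <= 1]].

(* Extended-real valued, so that the distance to the empty set is +oo.        *)
Definition dist (R : realType) (n : nat) (x : 'rV[R]_n) (Y : set 'rV[R]_n) :
    \bar R :=
  ereal_inf [set (norm2 (x - y))%:E | y in Y].

(* The smallest eigenvalue; only used on symmetric matrices of positive size, *)
(* whose set of real eigenvalues is finite and nonempty.                      *)
Definition lambda_min (R : realType) (n : nat) (A : 'M[R]_n) : R :=
  inf [set l : R | eigenvalue A l].

Definition posdef (R : realType) (n : nat) (A : 'M[R]_n) : Prop :=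
  forall v : 'rV[R]_n, v != 0 -> 0 < (v *m A *m v^T) 0 0.

Definition partial (R : realType) (n : nat) (i : 'I_n) (h : 'rV[R]_n -> R) :
    'rV[R]_n -> R :=
  fun x => 'D_(delta_mx 0 i) h x.

Definition grad (R : realType) (n : nat) (h : 'rV[R]_n -> R) (x : 'rV[R]_n) :
    'rV[R]_n :=
  \row_i partial i h x.

Definition hess (R : realType) (n : nat) (h : 'rV[R]_n -> R) (x : 'rV[R]_n) :
    'M[R]_n :=
  \matrix_(i, j) partial i (partial j h) x.

(* Class C^2, the only smoothness that the second-order notions need.         *)
Definition smooth (R : realType) (n : nat) (h : 'rV[R]_n -> R) : Prop :=
  [/\ forall x, differentiable h x,
      forall i x, differentiable (partial i h) x &
      forall i j, continuous (partial i (partial j h))].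

(* Properness needs no clause: h is real valued.                              *)
Definition coercive (R : realType) (n : nat) (h : 'rV[R]_n -> R) : Prop :=
  forall c : R, compact [set x | h x <= c].

Definition lipschitz_grad (R : realType) (n : nat) (h : 'rV[R]_n -> R)
    (L : R) : Prop :=
  forall x y, norm2 (grad h x - grad h y) <= L * norm2 (x - y).

Definition lipschitz_hess (R : realType) (n : nat) (h : 'rV[R]_n -> R)
    (L : R) : Prop :=
  forall x y, mxnorm2 (hess h x - hess h y) <= L * norm2 (x - y).

Definition local_minimizers (R : realType) (n : nat) (h : 'rV[R]_n -> R) :
    set 'rV[R]_n :=
  [set x | grad h x = 0 /\ posdef (hess h x)].

(* (R^n)^m is 'rV_(m * n), with the indexing of the Kronecker product *t:     *)
(* coordinate j of component i has index mxtens_index (i, j) = i * n + j.     *)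
Definition block (R : realType) (m n : nat) (x : 'rV[R]_(m * n)) (i : 'I_m) :
    'rV[R]_n :=
  \row_j x 0 (mxtens_index (i, j)).

Definition stack (R : realType) (m n : nat) (y : 'I_m -> 'rV[R]_n) :
    'rV[R]_(m * n) :=
  \row_k y (mxtens_unindex k).1 0 (mxtens_unindex k).2.

Definition sum_obj (R : realType) (m n : nat) (f : 'I_m -> 'rV[R]_n -> R) :
    'rV[R]_n -> R :=
  fun x => \sum_i f i x.

Definition stacked_obj (R : realType) (m n : nat)
    (f : 'I_m -> 'rV[R]_n -> R) : 'rV[R]_(m * n) -> R :=
  fun x => \sum_i f i (block x i).

Definition mixing_matrix (R : realType) (m : nat) (e : rel 'I_m)
    (W : 'M[R]_m) : Prop :=
  [/\ W^T = W,
      forall i, \sum_j W i j = 1,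
      forall j, \sum_i W i j = 1,
      forall i, \sum_(j | j != i) W i j < W i i &
      (forall i, 0 < W i i) /\
      (forall i j, i != j -> (e i j -> 0 < W i j) /\ (~~ e i j -> W i j = 0))].

Definition What (R : realType) (m n : nat) (W : 'M[R]_m) : 'M[R]_(m * n) :=
  W *t (1%:M : 'M[R]_n).

Definition Qfun (R : realType) (m n : nat) (f : 'I_m -> 'rV[R]_n -> R)
    (W : 'M[R]_m) (alpha : R) : 'rV[R]_(m * n) -> R :=
  fun x => stacked_obj f x +
    (2 * alpha)^-1 * (x *m (1%:M - What n W) *m x^T) 0 0.

(* W being symmetric, x *m (1%:M - What n W) is (I - What) x read as a row.   *)
Definition resid (R : realType) (m n : nat) (f : 'I_m -> 'rV[R]_n -> R)
    (W : 'M[R]_m) (alpha : R) (x : 'rV[R]_(m * n)) : 'rV[R]_(m * n) :=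
  grad (stacked_obj f) x + alpha^-1 *: (x *m (1%:M - What n W)).

Definition region1 (R : realType) (m n : nat) (f : 'I_m -> 'rV[R]_n -> R)
    (W : 'M[R]_m) (alpha eps : R) : set 'rV[R]_(m * n) :=
  [set x | eps <= norm2 (resid f W alpha x)].

Definition region2 (R : realType) (m n : nat) (f : 'I_m -> 'rV[R]_n -> R)
    (alpha gamma : R) : set 'rV[R]_(m * n) :=
  [set x | lambda_min (hess (stacked_obj f) x) <= - gamma - alpha^-1].

Definition Xprime (R : realType) (m n : nat) (f : 'I_m -> 'rV[R]_n -> R)
    (W : 'M[R]_m) (alpha : R) : set 'rV[R]_(m * n) :=
  [set x | norm2 (resid f W alpha x) = 0 /\
           0 < lambda_min (hess (stacked_obj f) x)].

Definition region3 (R : realType) (m n : nat) (f : 'I_m -> 'rV[R]_n -> R)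
    (W : 'M[R]_m) (alpha mu delta : R) : set 'rV[R]_(m * n) :=
  [set x | mu <= lambda_min (hess (stacked_obj f) x) /\
           (dist x (Xprime f W alpha) <= delta%:E)%E].

(* The defining property of the threshold \bar\alpha(Delta1).                 *)
Definition is_threshold (R : realType) (m n : nat)
    (f : 'I_m -> 'rV[R]_n -> R) (W : 'M[R]_m) (Delta1 abar : R) : Prop :=
  0 < abar /\
  forall alpha, 0 < alpha <= abar ->
  forall x, local_minimizers (Qfun f W alpha) x ->
  forall i, (dist (block x i) (local_minimizers (sum_obj f)) <= Delta1%:E)%E.

Definition alpha_hat (R : realType) (m : nat) (W : 'M[R]_m)
    (LFg abar zeta : R) : R :=
  Num.min abar (Num.min ((Num.sqrt 2 - 1) / LFg)
    (lambda_min W / (LFg * Num.max 1 (ln zeta^-1)))).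

(* The iterates for one realization xi of the noise.                          *)
Fixpoint ndgd (R : realType) (m n : nat) (f : 'I_m -> 'rV[R]_n -> R)
    (W : 'M[R]_m) (alpha : R) (x0 : 'rV[R]_(m * n))
    (xi : nat -> 'I_m -> 'rV[R]_n) (k : nat) : 'rV[R]_(m * n) :=
  if k is k'.+1 then
    let x := ndgd f W alpha x0 xi k' in
    stack (fun i => \sum_j W i j *: block x j -
                    alpha *: (grad (f i) (block x i) + xi k' i))
  else x0.

(* R^n with its Borel sigma-algebra.                                          *)
Definition borel_rV (R : realType) (n : nat) :=
  g_sigma_algebraType (@open 'rV[R]_n).

Definition iid (R : realType) (d : measure_display) (T : measurableType d)
    (P : probability T R) (n : nat) (I : eqType) (X : I -> T -> 'rV[R]_n) :
    Prop :=
  [/\ forall i, measurable_fun [set: T] (X i : T -> borel_rV R n),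
      forall i j (B : set (borel_rV R n)), measurable B ->
        P (X i @^-1` B) = P (X j @^-1` B) &
      forall (s : seq I) (B : I -> set (borel_rV R n)), uniq s ->
        (forall i, measurable (B i)) ->
        P (\bigcap_(i in [set` s]) (X i @^-1` B i)) =
          (\prod_(i <- s) P (X i @^-1` B i))%E].

(* E[X] = 0 and E[X X^T] = sigma^2 I_n.                                       *)
Definition zero_mean_var (R : realType) (d : measure_display)
    (T : measurableType d) (P : probability T R) (n : nat)
    (X : T -> 'rV[R]_n) (sigma : R) : Prop :=
  (forall a, 'E_P[fun w => (X w 0 a)%R]%E = 0%E) /\
  (forall a b, 'E_P[fun w => (X w 0 a * X w 0 b)%R]%E =
     (if a == b then sigma ^+ 2 else 0)%:E).

(* The factor hidden by the O-notation: any factor that is polynomial in the  *)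
(* entries of s and their inverses is dominated by one of this form, with c   *)
(* and p independent of s.  In the rates it multiplies, each logarithm        *)
(* appears as max(1, ln _): the O-notation is about small alpha and zeta,     *)
(* while ln zeta^-1 -> 0 as zeta -> 1 and ln (alpha^-1 zeta^-1) <= 0 when     *)
(* alpha * zeta >= 1.  The max is the logarithm itself once its argument is   *)
(* at least expR 1.                                                           *)
Definition poly_factor (R : realType) (c : R) (p : nat) (s : seq R) : R :=
  c * (1 + \sum_(t <- s) (`|t| + `|t^-1|)) ^+ p.

(* Main.v *)
From HB Require Import structures.
From mathcomp Require Import finmap.
Require Import Defs.
From mathcomp Require Import measurable_realfun ring lra.
Local Open Scope classical_set_scope.
Local Open Scope ring_scope.
Set Implicit Arguments.
Unset Strict Implicit.
Unset Printing Implicit Defensive.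

(** Write Q for the auxiliary function and g for its gradient.  NDGD is gradient
    descent on Q with step alpha, perturbed by the noise ([ndgdS]).  The proof has
    three ingredients.

    Landscape.  The eigenvalues of the Hessian of F are at least - L, and alpha L is
    at most lambda_min W <= 1, so that the covering by the three regions makes the
    Hessian of F, hence that of Q, at least mu wherever |g| < eps ([hess_ge_mu]).
    All critical points of the coercive function Q are then strict local minima, and
    a mountain-pass argument shows that there is only one, xs
    ([critical_point_unique]): the set of local minimizers of Q is {xs}.  Arguments
    in the style of Ekeland bound the gap Q - Q xs by the gradient ([gap_le_grad])
    and the distance to xs by the gap ([dist_le_gap]).

    Noise.  Almost surely |Q| stays below B, hence also along every path driven by
    points of the support of the noise ([support_path_bounded]).  A path that always
    picks a noise value at least as good as the mean shows that the minimum of Q is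
    not far below - B ([minimum_ge]); all points where Q <= B are then within a
    controlled distance of xs.  A path that repeats one noise value shows that this
    value is bounded ([support_coord_lt]), since the mean of the nodes would escape
    otherwise.  Although only its variance is prescribed, the noise thus has
    exponential moments.

    Tracking.  Let z accumulate the noise through the matrix W - alpha mu I.  The
    difference of the iterates and z performs a gradient descent whose gradient has
    an error at most (L + mu) |z| ([tracking_step]), so its gap contracts
    geometrically down to a multiple of the maximum of |z|^2 ([tracking_gap]).  The
    coordinates of z are sums of independent variables with total variance of order
    alpha ([coef_sqr_sum]).  By Chernoff's bound ([chernoff]), over the first
    alpha^-2 steps, up to a hidden factor, all of them are of order
    sqrt (alpha log (1 / (alpha zeta))) with probability at least 1 - zeta
    ([noise_event]).  After that many steps, the geometric term is of order alpha,
    and the iterate is as close to xs as z is small ([ndgd_estimate]). *)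

(** * Euclidean geometry of row vectors *)

Section Euclidean.
Variables (R : realType) (n : nat).
Implicit Types (u v w x y z : 'rV[R]_n) (a b : R).

Definition dot u v : R := \sum_j u 0 j * v 0 j.

Lemma mulmx_trE u v : (u *m v^T) 0 0 = dot u v.
Proof. by rewrite mxE; apply: eq_bigr => j _; rewrite mxE. Qed.

Lemma dotC u v : dot u v = dot v u.
Proof. by apply: eq_bigr => j _; rewrite mulrC. Qed.

Lemma dotDl u v w : dot (u + v) w = dot u w + dot v w.
Proof. by rewrite -big_split; apply: eq_bigr => j _; rewrite mxE mulrDl. Qed.

Lemma dotZl a u v : dot (a *: u) v = a * dot u v.
Proof. by rewrite mulr_sumr; apply: eq_bigr => j _; rewrite mxE mulrA. Qed.

Lemma dotNl u v : dot (- u) v = - dot u v.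
Proof. by rewrite -scaleN1r dotZl mulN1r. Qed.

Lemma dotBl u v w : dot (u - v) w = dot u w - dot v w.
Proof. by rewrite dotDl dotNl. Qed.

Lemma dotDr u v w : dot w (u + v) = dot w u + dot w v.
Proof. by rewrite dotC dotDl !(dotC w). Qed.

Lemma dotZr a u v : dot v (a *: u) = a * dot v u.
Proof. by rewrite dotC dotZl dotC. Qed.

Lemma dotNr u v : dot v (- u) = - dot v u.
Proof. by rewrite dotC dotNl dotC. Qed.

Lemma dotBr u v w : dot w (u - v) = dot w u - dot w v.
Proof. by rewrite dotDr dotNr. Qed.

Lemma dot0l u : dot 0 u = 0.
Proof. by rewrite -(scale0r 0) dotZl mul0r. Qed.

Lemma dot_delta u j : dot u (delta_mx 0 j) = u 0 j.
Proof.
rewrite /dot (bigD1 j)//= big1 ?addr0 ?mxE ?eqxx ?mulr1// => i ij.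
by rewrite mxE eqxx (negbTE ij) mulr0.
Qed.

Lemma dotxx u : dot u u = norm2 u ^+ 2.
Proof.
rewrite /norm2 sqr_sqrtr; last by apply: sumr_ge0 => j _; exact: sqr_ge0.
by apply: eq_bigr => j _; rewrite expr2.
Qed.

Definition dotE := (dotDl, dotDr, dotZl, dotZr, dotNl, dotNr).

Lemma norm2_ge0 u : 0 <= norm2 u.
Proof. exact: sqrtr_ge0. Qed.

Lemma norm2_0 : norm2 (0 : 'rV[R]_n) = 0.
Proof. by apply/eqP; rewrite -sqrf_eq0 -dotxx dot0l. Qed.

Lemma norm2_eq0 u : norm2 u = 0 -> u = 0.
Proof.
move=> /(congr1 (fun t => t ^+ 2)); rewrite expr0n/= -dotxx => /eqP.
rewrite psumr_eq0 => [/allP u0|j _]; last by rewrite -expr2 sqr_ge0.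
apply/rowP => j; rewrite mxE; apply/eqP.
by have := u0 j (mem_index_enum _); rewrite -expr2 sqrf_eq0.
Qed.

Lemma norm2_gt0 u : u != 0 -> 0 < norm2 u.
Proof.
move=> u0; rewrite lt_def norm2_ge0 andbT; apply: contra u0 => /eqP nu.
by rewrite (norm2_eq0 nu).
Qed.

Lemma norm2Z a u : norm2 (a *: u) = `|a| * norm2 u.
Proof.
apply/eqP; rewrite -(@eqrXn2 _ 2)// ?norm2_ge0 ?mulr_ge0 ?norm2_ge0//.
by rewrite exprMn -!dotxx dotZl dotZr mulrA -expr2 real_normK ?num_real.
Qed.

Lemma norm2N u : norm2 (- u) = norm2 u.
Proof. by rewrite -scaleN1r norm2Z normrN1 mul1r. Qed.

Lemma norm2_sub u v : norm2 (u - v) = norm2 (v - u).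
Proof. by rewrite -norm2N opprB. Qed.

Lemma sqr_norm2D u v :
  norm2 (u + v) ^+ 2 = norm2 u ^+ 2 + 2 * dot u v + norm2 v ^+ 2.
Proof. by rewrite -!dotxx !dotE (dotC v u); ring. Qed.

Lemma norm2_le u a : 0 <= a -> dot u u <= a ^+ 2 -> norm2 u <= a.
Proof. by move=> a0; rewrite dotxx ler_pXn2r// ?nnegrE ?norm2_ge0. Qed.

Lemma cauchy_schwarz u v : dot u v <= norm2 u * norm2 v.
Proof.
have [->|u0] := eqVneq u 0; first by rewrite dot0l norm2_0 mul0r.
have [->|v0] := eqVneq v 0; first by rewrite dotC dot0l norm2_0 mulr0.
have nu := norm2_gt0 u0; have nv := norm2_gt0 v0.
have : 0 <= dot (norm2 v *: u - norm2 u *: v) (norm2 v *: u - norm2 u *: v).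
  by rewrite dotxx sqr_ge0.
rewrite !dotE (dotC v u) !dotxx => h.
have : 0 <= (norm2 u * norm2 v) * (2 * (norm2 u * norm2 v - dot u v)).
  by rewrite (_ : _ * _ = norm2 v * (norm2 v * norm2 u ^+ 2) +
    norm2 u * (norm2 u * norm2 v ^+ 2) - 2 * (norm2 u * norm2 v * dot u v));
    [lra|ring].
by rewrite pmulr_rge0 ?mulr_gt0// pmulr_rge0// subr_ge0.
Qed.

Lemma ler_dot u v : `|dot u v| <= norm2 u * norm2 v.
Proof.
by rewrite ler_norml cauchy_schwarz andbT lerNl -dotNl -(norm2N u) cauchy_schwarz.
Qed.

Lemma norm2D u v : norm2 (u + v) <= norm2 u + norm2 v.
Proof.
apply: norm2_le; first by rewrite addr_ge0 ?norm2_ge0.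
by rewrite dotxx sqr_norm2D; have := cauchy_schwarz u v; lra.
Qed.

Lemma norm2B u v : norm2 (u - v) <= norm2 u + norm2 v.
Proof. by rewrite (le_trans (norm2D _ _))// norm2N. Qed.

Lemma norm2_dist u v w : norm2 (u - w) <= norm2 (u - v) + norm2 (v - w).
Proof. by rewrite (le_trans _ (norm2D _ _))// addrA subrK. Qed.

Lemma coord_le_norm2 u j : `|u 0 j| <= norm2 u.
Proof.
rewrite -(@ler_pXn2r _ 2)// ?nnegrE ?norm2_ge0// real_normK ?num_real//.
by rewrite -dotxx /dot (bigD1 j)//= expr2 lerDl sumr_ge0// => i _;
  rewrite -expr2 sqr_ge0.
Qed.

Lemma norm2_le_coord u a : (forall j, `|u 0 j| <= a) ->
  norm2 u ^+ 2 <= n%:R * a ^+ 2.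
Proof.
move=> ua; rewrite -dotxx /dot.
rewrite [leRHS](_ : _ = \sum_(j < n) a ^+ 2); last first.
  by rewrite big_const iter_addr_0 card_ord mulr_natl.
apply: ler_sum => j _; rewrite -expr2 -real_normK ?num_real//.
by rewrite ler_pXn2r ?nnegrE// (le_trans _ (ua j)).
Qed.

(** The topology of row vectors comes from the sup norm; the bounds in terms of it
    carry neighbourhoods and boundedness over to the Euclidean norm. *)
Lemma coord_le_norm u j : `|u 0 j| <= `|u|.
Proof.
have /mapP[k Hk ->] : `|u 0 j| \in [seq `|u x.1 x.2| | x : 'I_1 * 'I_n].
  by apply/mapP; exists (0, j) => //=; rewrite mem_enum.
by rewrite [leRHS]/Num.norm /= mx_normrE; apply/bigmax_geP; right => /=; exists k.
Qed.

Lemma norm_le_norm2 u : `|u| <= norm2 u.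
Proof.
rewrite [leLHS]/Num.norm /= mx_normrE; apply/bigmax_leP; split => [|i _].
  exact: norm2_ge0.
by rewrite (ord1 i.1) coord_le_norm2.
Qed.

Lemma norm2_le_norm u : norm2 u <= n.+1%:R * `|u|.
Proof.
apply: norm2_le; first by rewrite mulr_ge0.
rewrite dotxx (le_trans (norm2_le_coord (coord_le_norm u)))//.
rewrite exprMn ler_wpM2r ?sqr_ge0// -natrX ler_nat.
by rewrite (leq_trans (leqnSn n))// expnS expn1 leq_pmulr.
Qed.

Lemma norm2_lip u v : `|norm2 u - norm2 v| <= norm2 (u - v).
Proof.
have h1 : norm2 u <= norm2 (u - v) + norm2 v by have := norm2D (u - v) v; rewrite subrK.
have h2 : norm2 v <= norm2 (v - u) + norm2 u by have := norm2D (v - u) u; rewrite subrK.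
by rewrite norm2_sub in h2; rewrite ler_norml; lra.
Qed.

End Euclidean.

Section EuclideanTopology.
Variables (R : realType).

Lemma nbhs_norm2P n (x : 'rV[R]_n) (A : set 'rV[R]_n) :
  nbhs x A <-> exists2 r, 0 < r & forall y, norm2 (y - x) < r -> A y.
Proof.
split=> [/nbhs_ballP[r /= r0 rA]|[r r0 rA]].
  exists r => // y yx; apply: rA; rewrite -ball_normE /ball_/=.
  by rewrite (le_lt_trans (norm_le_norm2 _))// norm2_sub.
apply/nbhs_ballP; exists (r / n.+1%:R) => /=; first by rewrite divr_gt0.
move=> y; rewrite -ball_normE /ball_/= => xy; apply: rA.
rewrite norm2_sub (le_lt_trans (norm2_le_norm _))//.
by rewrite mulrC -ltr_pdivlMr.
Qed.

(** Every map that is Lipschitz for the Euclidean norms is continuous for the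
    sup-norm topology. *)
Lemma lip_continuous n p (h : 'rV[R]_n -> 'rV[R]_p) (L : R) :
  (forall x y, norm2 (h x - h y) <= L * norm2 (x - y)) -> continuous h.
Proof.
move=> hL x A /nbhs_norm2P[e e0 eA].
have L1 : 0 < `|L| + 1 by rewrite ltr_wpDl.
apply/nbhs_norm2P; exists (e / (`|L| + 1)) => [|y]; first by rewrite divr_gt0.
rewrite ltr_pdivlMr// => yx; apply: eA; apply: le_lt_trans (hL _ _) _.
rewrite mulrC; apply: le_lt_trans yx; rewrite mulrC [leRHS]mulrC.
by rewrite ler_wpM2r ?norm2_ge0// (le_trans (ler_norm L))// lerDl.
Qed.

Lemma lip_continuousR n (h : 'rV[R]_n -> R) (L : R) :
  (forall x y, `|h x - h y| <= L * norm2 (x - y)) -> continuous h.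
Proof.
move=> hL x A /nbhs_ballP[e /= e0 eA].
have L1 : 0 < `|L| + 1 by rewrite ltr_wpDl.
apply/nbhs_norm2P; exists (e / (`|L| + 1)) => [|y]; first by rewrite divr_gt0.
rewrite ltr_pdivlMr// => yx; apply: eA; rewrite -ball_normE /ball_ /=.
apply: le_lt_trans (hL _ _) _; rewrite norm2_sub.
apply: le_lt_trans yx; rewrite [leRHS]mulrC.
by rewrite ler_wpM2r ?norm2_ge0// (le_trans (ler_norm L))// lerDl.
Qed.

Lemma continuous_norm2_sub n (x : 'rV[R]_n) : continuous (fun y : 'rV[R]_n => norm2 (y - x)).
Proof.
apply: (@lip_continuousR _ _ 1) => y z; rewrite mul1r.
by rewrite (le_trans (norm2_lip _ _))// opprB addrA subrK.
Qed.

Lemma continuous_norm2 n : continuous (@norm2 R n).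
Proof.
by apply: (@lip_continuousR _ _ 1) => y z; rewrite mul1r norm2_lip.
Qed.

Lemma open_norm2_ball n (x : 'rV[R]_n) (r : R) :
  open [set y | norm2 (y - x) < r].
Proof.
rewrite openE => y /= yx; apply/nbhs_norm2P; exists (r - norm2 (y - x)).
  by rewrite subr_gt0.
move=> z zy /=; rewrite (le_lt_trans (norm2_dist _ y _))//.
by rewrite -ltrBrDr.
Qed.

Lemma closed_norm2_ball n (x : 'rV[R]_n) (r : R) :
  closed [set y | norm2 (y - x) <= r].
Proof.
rewrite (_ : mkset _ = (fun y => norm2 (y - x)) @^-1` [set t | t <= r])//.
by apply: preimage_closed; [move=> y _; exact: continuous_norm2_sub|exact: closed_le].
Qed.

Lemma closed_bounded_compact n (A : set 'rV[R]_n) (M : R) :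
  closed A -> (forall x, A x -> norm2 x <= M) -> compact A.
Proof.
move=> Acl AM; apply: bounded_closed_compact => //.
exists M; split; first exact: num_real.
move=> N MN x Ax; apply: le_trans (norm_le_norm2 x) _.
by apply: le_trans (AM _ Ax) _; exact: ltW.
Qed.

Lemma compact_norm2_bounded n (A : set 'rV[R]_n) :
  compact A -> exists M, forall x, A x -> norm2 x <= M.
Proof.
move=> /compact_bounded[M [_ AM]]; exists (n.+1%:R * (M + 1)) => x Ax.
apply: le_trans (norm2_le_norm x) _; rewrite ler_wpM2l//.
by apply: AM => //; rewrite ltrDl.
Qed.

(** A continuous function with bounded sublevel sets attains its minimum on
    every closed set: below the value at one point, only a compact set
    matters. *)
Lemma coercive_argmin n (h : 'rV[R]_n -> R) (A : set 'rV[R]_n) :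
  continuous h -> closed A -> A !=set0 ->
  (forall c, exists M, forall x, h x <= c -> norm2 x <= M) ->
  exists2 x, A x & forall y, A y -> h x <= h y.
Proof.
move=> hc Acl [x0 Ax0] hM; have [M hxM] := hM (h x0).
pose B := A `&` [set x | h x <= h x0].
have Bcl : closed B.
  apply: closedI => //; rewrite (_ : mkset _ = h @^-1` [set t | t <= h x0])//.
  by apply: preimage_closed; [move=> ? _; exact: hc|exact: closed_le].
have Bcpt : compact B by apply: (closed_bounded_compact (M := M)) => // x [_ /hxM].
have [] := @EVT_min_rV _ _ h B _ Bcpt.
- by exists x0; split => //=; rewrite lexx.
- exact: continuous_subspaceT.
move=> c; rewrite inE => -[Ac /= cx0] cmin; exists c => // y Ay.
have [yx0|yx0] := leP (h y) (h x0); first by apply: cmin; rewrite inE.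
by rewrite (le_trans cx0)// ltW.
Qed.

End EuclideanTopology.

(** * Landscape of a function that is strongly convex where its gradient is small *)

Section Landscape.
Variables (R : realType) (N : nat).
Variables (Q : 'rV[R]_N -> R) (g : 'rV[R]_N -> 'rV[R]_N).
Variables (Lq eps mu : R).
Hypothesis Lq_gt0 : 0 < Lq.
Hypothesis eps_gt0 : 0 < eps.
Hypothesis mu_gt0 : 0 < mu.
Hypothesis Q_cont : continuous Q.
Hypothesis g_lip : forall x y, norm2 (g x - g y) <= Lq * norm2 (x - y).
Hypothesis Q_quad : forall x y,
  Q y <= Q x + dot (g x) (y - x) + Lq / 2 * norm2 (y - x) ^+ 2.
Hypothesis Q_coercive : forall c, exists M, forall x, Q x <= c -> norm2 x <= M.
(** Strong convexity is local, around the points of small gradient: as the set of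
    these points may be disconnected, several minima are not yet excluded. *)
Hypothesis Q_convex : forall x, norm2 (g x) < eps ->
  exists2 r, 0 < r & forall y z, norm2 (y - x) < r -> norm2 (z - x) < r ->
    Q z + dot (g z) (y - z) + mu / 2 * norm2 (y - z) ^+ 2 <= Q y.

Let g_cont : continuous g.
Proof. exact: lip_continuous g_lip. Qed.

Let ng_cont : continuous (fun x => norm2 (g x)).
Proof. by move=> x; apply: continuous_comp; [exact: g_cont|exact: continuous_norm2]. Qed.

Lemma descent_step x t : 0 <= t <= Lq^-1 ->
  Q (x - t *: g x) <= Q x - t / 2 * norm2 (g x) ^+ 2.
Proof.
move=> /andP[t0 tL]; have := Q_quad x (x - t *: g x).
have -> : x - t *: g x - x = - (t *: g x) by rewrite addrAC subrr add0r.
rewrite dotNr dotZr dotxx norm2N norm2Z ger0_norm// exprMn.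
have tL1 : Lq * t <= 1 by rewrite mulrC -ler_pdivlMr// mul1r.
have : 0 <= (1 - Lq * t) * (t * norm2 (g x) ^+ 2 / 2).
  by rewrite mulr_ge0 ?subr_ge0// divr_ge0// mulr_ge0// sqr_ge0.
by set s := norm2 _ ^+ 2 => h1 h2; nra.
Qed.

Lemma local_monotone x : norm2 (g x) < eps -> exists2 r, 0 < r &
  forall y z, norm2 (y - x) < r -> norm2 (z - x) < r ->
    mu * norm2 (y - z) ^+ 2 <= dot (g y - g z) (y - z).
Proof.
move=> /Q_convex[r r0 rP]; exists r => // y z yr zr.
have := rP _ _ yr zr; have := rP _ _ zr yr.
by rewrite (norm2_sub z y) dotBl -(opprB y z) dotNr; lra.
Qed.

(** Where the Hessian is at least mu, moving along the antigradient shrinks the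
    gradient. *)
Lemma grad_shrink x : norm2 (g x) < eps -> exists2 t0, 0 < t0 &
  forall t, 0 < t < t0 -> norm2 (g (x - t *: g x)) ^+ 2 <=
    (1 - 2 * mu * t + Lq ^+ 2 * t ^+ 2) * norm2 (g x) ^+ 2.
Proof.
move=> /[dup] gx /local_monotone[r r0 rP].
have ge0 := norm2_ge0 (g x).
have ge1 : 0 < norm2 (g x) + 1 by lra.
exists (r / (norm2 (g x) + 1)); first by rewrite divr_gt0.
move=> t /andP[t0]; rewrite ltr_pdivlMr// => tr.
pose y := x - t *: g x; rewrite -/y.
have yx : y - x = - (t *: g x) by rewrite /y addrAC subrr add0r.
have nyx : norm2 (y - x) = t * norm2 (g x).
  by rewrite yx norm2N norm2Z gtr0_norm.
have mono : mu * norm2 (y - x) ^+ 2 <= dot (g y - g x) (y - x).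
  by apply: rP; rewrite ?subrr ?norm2_0// nyx; nra.
rewrite nyx yx dotNr dotZr exprMn in mono.
have lip := g_lip y x; rewrite nyx in lip.
have lip2 : norm2 (g y - g x) ^+ 2 <= Lq ^+ 2 * t ^+ 2 * norm2 (g x) ^+ 2.
  rewrite -mulrA -!exprMn ler_pXn2r// nnegrE ?norm2_ge0//.
  by rewrite mulr_ge0 ?mulr_ge0// ltW.
have -> : g y = g x + (g y - g x) by rewrite addrC subrK.
rewrite sqr_norm2D dotC.
have mono' : mu * (t * norm2 (g x) ^+ 2) <= - dot (g y - g x) (g x).
  by rewrite -(ler_pM2l t0); move: mono; lra.
by move: lip2 mono'; set s := norm2 (g x) ^+ 2; lra.
Qed.

Lemma minimum : exists2 x, g x = 0 & forall y, Q x <= Q y.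
Proof.
have [|x _ xmin] := coercive_argmin Q_cont closedT _ Q_coercive.
  by exists 0.
exists x => [|y]; last exact: xmin.
have := descent_step x (t := Lq^-1); rewrite lexx invr_ge0 ltW// => /(_ isT).
have := xmin (x - Lq^-1 *: g x) I => /[swap] h1 h2.
have : Lq^-1 / 2 * norm2 (g x) ^+ 2 <= 0 by lra.
rewrite pmulr_rle0 ?divr_gt0 ?invr_gt0// => h3.
by apply/norm2_eq0/eqP; rewrite -sqrf_eq0 eq_le h3 sqr_ge0.
Qed.

(** A finite-dimensional mountain-pass argument.  The gradient descent map sends
    a neighbourhood of each critical point into itself, and such neighbourhoods
    are disjoint.  Every orbit enters one of them, since outside of them the
    gradient is bounded away from 0 on each sublevel set.  The basins are thus
    open and partition a connected space. *)
Lemma critical_point_unique c c' : g c = 0 -> g c' = 0 -> c = c'.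
Proof.
move=> gc gc'.
have /choice[r rP] : forall c, exists r : R, g c = 0 -> 0 < r /\
    forall y z, norm2 (y - c) < r -> norm2 (z - c) < r ->
    Q z + dot (g z) (y - z) + mu / 2 * norm2 (y - z) ^+ 2 <= Q y.
  move=> x; have [gx|gx] := pselect (g x = 0); last by exists 0.
  by have [|s s0 sP] := Q_convex (x := x); [rewrite gx norm2_0|exists s].
pose S x := x - Lq^-1 *: g x.
(* The trap U c is a ball on which Q grows quadratically away from c, cut at the
   level that this growth guarantees on the boundary of the ball. *)
pose U c := [set y | norm2 (y - c) < r c / 2] `&`
            [set y | Q y < Q c + mu / 2 * (r c / 2) ^+ 2].
have Uself x : g x = 0 -> U x x.
  move=> /rP[rx _]; split => /=; first by rewrite subrr norm2_0 divr_gt0.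
  by rewrite ltrDl mulr_gt0 ?exprn_gt0 ?divr_gt0.
have Uopen x : open (U x).
  apply: openI; first exact: open_norm2_ball.
  rewrite (_ : mkset _ = Q @^-1` [set t | t < Q x + mu / 2 * (r x / 2) ^+ 2])//.
  by apply: open_comp; [move=> ? _; exact: Q_cont|exact: open_lt].
have growth x y : g x = 0 -> norm2 (y - x) < r x ->
    Q x + mu / 2 * norm2 (y - x) ^+ 2 <= Q y.
  move=> gx yx; have [rx /(_ y x yx)] := rP _ gx.
  by rewrite subrr norm2_0 gx dot0l addr0; apply.
have QS y : Q (S y) <= Q y - Lq^-1 / 2 * norm2 (g y) ^+ 2.
  by apply: descent_step; rewrite lexx invr_ge0 ltW.
have QS' y : Q (S y) <= Q y.
  by rewrite (le_trans (QS _))// gerBl mulr_ge0 ?sqr_ge0// divr_ge0// invr_ge0 ltW.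
(* The step moves y by at most its distance to c, hence stays within twice the
   radius of the trap, where the level of Q still forces y back into it. *)
have Uinv x y : g x = 0 -> U x y -> U x (S y).
  move=> gx [/= yx Qy]; have [rx _] := rP _ gx.
  have Sx : norm2 (S y - x) < r x.
    rewrite (le_lt_trans (norm2_dist _ y _))// {1}/S addrAC subrr add0r norm2N.
    rewrite norm2Z gtr0_norm ?invr_gt0//.
    have : Lq^-1 * norm2 (g y) <= norm2 (y - x).
      by rewrite ler_pdivrMl//; have := g_lip y x; rewrite gx subr0.
    by lra.
  have QSy := le_lt_trans (QS' y) Qy; split => //=.
  have := le_lt_trans (growth _ _ gx Sx) QSy.
  by rewrite ltrD2l ltr_pM2l ?divr_gt0// ltr_pXn2r ?nnegrE ?norm2_ge0// divr_ge0// ltW.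
have uniq_in x x' : g x = 0 -> g x' = 0 -> norm2 (x' - x) < r x -> x = x'.
  move=> gx gx' xx'; have [rx _] := rP _ gx; have [_ mono] := rP _ gx.
  have := growth _ _ gx xx'; have := mono x x'.
  rewrite subrr norm2_0 (norm2_sub x x') gx' dot0l => /(_ rx xx') h1 h2.
  have : mu * norm2 (x' - x) ^+ 2 <= 0 by lra.
  rewrite pmulr_rle0// => h3; apply/eqP; rewrite eq_sym -subr_eq0; apply/eqP.
  by apply/norm2_eq0/eqP; rewrite -sqrf_eq0 eq_le h3 sqr_ge0.
have Uinj x x' y : g x = 0 -> g x' = 0 -> U x y -> U x' y -> x = x'.
  wlog rr : x x' / r x' <= r x.
    move=> h gx gx' Ux Ux'; have [rr|/ltW rr] := leP (r x') (r x); first exact: h.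
    by apply/esym; exact: h.
  move=> gx gx' [/= xy _] [/= x'y _]; apply: uniq_in => //.
  by rewrite (le_lt_trans (norm2_dist _ y _))// (norm2_sub x'); lra.
pose orb k := iter k S.
have S_cont : continuous S.
  apply: (@lip_continuous _ _ _ _ 2) => x y.
  have -> : S x - S y = (x - y) - Lq^-1 *: (g x - g y).
    by rewrite /S opprD addrACA -opprD scalerBr.
  rewrite (le_trans (norm2B _ _))// norm2Z gtr0_norm ?invr_gt0//.
  have : Lq^-1 * norm2 (g x - g y) <= norm2 (x - y) by rewrite ler_pdivrMl.
  by lra.
have orb_cont k : continuous (orb k).
  elim: k => [|k IH] x; first exact: cvg_id.
  by apply: (@continuous_comp _ _ _ (orb k) S); [exact: IH|exact: S_cont].
have orbU x y k j : g x = 0 -> U x (orb k y) -> U x (orb (j + k)%N y).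
  by move=> gx Uk; elim: j => //= j IH; exact: Uinv.
pose basin x := [set y | exists k, U x (orb k y)].
have basin_open x : open (basin x).
  rewrite openE => y [k Uk].
  have : nbhs y (orb k @^-1` U x).
    by apply: orb_cont; exact: open_nbhs_nbhs.
  by apply: filterS => z Uz; exists k.
have basin_inj x x' y : g x = 0 -> g x' = 0 -> basin x y -> basin x' y -> x = x'.
  move=> gx gx' [k Uk] [k' Uk']; apply: (Uinj _ _ (orb (k' + k)%N y)) => //.
    exact: orbU.
  by rewrite addnC; exact: orbU.
have [xm _ Qmin] := minimum.
(* An orbit avoiding all traps would stay in a compact set without critical point,
   and Q would decrease by a fixed amount at each step. *)
have cover y : exists2 x, g x = 0 & basin x y.
  apply: contrapT => nbasin.
  pose K := [set z | Q z <= Q y] `&` ~` \bigcup_(x in [set x | g x = 0]) U x.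
  have Korb k : K (orb k y).
    split=> [/=|[x gx Ux]]; last by apply: nbasin; exists x => //; exists k.
    by elim: k => //= k IH; rewrite (le_trans (QS' _)).
  have Kcl : closed K.
    apply: closedI.
      rewrite (_ : mkset _ = Q @^-1` [set t | t <= Q y])//.
      by apply: preimage_closed; [move=> ? _; exact: Q_cont|exact: closed_le].
    by apply: open_closedC; apply: bigcup_open => x _; exact: Uopen.
  have [M yM] := Q_coercive (Q y).
  have Kcpt : compact K by apply: (closed_bounded_compact (M := M)) => // z [/yM].
  have [||z] := @EVT_min_rV _ _ (fun z => norm2 (g z)) K _ Kcpt.
  - by exists y; exact: (Korb 0%N).
  - by apply: continuous_subspaceT; exact: ng_cont.
  rewrite inE => -[_ Kz] zmin.
  have gz : g z != 0 by apply/eqP => gz; apply: Kz; exists z => //; exact: Uself.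
  have d0 : 0 < Lq^-1 / 2 * norm2 (g z) ^+ 2.
    by rewrite mulr_gt0 ?divr_gt0 ?invr_gt0// exprn_gt0 ?norm2_gt0.
  have Qorb k : Q (orb k y) <= Q y - k%:R * (Lq^-1 / 2 * norm2 (g z) ^+ 2).
    elim: k => [|k IH]; first by rewrite mul0r subr0.
    apply: le_trans (QS _) _.
    have : norm2 (g z) <= norm2 (g (orb k y)) by apply: zmin; rewrite inE.
    rewrite -(@ler_pXn2r _ 2)// ?nnegrE ?norm2_ge0//.
    rewrite -(ler_pM2l (_ : 0 < Lq^-1 / 2)) ?divr_gt0 ?invr_gt0//.
    by move: IH; rewrite -[k.+1]addn1 natrD mulrDl mul1r; set u := _ * norm2 (g z) ^+ 2; lra.
  have Qk k : k%:R * (Lq^-1 / 2 * norm2 (g z) ^+ 2) <= Q y - Q xm.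
    by have := Qorb k; have := Qmin (orb k y); lra.
  have Qym : 0 <= Q y - Q xm by rewrite subr_ge0.
  have := archi_boundP (divr_ge0 Qym (ltW d0)); rewrite ltr_pdivrMr//.
  by rewrite ltNge Qk.
(* On the segment from c to c', the basin of c is open, and it is closed as the
   complement of the other basins. *)
pose p (t : R) := c + t *: (c' - c).
have p_cont : continuous p.
  move=> t A /nbhs_norm2P[e e0 eA].
  have nc := norm2_ge0 (c' - c).
  have nc1 : 0 < norm2 (c' - c) + 1 by lra.
  apply/nbhs_ballP; exists (e / (norm2 (c' - c) + 1)) => /=; first by rewrite divr_gt0.
  move=> s; rewrite -ball_normE /ball_ /= ltr_pdivlMr// => ts; apply: eA.
  rewrite /p opprD addrACA subrr add0r -scalerBl norm2Z distrC.
  by apply: le_lt_trans ts; rewrite ler_wpM2l// lerDl.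
have pre_open (B : set 'rV[R]_N) : open B -> open (p @^-1` B).
  by move=> Bo; apply: open_comp => // t _; exact: p_cont.
have : (`[0, 1] `&` p @^-1` basin c = `[0, 1])%classic.
  apply: (@segment_connected R 0 1).
  - exists 0; split; first by rewrite /= in_itv/= lexx ler01.
    by exists 0%N; rewrite /= /p scale0r addr0; exact: Uself.
  - by exists (p @^-1` basin c) => //; exact: pre_open.
  exists (~` (p @^-1` \bigcup_(x in [set x | g x = 0 /\ x <> c]) basin x)).
    by apply: open_closedC; apply: pre_open; apply: bigcup_open => x _.
  apply/seteqP; split => t [t01 tp]; split => //.
    by move=> [x [gx xc] xt]; apply: xc; exact: basin_inj xt tp.
  have [x gx xt] := cover (p t); have [<-//|xc] := eqVneq x c.
  by exfalso; apply: tp; exists x => //; split => //; exact/eqP.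
move=> /seteqP[_ /(_ 1)]; rewrite /= in_itv/= lexx ler01 => /(_ isT)[_].
rewrite /p scale1r addrC subrK => cc'; apply: (basin_inj _ _ c') => //.
by exists 0%N; exact: Uself.
Qed.

(** Ekeland's principle for the norm of the gradient: if no critical point were
    that close to x, then the gradient could still be shrunk at a rate that pays
    for the way. *)
Lemma critical_point_near x : norm2 (g x) < eps ->
  exists2 y, g y = 0 & norm2 (x - y) <= 2 * norm2 (g x) / mu.
Proof.
move=> gx; pose h y := norm2 (g y) + mu / 2 * norm2 (y - x).
have h_cont : continuous h.
  apply: (@lip_continuousR _ _ _ (Lq + mu / 2)) => y z.
  rewrite /h opprD addrACA (le_trans (ler_normD _ _))// mulrDl lerD//.
    by rewrite (le_trans (norm2_lip _ _)).
  rewrite -mulrBr normrM gtr0_norm ?divr_gt0// ler_pM2l ?divr_gt0//.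
  by rewrite (le_trans (norm2_lip _ _))// opprB addrA subrK.
have h_coer a : exists M, forall y, h y <= a -> norm2 y <= M.
  exists (norm2 x + 2 * a / mu) => y; rewrite /h => hy.
  have ge0 := norm2_ge0 (g y).
  have : norm2 (y - x) <= 2 * a / mu.
    by rewrite ler_pdivlMr//; lra.
  by have := norm2D (y - x) x; rewrite subrK; lra.
have [|y _ ymin] := coercive_argmin h_cont closedT _ h_coer; first by exists x.
have := ymin x I; rewrite /h subrr norm2_0 mulr0 addr0 => hyx.
have nyx := norm2_ge0 (y - x); have ny0 := norm2_ge0 (g y).
have gy : norm2 (g y) < eps.
  have : 0 <= mu / 2 * norm2 (y - x) by rewrite mulr_ge0// divr_ge0// ltW.
  by lra.
exists y; last first.
  by rewrite norm2_sub ler_pdivlMr//; lra.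
apply: contrapT => /eqP gy0.
have ngy : 0 < norm2 (g y) by exact: norm2_gt0.
have [t0 t00 t0P] := grad_shrink gy.
pose t := Num.min (t0 / 2) (Num.min mu^-1 (mu / (2 * Lq ^+ 2))).
have t_gt0 : 0 < t.
  by rewrite /t !lt_min; apply/and3P; split; rewrite ?invr_gt0 ?divr_gt0// mulr_gt0 ?exprn_gt0.
have tmu : mu * t <= 1.
  by rewrite mulrC -ler_pdivlMr// mul1r /t !ge_min lexx orbT.
have tt0 : t < t0 by rewrite gt_min; apply/orP; left; lra.
have tL : Lq ^+ 2 * t <= mu / 2.
  have : t <= mu / (2 * Lq ^+ 2) by rewrite !ge_min lexx !orbT.
  rewrite ler_pdivlMr ?mulr_gt0 ?exprn_gt0//; lra.
have := t0P t; rewrite t_gt0 tt0 => /(_ isT) shrink.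
pose z := y - t *: g y.
have gz : norm2 (g z) <= (1 - 3 / 4 * mu * t) * norm2 (g y).
  rewrite -(@ler_pXn2r _ 2)// ?nnegrE ?norm2_ge0//; last first.
    by rewrite mulr_ge0//; lra.
  apply: le_trans shrink _; rewrite exprMn ler_wpM2r ?sqr_ge0//.
  have := ler_wpM2r (ltW t_gt0) tL; have := sqr_ge0 (3 / 4 * mu * t).
  lra.
have := ymin z I; rewrite leNgt => /negP; apply.
rewrite /h; have zx : norm2 (z - x) <= t * norm2 (g y) + norm2 (y - x).
  rewrite (le_trans (norm2_dist _ y _))// lerD2r /z addrAC subrr add0r.
  by rewrite norm2N norm2Z gtr0_norm.
have := mulr_gt0 (mulr_gt0 mu_gt0 t_gt0) ngy.
have : mu / 2 * norm2 (z - x) <= mu / 2 * (t * norm2 (g y) + norm2 (y - x)).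
  by rewrite ler_wpM2l// divr_ge0// ltW.
by move: gz; lra.
Qed.

Variable xs : 'rV[R]_N.
Hypothesis g_xs : g xs = 0.

Lemma minimum_xs x : Q xs <= Q x.
Proof. by have [y gy ymin] := minimum; rewrite (critical_point_unique g_xs gy). Qed.

Lemma error_bound x : norm2 (g x) < eps -> norm2 (x - xs) <= 2 * norm2 (g x) / mu.
Proof.
by move=> /critical_point_near[y gy]; rewrite (critical_point_unique g_xs gy).
Qed.

(** A Polyak-Lojasiewicz inequality: along the antigradient flow, the squared
    gradient norm divided by mu decreases faster than Q, so that the difference of
    both is minimal at the critical point only. *)
Lemma gap_le_grad x : norm2 (g x) < eps -> Q x - Q xs <= norm2 (g x) ^+ 2 / mu.
Proof.
move=> gx; pose h y := norm2 (g y) ^+ 2 / mu - Q y.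
pose A := [set y | norm2 (g y) <= norm2 (g x)].
have Acl : closed A.
  rewrite (_ : A = (fun y => norm2 (g y)) @^-1` [set t | t <= norm2 (g x)])//.
  by apply: preimage_closed; [move=> ? _; exact: ng_cont|exact: closed_le].
have Acpt : compact A.
  apply: (closed_bounded_compact (M := norm2 xs + 2 * norm2 (g x) / mu)) => // y Ay.
  have := norm2D (y - xs) xs; rewrite subrK.
  have := error_bound (le_lt_trans Ay gx).
  have : 2 * norm2 (g y) / mu <= 2 * norm2 (g x) / mu.
    by rewrite ler_pM2r ?invr_gt0// ler_pM2l.
  lra.
have h_cont : continuous h.
  have c1 : continuous ((fun y => norm2 (g y)) \* (fun y => norm2 (g y)) \* cst mu^-1).
    move=> y; apply: continuousM; last exact: cst_continuous.
    by apply: continuousM; exact: ng_cont.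
  by move=> y; exact: (continuousB (c1 y) (@Q_cont y)).
have [||y] := @EVT_min_rV _ _ h A _ Acpt.
- by exists x; exact: lexx.
- exact: continuous_subspaceT.
rewrite inE => Ay ymin; have gy := le_lt_trans Ay gx.
have [gy0|gy0] := pselect (g y = 0).
  have := ymin x; rewrite inE (critical_point_unique g_xs gy0) => /(_ (lexx _)).
  by rewrite /h -(critical_point_unique g_xs gy0) g_xs norm2_0 expr0n mul0r; lra.
have ngy : 0 < norm2 (g y) by apply: norm2_gt0; exact/eqP.
have [t0 t00 t0P] := grad_shrink gy.
(* Short enough for the first-order gain to dominate the quadratic remainders. *)
pose t := Num.min (t0 / 2) (mu / (4 * Lq ^+ 2 + 4 * Lq * mu)).
have den : 0 < 4 * Lq ^+ 2 + 4 * Lq * mu.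
  by rewrite addr_gt0 ?mulr_gt0// exprn_gt0.
have t_gt0 : 0 < t by rewrite /t lt_min !divr_gt0.
have tt0 : t < t0 by rewrite gt_min; apply/orP; left; lra.
have tL : 4 * (Lq ^+ 2 * t) + 4 * (Lq * mu * t) <= mu.
  have : t <= mu / (4 * Lq ^+ 2 + 4 * Lq * mu) by rewrite /t ge_min lexx orbT.
  by rewrite ler_pdivlMr//; lra.
have Lt : 0 < Lq * mu * t by rewrite !mulr_gt0.
have L2t : 0 < Lq ^+ 2 * t by rewrite mulr_gt0// exprn_gt0.
have := t0P t; rewrite t_gt0 tt0 => /(_ isT) shrink.
pose z := y - t *: g y; rewrite -/z in shrink.
have s0 : 0 < norm2 (g y) ^+ 2 by rewrite exprn_gt0.
have zA : z \in A.
  rewrite inE; apply: le_trans _ Ay.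
  rewrite -(@ler_pXn2r _ 2)// ?nnegrE ?norm2_ge0//.
  apply: le_trans shrink _; rewrite ler_piMl ?ltW//.
  have := ler_wpM2r (ltW t_gt0) tL; have := mulr_gt0 mu_gt0 t_gt0.
  have := mulr_gt0 Lt t_gt0.
  lra.
have := ymin z zA; rewrite leNgt => /negP[].
have yz : y - z = t *: g y by rewrite /z opprB addrC subrK.
have := Q_quad z y; rewrite yz dotZr norm2Z gtr0_norm// exprMn => Qy.
have gzy : dot (g z) (g y) <= norm2 (g y) ^+ 2.
  apply: le_trans (cauchy_schwarz _ _) _; rewrite expr2 ler_pM2r//.
  rewrite -(@ler_pXn2r _ 2)// ?nnegrE ?norm2_ge0//.
  apply: le_trans shrink _; rewrite ler_piMl ?ltW//.
  have := ler_wpM2r (ltW t_gt0) tL; have := mulr_gt0 mu_gt0 t_gt0.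
  by have := mulr_gt0 Lt t_gt0; lra.
rewrite /h.
have : norm2 (g z) ^+ 2 / mu <= (1 - 2 * mu * t + Lq ^+ 2 * t ^+ 2) * norm2 (g y) ^+ 2 / mu.
  by rewrite ler_pM2r ?invr_gt0.
rewrite [leRHS](_ : _ = norm2 (g y) ^+ 2 / mu - 2 * t * norm2 (g y) ^+ 2 +
  Lq ^+ 2 * t / mu * (t * norm2 (g y) ^+ 2)); last by field; lra.
have Ltmu : Lq ^+ 2 * t / mu <= 1 / 4 by rewrite ler_pdivrMr//; lra.
have Lt2 : Lq * t <= 1 / 4.
  by rewrite -(ler_pM2r mu_gt0); lra.
have ts : 0 < t * norm2 (g y) ^+ 2 by rewrite mulr_gt0.
have := ler_wpM2l (ltW t_gt0) gzy.
have := ler_wpM2r (ltW ts) Ltmu; have := ler_wpM2r (ltW ts) Lt2.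
by lra.
Qed.

(** Ekeland's principle for Q: some point within (Q x - Q xs) / th of x has a
    gradient of norm at most th, and is thus covered by error_bound. *)
Lemma dist_le_gap x th : 0 < th < eps ->
  norm2 (x - xs) <= (Q x - Q xs) / th + 2 * th / mu.
Proof.
move=> /andP[th0 the]; pose h y := Q y + th * norm2 (y - x).
have h_cont : continuous h.
  have c1 : continuous (cst th \* (fun y : 'rV[R]_N => norm2 (y - x))).
    move=> y; apply: continuousM; first exact: cst_continuous.
    exact: continuous_norm2_sub.
  by move=> y; exact: (continuousD (@Q_cont y) (c1 y)).
have h_coer a : exists M, forall y, h y <= a -> norm2 y <= M.
  have [M aM] := Q_coercive a; exists M => y; rewrite /h => hy; apply: aM.
  by have := mulr_ge0 (ltW th0) (norm2_ge0 (y - x)); lra.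
have [|y _ ymin] := coercive_argmin h_cont closedT _ h_coer; first by exists x.
have := ymin x I; rewrite /h subrr norm2_0 mulr0 addr0 => hyx.
have gy : norm2 (g y) <= th.
  rewrite leNgt; apply/negP => gy.
  have ny0 : 0 < norm2 (g y) by exact: lt_trans gy.
  pose t := Num.min Lq^-1 ((norm2 (g y) - th) / (Lq * norm2 (g y))).
  have t_gt0 : 0 < t by rewrite /t lt_min invr_gt0 Lq_gt0 divr_gt0 ?subr_gt0 ?mulr_gt0.
  have tL : t * (Lq * norm2 (g y)) <= norm2 (g y) - th.
    by rewrite -ler_pdivlMr ?mulr_gt0// /t ge_min lexx orbT.
  pose z := y - t *: g y.
  have zy : z - y = - (t *: g y) by rewrite /z addrAC subrr add0r.
  have nzy : norm2 (z - y) = t * norm2 (g y) by rewrite zy norm2N norm2Z gtr0_norm.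
  have := Q_quad y z; rewrite nzy zy dotNr dotZr dotxx => Qz.
  have := ymin z I; rewrite /h leNgt => /negP; apply.
  have := norm2_dist z y x; rewrite nzy => zx.
  have := ler_wpM2l (ltW th0) zx.
  have tg : 0 < t * norm2 (g y) by rewrite mulr_gt0.
  have := ler_wpM2l (ltW tg) tL.
  have := mulr_gt0 tg (_ : 0 < norm2 (g y) - th); rewrite subr_gt0 => /(_ gy).
  by move: Qz; lra.
have := error_bound (le_lt_trans gy the).
have : 2 * norm2 (g y) / mu <= 2 * th / mu by rewrite ler_pM2r ?invr_gt0// ler_pM2l.
have : norm2 (y - x) <= (Q x - Q xs) / th.
  by rewrite ler_pdivlMr//; have := minimum_xs y; lra.
by have := norm2_dist x y xs; rewrite (norm2_sub x y); lra.
Qed.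

End Landscape.

(** * Second-order calculus on row vectors *)

Section Calculus.
Variables (R : realType) (n : nat).
Implicit Types (h : 'rV[R]_n -> R) (x y z u v w : 'rV[R]_n).

(** The mean value theorem for p minus its quadratic minorant. *)
Lemma taylor1_ge (p q : R -> R) (k : R) :
  (forall t : R, 0 <= t <= 1 -> is_derive t 1 p (q t)) ->
  (forall t : R, 0 <= t <= 1 -> q 0 + k * t <= q t) ->
  p 0 + q 0 + k / 2 <= p 1.
Proof.
move=> dp qk.
pose r t := p t - (q 0 * t + k / 2 * t ^+ 2).
have dr (t : R) : 0 <= t <= 1 -> is_derive t 1 r (q t - (q 0 + k * t)).
  move=> /dp dpt; apply: is_deriveB.
  apply: is_derive_eq.
  by rewrite /GRing.scale/= !mulr1; lra.
have [|||c c01] := @MVT_segment R r (fun t => q t - (q 0 + k * t)) 0 1.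
- exact: ler01.
- by move=> t; rewrite in_itv /= => /andP[t0 t1]; apply: dr; rewrite !ltW.
- by apply: derivable_within_continuous => t; rewrite in_itv/= => /dr[].
rewrite in_itv/= in c01; have := qk _ c01.
by rewrite /r; lra.
Qed.

Lemma derive_dot h x v : differentiable h x -> 'D_v h x = dot (grad h x) v.
Proof.
move=> dh; rewrite deriveE// {1}(row_sum_delta v) linear_sum.
by apply: eq_bigr => j _; rewrite linearZ /= mxE /partial deriveE// mulrC.
Qed.

Lemma is_derive_line h x v (t : R) : differentiable h (x + t *: v) ->
  is_derive t 1 (fun s => h (x + s *: v)) (dot (grad h (x + t *: v)) v).
Proof.
move=> dh.
have E : (fun e : R => e^-1 *: (h (x + (e *: (1 : R) + t) *: v) - h (x + t *: v))) =
    (fun e : R => e^-1 *: (h (e *: v + (x + t *: v)) - h (x + t *: v))).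
  apply/funext => e; congr (_ *: (h _ - _)).
  by rewrite /GRing.scale/= mulr1 -/(GRing.scale _ _) scalerDl addrCA.
split.
  by rewrite /derivable /= E; exact: (@diff_derivable _ _ _ h _ v dh).
by rewrite -derive_dot// /derive /= E.
Qed.

Lemma dot_mulmx (A : 'M[R]_n) v w :
  dot (v *m A) w = \sum_j w 0 j * \sum_i v 0 i * A i j.
Proof. by apply: eq_bigr => j _; rewrite mxE mulrC. Qed.

Lemma is_derive_grad_line h x v w (t : R) :
  (forall i y, differentiable (partial i h) y) ->
  is_derive t 1 (fun s => dot (grad h (x + s *: v)) w)
                (dot (v *m hess h (x + t *: v)) w).
Proof.
move=> dh.
have -> : (fun s => dot (grad h (x + s *: v)) w) =
    \sum_j (w 0 j \*: (fun s => partial j h (x + s *: v))).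
  apply/funext => s; rewrite fct_sumE; apply: eq_bigr => j _ /=.
  by rewrite mxE mulrC.
rewrite dot_mulmx; apply: is_derive_sum => j; apply: is_deriveZ.
apply: is_derive_eq; first exact: is_derive_line.
by apply: eq_bigr => i _; rewrite !mxE mulrC.
Qed.

Lemma taylor_convex h (c : R) z v : smooth h ->
  (forall t : R, 0 <= t <= 1 -> c * norm2 v ^+ 2 <= dot (v *m hess h (z + t *: v)) v) ->
  h z + dot (grad h z) v + c / 2 * norm2 v ^+ 2 <= h (z + v).
Proof.
move=> [dh ddh _] hc.
have /= := @taylor1_ge (fun t => h (z + t *: v)) (fun t => dot (grad h (z + t *: v)) v)
  (c * norm2 v ^+ 2).
rewrite scale0r addr0 scale1r mulrAC; apply=> [t _|t /andP[t0 t1]].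
  exact: is_derive_line.
have [||s] := @MVT_segment R (fun t => dot (grad h (z + t *: v)) v)
  (fun t => dot (v *m hess h (z + t *: v)) v) 0 t t0.
  by move=> s _; exact: is_derive_grad_line.
  apply: derivable_within_continuous => s _.
  by have [] := is_derive_grad_line z v v s ddh.
rewrite in_itv /= => /andP[s0 st]; rewrite subr0 scale0r addr0 => /eqP.
rewrite subr_eq => /eqP ->; rewrite addrC lerD2r ler_wpM2r//.
by apply: hc; rewrite s0 (le_trans st).
Qed.

Lemma taylor_lipschitz h (L : R) x y : (forall z, differentiable h z) ->
  lipschitz_grad h L ->
  h y <= h x + dot (grad h x) (y - x) + L / 2 * norm2 (y - x) ^+ 2.
Proof.
move=> dh hL.
have /= := @taylor1_ge (- (fun t => h (x + t *: (y - x))))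
  (fun t => - dot (grad h (x + t *: (y - x))) (y - x)) (- L * norm2 (y - x) ^+ 2).
rewrite -[(- _ : R -> R) 0]/(- h _) -[(- _ : R -> R) 1]/(- h _).
rewrite scale0r addr0 scale1r [x + _]addrC subrK => H.
suff : - h x - dot (grad h x) (y - x) + - L * norm2 (y - x) ^+ 2 / 2 <= - h y by lra.
apply: H => [t _|t /andP[t0 t1]].
  by apply: is_deriveN; exact: is_derive_line.
rewrite mulNr mulNr -opprD lerN2 -lerBlDl -dotBl.
apply: le_trans (cauchy_schwarz _ _) _.
have := ler_wpM2r (norm2_ge0 (y - x)) (hL (x + t *: (y - x)) x).
rewrite addrAC subrr add0r norm2Z ger0_norm// => /le_trans; apply.
by rewrite le_eqVlt; apply/orP; left; apply/eqP; ring.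
Qed.

(** The second derivative along v is a limit of difference quotients of the
    gradient. *)
Lemma hess_ge_lipschitz h (L : R) x v : smooth h -> lipschitz_grad h L ->
  - L * norm2 v ^+ 2 <= dot (v *m hess h x) v.
Proof.
move=> [dh ddh _] hL.
have [dd] := is_derive_grad_line x v v 0 ddh; rewrite scale0r addr0 => <-.
rewrite /derive; apply: limr_ge; first exact: dd.
near=> t; rewrite /= addr0 scale0r addr0 -dotBl.
have t0 : t != 0 by near: t; exact: nbhs_dnbhs_neq.
have : `|dot (grad h (x + (t *: 1) *: v) - grad h x) v| <= L * `|t| * norm2 v ^+ 2.
  apply: le_trans (ler_dot _ _) _.
  have := ler_wpM2r (norm2_ge0 v) (hL (x + (t *: 1) *: v) x).
  rewrite addrAC subrr add0r norm2Z [_ *: 1]mulr1 => /le_trans; apply.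
  by rewrite le_eqVlt; apply/orP; left; apply/eqP; ring.
set d := dot _ _ => dL.
have : `|t^-1 *: d| <= L * norm2 v ^+ 2.
  rewrite /GRing.scale/= normrM normfV ler_pdivrMl ?normr_gt0//.
  by apply: le_trans dL _; rewrite le_eqVlt; apply/orP; left; apply/eqP; ring.
by rewrite ler_norml mulNr => /andP[].
Unshelve. all: by end_near. Qed.

Lemma not_close_to_both (a b c : R) :
  `|b - c| < `|a - b| / 2 -> `|a - c| < `|a - b| / 2 -> False.
Proof. by have := ler_normD (a - c) (c - b); rewrite addrA subrK (distrC c); lra. Qed.

Section Schwarz.
Variables (h : 'rV[R]_n -> R) (h_smooth : smooth h).

Let line x i j (s t : R) : x + s *: delta_mx 0 i + t *: delta_mx 0 j =
  x + t *: delta_mx 0 j + s *: delta_mx 0 i.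
Proof. by rewrite addrAC. Qed.

Let dline i x (t : R) : is_derive t 1 (fun s => h (x + s *: delta_mx 0 i))
  (partial i h (x + t *: delta_mx 0 i)).
Proof.
have [dh _ _] := h_smooth.
by apply: is_derive_eq; [exact: is_derive_line|rewrite dot_delta mxE].
Qed.

Let ddline i j x (t : R) : is_derive t 1 (fun s => partial j h (x + s *: delta_mx 0 i))
  (partial i (partial j h) (x + t *: delta_mx 0 i)).
Proof.
have [_ dh _] := h_smooth.
by apply: is_derive_eq; [exact: is_derive_line|rewrite dot_delta mxE].
Qed.

(** The mean value theorem, once in each direction. *)
Lemma second_difference i j x (s : R) : 0 < s ->
  exists2 y, norm2 (y - x) <= 2 * s &
    h (x + s *: delta_mx 0 i + s *: delta_mx 0 j) - h (x + s *: delta_mx 0 i) -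
    h (x + s *: delta_mx 0 j) + h x = s ^+ 2 * partial j (partial i h) y.
Proof.
move=> s0.
pose p t := h (x + s *: delta_mx 0 j + t *: delta_mx 0 i) - h (x + t *: delta_mx 0 i).
pose q t := partial i h (x + s *: delta_mx 0 j + t *: delta_mx 0 i) -
            partial i h (x + t *: delta_mx 0 i).
have dp (t : R) : is_derive t 1 p (q t) by apply: is_deriveB; exact: dline.
have [//||t t0s pt] := @MVT R p q 0 s.
  by apply: derivable_within_continuous => t _; have [] := dp t.
pose p' r := partial i h (x + t *: delta_mx 0 i + r *: delta_mx 0 j).
have [//|||r r0s pr] := @MVT R p'
    (fun r => partial j (partial i h) (x + t *: delta_mx 0 i + r *: delta_mx 0 j)) 0 s.
- by move=> r _; exact: ddline.
- by apply: derivable_within_continuous => r _; have [] := ddline j i (x + t *: delta_mx 0 i) r.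
exists (x + t *: delta_mx 0 i + r *: delta_mx 0 j).
  rewrite [_ - x]addrC !addrA addNr add0r (le_trans (norm2D _ _))// !norm2Z.
  have nd k : norm2 (delta_mx 0 k : 'rV[R]_n) = 1.
    by apply/eqP; rewrite -(@eqrXn2 _ 2)// ?norm2_ge0// -dotxx dot_delta mxE !eqxx expr1n.
  rewrite !nd !mulr1; move: t0s r0s; rewrite !in_itv/= => /andP[t0 ts] /andP[r0 rs].
  by rewrite !gtr0_norm//; lra.
move: pt; rewrite /p scale0r !addr0 subr0 (line _ j i).
rewrite /q (line _ j i) -/(p' s) (_ : partial i h (x + t *: _) = p' 0); last first.
  by rewrite /p' scale0r addr0.
by rewrite pr subr0 expr2; lra.
Qed.

(** Schwarz's theorem: both mixed derivatives are limits of the same second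
    difference quotient. *)
Lemma partialC i j x : partial i (partial j h) x = partial j (partial i h) x.
Proof.
have [_ _ hc] := h_smooth.
apply/eqP; rewrite -subr_eq0 -normr_eq0; apply/negP => /negP ne.
have e0 : 0 < `|partial i (partial j h) x - partial j (partial i h) x| by rewrite lt_def ne normr_ge0.
set e := `|_| in e0.
have near1 a b : exists2 r, 0 < r & forall y, norm2 (y - x) < r ->
    `|partial a (partial b h) x - partial a (partial b h) y| < e / 2.
  have : nbhs (partial a (partial b h) x) (ball (partial a (partial b h) x) (e / 2)).
    by apply: nbhsx_ballx; rewrite divr_gt0.
  move=> /(hc a b x)/nbhs_norm2P[r r0 rP]; by exists r.
have [r1 r10 P1] := near1 i j; have [r2 r20 P2] := near1 j i.
pose s := Num.min r1 r2 / 4.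
have s0 : 0 < s by rewrite divr_gt0// lt_min r10.
have s12 : Num.min r1 r2 <= r1 /\ Num.min r1 r2 <= r2.
  by rewrite !ge_min !lexx orbT.
have s1 : 2 * s < r1 by move: s12 s0 => [+ _]; rewrite /s; lra.
have s2 : 2 * s < r2 by move: s12 s0 => [_ +]; rewrite /s; lra.
have [y yx yE] := second_difference i j x s0.
have [z zx] := second_difference j i x s0.
rewrite (line x j i) => zE.
have : s ^+ 2 * partial j (partial i h) y = s ^+ 2 * partial i (partial j h) z.
  by apply: etrans (esym yE) _; apply: etrans zE; congr (_ + _); exact: addrAC.
move=> /(mulfI (lt0r_neq0 (exprn_gt0 _ s0))) yz.
have := P1 _ (le_lt_trans zx s1); have := P2 _ (le_lt_trans yx s2).
rewrite yz => h2 h1.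
exact: not_close_to_both h2 h1.
Qed.

Lemma hess_sym x : (hess h x)^T = hess h x.
Proof. by apply/matrixP => i j; rewrite !mxE partialC. Qed.

End Schwarz.

End Calculus.

(** * The smallest eigenvalue as a Rayleigh quotient *)

Section Rayleigh.
Variables (R : realType) (n : nat).
Implicit Types (A : 'M[R]_n) (v w : 'rV[R]_n).

Lemma continuous_sumR (I : Type) (r : seq I) (F : I -> 'rV[R]_n -> R) :
  (forall i, continuous (F i)) -> continuous (\sum_(i <- r) F i).
Proof.
move=> Fc; elim/big_ind : _ => //; first by move=> x; exact: cst_continuous.
by move=> p q pc qc x; exact: (continuousD (pc x) (qc x)).
Qed.

Lemma continuous_quadratic A : continuous (fun v => dot (v *m A) v).
Proof.
have -> : (fun v => dot (v *m A) v) =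
    \sum_j (\sum_i ((fun v : 'rV[R]_n => v 0 j) \* (cst (A i j) \* (fun v : 'rV[R]_n => v 0 i)))).
  apply/funext => v; rewrite dot_mulmx fct_sumE; apply: eq_bigr => j _.
  by rewrite fct_sumE mulr_sumr; apply: eq_bigr => i _ /=; congr (_ * _); rewrite mulrC.
apply: continuous_sumR => j; apply: continuous_sumR => i x.
apply: continuousM; first exact: coord_continuous.
by apply: continuousM; [exact: cst_continuous|exact: coord_continuous].
Qed.

Lemma dot_sym A v w : A^T = A -> dot (v *m A) w = dot (w *m A) v.
Proof.
move=> As; rewrite -!mulmx_trE -[in LHS](trmxK (v *m A *m w^T)) mxE.
by rewrite !trmx_mul trmxK As mulmxA.
Qed.

Lemma eigenvalue_dot A (l : R) : eigenvalue A l ->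
  exists2 v, v != 0 & dot (v *m A) v = l * norm2 v ^+ 2.
Proof. by move=> /eigenvalueP[v vA v0]; exists v => //; rewrite vA dotZl dotxx. Qed.

(** The minimum of the quadratic form over the unit sphere is attained at an
    eigenvector. *)
Lemma lambda_min_rayleigh A v : (0 < n)%N -> A^T = A ->
  lambda_min A * norm2 v ^+ 2 <= dot (v *m A) v.
Proof.
move=> n0 As.
pose S := [set v : 'rV[R]_n | norm2 v = 1].
have nd k : norm2 (delta_mx 0 k : 'rV[R]_n) = 1.
  by apply/eqP; rewrite -(@eqrXn2 _ 2)// ?norm2_ge0// -dotxx dot_delta mxE !eqxx expr1n.
have Scl : closed S.
  rewrite (_ : S = @norm2 R n @^-1` [set t | t = 1])//.
  by apply: preimage_closed; [move=> ? _; exact: continuous_norm2|exact: closed_eq].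
have Scpt : compact S by apply: (closed_bounded_compact (M := 1)) => // w ->.
have [||w] := @EVT_min_rV _ _ (fun v => dot (v *m A) v) S _ Scpt.
- by exists (delta_mx 0 (Ordinal n0)); exact: nd.
- by apply: continuous_subspaceT; exact: continuous_quadratic.
rewrite inE => Sw wmin; pose l := dot (w *m A) w.
have lP u : l * norm2 u ^+ 2 <= dot (u *m A) u.
  have [->|u0] := eqVneq u 0; first by rewrite norm2_0 expr0n mulr0 mul0mx dot0l.
  have nu := norm2_gt0 u0.
  have : l <= dot (((norm2 u)^-1 *: u) *m A) ((norm2 u)^-1 *: u).
    by apply: wmin; rewrite inE /S /= norm2Z gtr0_norm ?invr_gt0// mulVf// gt_eqF.
  rewrite -scalemxAl dotZl dotZr => h.
  have := ler_wpM2r (sqr_ge0 (norm2 u)) h; rewrite mulrA -expr2 mulrAC -exprMn.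
  by rewrite mulVf ?gt_eqF// expr1n mul1r.
have eig : eigenvalue A l.
  apply/eigenvalueP; exists w; last first.
    by apply/eqP => w0; move: Sw; rewrite /S /= w0 norm2_0 => /eqP; rewrite eq_sym oner_eq0.
  apply/eqP; rewrite -subr_eq0; apply/eqP/norm2_eq0; have [u uD] : exists u, w *m A - l *: w = u by eexists.
  rewrite uD.
  have uE : dot u u = dot (w *m A) u - l * dot w u by rewrite -{1}uD dotBl dotZl.
  apply/eqP; rewrite -sqrf_eq0 -dotxx; apply: contraT => u0.
  have {}u0 : 0 < dot u u by rewrite lt_def u0 dotxx sqr_ge0.
  pose k := dot (u *m A) u - l * norm2 u ^+ 2.
  have k0 : 0 <= k by rewrite subr_ge0.
  pose t := dot u u / (k + 1).
  have k1 : 0 < k + 1 by lra.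
  have := lP (w - t *: u); rewrite sqr_norm2D norm2N dotNr dotZr norm2Z exprMn.
  rewrite mulmxBl -scalemxAl !dotE (dot_sym u w As) Sw real_normK ?num_real// -/l.
  have tk : t * k <= dot u u.
    rewrite /t mulrAC ler_pdivrMr//; nra.
  have t0 : 0 < t by rewrite divr_gt0.
  have := mulr_gt0 t0 u0; have := ler_wpM2l (ltW t0) tk.
  rewrite /k in tk *; move: uE; nra.
have : lambda_min A <= l.
  rewrite /lambda_min; apply: ge_inf => //; exists l => m /eigenvalue_dot[u u0 uE].
  by have := lP u; rewrite uE ler_pM2r// exprn_gt0// norm2_gt0.
by move=> /(ler_wpM2r (sqr_ge0 (norm2 v)))/le_trans; apply.
Qed.

(** The sign of the bound matters: lambda_min is 0 when there is no real
    eigenvalue. *)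
Lemma lambda_min_ge A (c : R) : 0 <= c ->
  (forall v, - c * norm2 v ^+ 2 <= dot (v *m A) v) -> - c <= lambda_min A.
Proof.
move=> c0 cA; rewrite /lambda_min.
have [->|/set0P E0] := eqVneq [set l : R | eigenvalue A l] set0.
  by rewrite inf0 oppr_le0.
apply: lb_le_inf => // l /eigenvalue_dot[v v0 vE].
by have := cA v; rewrite vE ler_pM2r// exprn_gt0// norm2_gt0.
Qed.

End Rayleigh.

(** * Stacked vectors and the stacked objective *)

Section Blocks.
Variables (R : realType) (m n : nat).
Implicit Types (x y : 'rV[R]_(m * n)) (W : 'M[R]_m).

Lemma mxtens_indexP (k : 'I_(m * n)) : exists i j, k = mxtens_index (i, j).
Proof. by case E : (mxtens_unindex k) => [i j]; exists i, j; rewrite -E mxtens_unindexK. Qed.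

Lemma sum_mxtens (F : 'I_(m * n) -> R) :
  \sum_k F k = \sum_i \sum_j F (mxtens_index (i, j)).
Proof.
rewrite pair_big /= (reindex (@mxtens_index m n)) /=.
  by apply: eq_bigr => -[i j].
by exists (@mxtens_unindex m n) => k _; rewrite (mxtens_indexK, mxtens_unindexK).
Qed.

(** The same map with the component as a parameter, to carry its linear structure. *)
Definition coblock (i : 'I_m) x : 'rV[R]_n := block x i.

Lemma coblock_is_linear i : linear (coblock i).
Proof. by move=> a x y; apply/rowP => j; rewrite !mxE. Qed.

HB.instance Definition _ i := GRing.isLinear.Build R 'rV[R]_(m * n)
  'rV[R]_n *:%R (coblock i) (coblock_is_linear i).

Lemma blockD i x y : block (x + y) i = block x i + block y i.
Proof. by apply/rowP => j; rewrite !mxE. Qed.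

Lemma blockB i x y : block (x - y) i = block x i - block y i.
Proof. by apply/rowP => j; rewrite !mxE. Qed.

Lemma blockZ i a x : block (a *: x) i = a *: block x i.
Proof. by apply/rowP => j; rewrite !mxE. Qed.

Lemma block_stack (y : 'I_m -> 'rV[R]_n) i : block (stack y) i = y i.
Proof. by apply/rowP => j; rewrite !mxE mxtens_indexK. Qed.

Lemma block_inj x y : (forall i, block x i = block y i) -> x = y.
Proof.
move=> xy; apply/rowP => k; have [i [j ->]] := mxtens_indexP k.
by have /rowP/(_ j) := xy i; rewrite !mxE.
Qed.

Lemma block_delta (i i' : 'I_m) (j : 'I_n) :
  block (delta_mx 0 (mxtens_index (i, j)) : 'rV[R]_(m * n)) i' =
  if i' == i then delta_mx 0 j else 0.
Proof.
apply/rowP => j'; rewrite !mxE (can_eq (@mxtens_indexK m n)) xpair_eqE /=.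
by case: eqVneq => _; rewrite mxE.
Qed.

Lemma dot_block x y : dot x y = \sum_i dot (block x i) (block y i).
Proof.
by rewrite /dot sum_mxtens; apply: eq_bigr => i _; apply: eq_bigr => j _; rewrite !mxE.
Qed.

Lemma norm2_block x : norm2 x ^+ 2 = \sum_i norm2 (block x i) ^+ 2.
Proof. by rewrite -dotxx dot_block; apply: eq_bigr => i _; rewrite dotxx. Qed.

Lemma norm2_block_le x i : norm2 (block x i) <= norm2 x.
Proof.
rewrite -(@ler_pXn2r _ 2)// ?nnegrE ?norm2_ge0// norm2_block (bigD1 i)//= lerDl.
by rewrite sumr_ge0// => j _; rewrite sqr_ge0.
Qed.

Lemma coblock_continuous i : continuous (coblock i).
Proof.
apply: (@lip_continuous _ _ _ _ 1) => x y.
by rewrite /coblock -blockB mul1r norm2_block_le.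
Qed.

Lemma block_mul_What W x i : block (x *m What n W) i = \sum_j W j i *: block x j.
Proof.
apply/rowP => a; rewrite !mxE sum_mxtens summxE; apply: eq_bigr => j _.
rewrite !mxE (bigD1 a)//= tensmxE mxE eqxx mulr1 big1 ?addr0 1?mulrC// => b ba.
by rewrite tensmxE mxE (negbTE ba) !mulr0.
Qed.

Lemma What_sym W : W^T = W -> (What n W)^T = What n W.
Proof. by move=> Ws; rewrite /What trmx_tens Ws trmx1. Qed.

(** The quadratic form of the Kronecker product splits over the coordinates. *)
Lemma dot_What W x : dot (x *m What n W) x =
  \sum_a dot ((\row_i block x i 0 a) *m W) (\row_i block x i 0 a).
Proof.
rewrite dot_block.
under eq_bigr => i _ do rewrite block_mul_What.
transitivity (\sum_i \sum_a (\sum_j W j i * block x j 0 a) * block x i 0 a).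
  apply: eq_bigr => i _; apply: eq_bigr => a _; rewrite summxE; congr (_ * _).
  by apply: eq_bigr => j _; rewrite mxE.
rewrite exchange_big; apply: eq_bigr => a _; apply: eq_bigr => i _.
by rewrite !mxE; congr (_ * _); apply: eq_bigr => j _; rewrite !mxE mulrC.
Qed.

Lemma sum_sqr_coord x : \sum_a norm2 (\row_i block x i 0 a) ^+ 2 = norm2 x ^+ 2.
Proof.
rewrite norm2_block; under eq_bigr do rewrite -dotxx.
under [RHS]eq_bigr do rewrite -dotxx.
rewrite exchange_big; apply: eq_bigr => a _; apply: eq_bigr => i _.
by rewrite !mxE.
Qed.

End Blocks.

Section MixingMatrix.
Variables (R : realType) (m : nat) (e : rel 'I_m) (W : 'M[R]_m).
Hypotheses (m_gt0 : (0 < m)%N) (W_mix : mixing_matrix e W).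

Lemma mixing_ge0 i j : 0 <= W i j.
Proof.
have [_ _ _ _ [Wii Wij]] := W_mix; have [->|ij] := eqVneq i j; first exact: ltW.
have [h1 h2] := Wij _ _ ij; have [eij|/h2->//] := boolP (e i j).
by rewrite ltW ?h1.
Qed.

(** Each product v_i v_j is at most the mean of v_i^2 and v_j^2, and the weights of
    each row and of each column sum to 1. *)
Lemma mixing_form_le (v : 'rV[R]_m) : dot (v *m W) v <= norm2 v ^+ 2.
Proof.
have [_ rows cols _ _] := W_mix.
have -> : norm2 v ^+ 2 = \sum_j \sum_i W i j * ((v 0 i ^+ 2 + v 0 j ^+ 2) / 2).
  transitivity (\sum_j \sum_i (W i j * v 0 i ^+ 2 / 2 + W i j * v 0 j ^+ 2 / 2)).
    under eq_bigr do rewrite big_split.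
    rewrite big_split/= exchange_big -big_split/= -dotxx; apply: eq_bigr => i _.
    rewrite -!mulr_suml rows cols; lra.
  by apply: eq_bigr => j _; apply: eq_bigr => i _; lra.
rewrite dot_mulmx; apply: ler_sum => j _; rewrite mulr_sumr; apply: ler_sum => i _.
have := mulr_ge0 (mixing_ge0 i j) (sqr_ge0 (v 0 i - v 0 j)); nra.
Qed.

Lemma lambda_min_le1 : lambda_min W <= 1.
Proof.
have [Ws _ _ _ _] := W_mix.
pose v : 'rV[R]_m := delta_mx 0 (Ordinal m_gt0).
have : 0 < norm2 v.
  apply: norm2_gt0; apply/eqP => /rowP/(_ (Ordinal m_gt0)).
  by rewrite !mxE !eqxx => /eqP; rewrite oner_eq0.
move=> /(exprn_gt0 2) v0; rewrite -(ler_pM2r v0) mul1r.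
by apply: le_trans (mixing_form_le v); exact: lambda_min_rayleigh.
Qed.

Variable n : nat.
Implicit Types x : 'rV[R]_(m * n).

Lemma What_form_le x : dot (x *m What n W) x <= norm2 x ^+ 2.
Proof.
rewrite dot_What -sum_sqr_coord; apply: ler_sum => a _; exact: mixing_form_le.
Qed.

Lemma What_form_ge x : lambda_min W * norm2 x ^+ 2 <= dot (x *m What n W) x.
Proof.
have [Ws _ _ _ _] := W_mix.
rewrite dot_What -sum_sqr_coord mulr_sumr; apply: ler_sum => a _.
exact: lambda_min_rayleigh.
Qed.

Lemma sum_block_What x : \sum_i block (x *m What n W) i = \sum_i block x i.
Proof.
have [_ rows _ _ _] := W_mix.
under eq_bigr do rewrite block_mul_What.
rewrite exchange_big; apply: eq_bigr => j _.
by rewrite -scaler_suml rows scale1r.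
Qed.

End MixingMatrix.

Section LinearAlgebra.
Variables (R : realType) (n : nat).

Lemma mulmx_bounded (A : 'M[R]_n) : exists2 C, 0 <= C &
  forall v : 'rV[R]_n, norm2 (v *m A) <= C * norm2 v.
Proof.
exists (Num.sqrt (\sum_j norm2 (row j A^T) ^+ 2)) => [|v]; first exact: sqrtr_ge0.
apply: norm2_le; first by rewrite mulr_ge0 ?sqrtr_ge0 ?norm2_ge0.
rewrite exprMn sqr_sqrtr ?sumr_ge0// => [|j _]; last exact: sqr_ge0.
rewrite mulr_suml; apply: ler_sum => j _; rewrite -expr2.
have -> : (v *m A) 0 j = dot v (row j A^T).
  by rewrite mxE; apply: eq_bigr => i _; rewrite !mxE.
rewrite -real_normK ?num_real// -exprMn ler_pXn2r ?nnegrE ?mulr_ge0 ?norm2_ge0//.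
by rewrite mulrC ler_dot.
Qed.

Lemma is_derive_coord (x v : 'rV[R]_n) i :
  is_derive x v (fun y : 'rV[R]_n => y 0 i) (v 0 i).
Proof.
have E : (fun e : R => e^-1 *: ((e *: v + x) 0 i - x 0 i)) @ 0^' --> v 0 i.
  apply: cvg_near_cst; near=> t.
  rewrite /= !mxE addrK /GRing.scale/= mulrA mulVf ?mul1r//.
  by near: t; exact: nbhs_dnbhs_neq.
by split; [apply/cvg_ex; exists (v 0 i)|exact/cvg_lim].
Unshelve. all: by end_near. Qed.

Lemma is_derive_mulmx (A : 'M[R]_n) (x v : 'rV[R]_n) j :
  is_derive x v (fun y => (y *m A) 0 j) ((v *m A) 0 j).
Proof.
have -> : (fun y : 'rV[R]_n => (y *m A) 0 j) =
    \sum_i (A i j \*: (fun y : 'rV[R]_n => y 0 i)).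
  by apply/funext => y; rewrite mxE fct_sumE; apply: eq_bigr => i _; rewrite mulrC.
rewrite mxE; under [X in is_derive _ _ _ X]eq_bigr do rewrite mulrC.
by apply: is_derive_sum => i; apply: is_deriveZ; exact: is_derive_coord.
Qed.

Lemma is_derive_form (A : 'M[R]_n) (x v : 'rV[R]_n) : A^T = A ->
  is_derive x v (fun y => dot (y *m A) y) (2 * dot (x *m A) v).
Proof.
move=> As.
have -> : (fun y => dot (y *m A) y) =
    \sum_j ((fun y => (y *m A) 0 j) * (fun y : 'rV[R]_n => y 0 j)).
  by apply/funext => y; rewrite fct_sumE.
rewrite (_ : 2 * _ = \sum_j ((x *m A) 0 j *: v 0 j + x 0 j *: (v *m A) 0 j)).
  apply: is_derive_sum => j; apply: is_deriveM; first exact: is_derive_mulmx.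
  exact: is_derive_coord.
rewrite big_split/= -/(dot _ _) mulr_natl mulr2n; congr (_ + _).
by rewrite dot_sym// dotC.
Qed.

End LinearAlgebra.

Section Stacked.
Variables (R : realType) (m n : nat) (f : 'I_m -> 'rV[R]_n -> R).
Hypothesis f_smooth : forall i, smooth (f i).
Implicit Types x y v : 'rV[R]_(m * n).

Lemma is_derive_block (h : 'rV[R]_n -> R) i x v : differentiable h (block x i) ->
  is_derive x v (fun y => h (block y i)) (dot (grad h (block x i)) (block v i)).
Proof.
move=> dh.
have cl : continuous (@coblock R m n i) by exact: coblock_continuous.
have dl := linear_differentiable x cl.
have dhl : differentiable (h \o coblock i) x by exact: differentiable_comp.
split; first exact: (@diff_derivable _ _ _ (h \o coblock i)).
rewrite -derive_dot// [RHS]deriveE//.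
have -> : 'D_v (fun y => h (block y i)) x = 'd (h \o coblock i) x v by rewrite deriveE.
by rewrite diff_comp//= (diff_lin _ cl).
Qed.

Lemma differentiable_block (h : 'rV[R]_n -> R) i x : differentiable h (block x i) ->
  differentiable (fun y => h (block y i)) x.
Proof.
move=> dh; apply: (@differentiable_comp _ _ _ _ (coblock i) h) dh.
by apply: linear_differentiable; exact: coblock_continuous.
Qed.

Lemma stacked_objE : stacked_obj f = \sum_i (fun x => f i (block x i)).
Proof. by apply/funext => x; rewrite fct_sumE. Qed.

Lemma partial_stacked i j :
  partial (mxtens_index (i, j)) (stacked_obj f) = fun x => partial j (f i) (block x i).
Proof.
apply/funext => x; rewrite /partial stacked_objE.
have H k : is_derive x (delta_mx 0 (mxtens_index (i, j))) (fun x => f k (block x k))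
    (if k == i then partial j (f i) (block x i) else 0).
  have [dk _ _] := f_smooth k.
  apply: is_derive_eq; first exact: is_derive_block.
  rewrite block_delta; case: eqVneq => [->|_]; last by rewrite dotC dot0l.
  by rewrite dot_delta mxE.
have [_ ->] := is_derive_sum H.
by rewrite -big_mkcond big_pred1_eq.
Qed.

Lemma partial2_stacked i j i' j' :
  partial (mxtens_index (i', j')) (partial (mxtens_index (i, j)) (stacked_obj f)) =
  fun x => if i' == i then partial j' (partial j (f i)) (block x i) else 0.
Proof.
apply/funext => x; rewrite partial_stacked {1}/partial.
have [_ dd _] := f_smooth i.
have [_ ->] := is_derive_block (delta_mx 0 (mxtens_index (i', j'))) (dd j (block x i)).
rewrite block_delta eq_sym; case: eqP => _; last by rewrite dotC dot0l.
by rewrite dot_delta mxE.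
Qed.

Lemma smooth_stacked : smooth (stacked_obj f).
Proof.
split=> [x|k x|k k'].
- rewrite stacked_objE; apply: differentiable_sum => i; apply: differentiable_block.
  by have [] := f_smooth i.
- have [i [j ->]] := mxtens_indexP k; rewrite partial_stacked.
  by apply: differentiable_block; have [] := f_smooth i.
have [i [j ->]] := mxtens_indexP k; have [i' [j' ->]] := mxtens_indexP k'.
rewrite partial2_stacked; case: eqP => _ x; last exact: cst_continuous.
apply: (@continuous_comp _ _ _ (coblock i')); first exact: coblock_continuous.
by have [_ _] := f_smooth i'; exact.
Qed.

Lemma block_grad_stacked x i : block (grad (stacked_obj f) x) i = grad (f i) (block x i).
Proof. by apply/rowP => j; rewrite !mxE partial_stacked. Qed.

Lemma lipschitz_stacked (L : R) : 0 <= L ->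
  (forall i, lipschitz_grad (f i) L) -> lipschitz_grad (stacked_obj f) L.
Proof.
move=> L0 fL x y; apply: norm2_le; first by rewrite mulr_ge0 ?norm2_ge0.
rewrite dotxx exprMn !norm2_block mulr_sumr; apply: ler_sum => i _.
rewrite !blockB !block_grad_stacked -exprMn ler_pXn2r ?nnegrE ?mulr_ge0 ?norm2_ge0//.
exact: fL.
Qed.

End Stacked.

(** * The auxiliary function *)

Section Auxiliary.
Variables (R : realType) (m n : nat) (f : 'I_m -> 'rV[R]_n -> R).
Variables (e : rel 'I_m) (W : 'M[R]_m) (L alpha : R).
Hypotheses (m_gt0 : (0 < m)%N) (n_gt0 : (0 < n)%N).
Hypothesis f_smooth : forall i, smooth (f i).
Hypothesis W_mix : mixing_matrix e W.
Hypothesis f_lip : forall i, lipschitz_grad (f i) L.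
Hypothesis f_coercive : forall i, coercive (f i).
Hypotheses (L_ge0 : 0 <= L) (alpha_gt0 : 0 < alpha).
Implicit Types x y v : 'rV[R]_(m * n).

Local Notation F := (stacked_obj f).
Local Notation A := (1%:M - What n W).
Local Notation Q := (Qfun f W alpha).
Local Notation g := (resid f W alpha).

Let F_smooth : smooth F. Proof. exact: smooth_stacked. Qed.
Let F_lip : lipschitz_grad F L. Proof. exact: lipschitz_stacked. Qed.

Let A_sym : A^T = A.
Proof.
by have [Ws _ _ _ _] := W_mix; rewrite linearB /= trmx1 What_sym.
Qed.

Let A_form x : dot (x *m A) x = norm2 x ^+ 2 - dot (x *m What n W) x.
Proof. by rewrite mulmxBr mulmx1 dotBl dotxx. Qed.

Let A_ge0 x : 0 <= dot (x *m A) x.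
Proof. by rewrite A_form subr_ge0; exact: (What_form_le W_mix). Qed.

Let A_le x : dot (x *m A) x <= (1 - lambda_min W) * norm2 x ^+ 2.
Proof. by rewrite A_form; have := What_form_ge m_gt0 W_mix x; lra. Qed.

Let QE x : Q x = F x + (2 * alpha)^-1 * dot (x *m A) x.
Proof. by rewrite /Qfun mulmx_trE. Qed.

Let A_shift x y : dot (y *m A) y =
  dot (x *m A) x + 2 * dot (x *m A) (y - x) + dot ((y - x) *m A) (y - x).
Proof.
move: (y - x) (subrK x y) => d <-.
by rewrite mulmxDl dotDl !dotDr (dot_sym d x A_sym); ring.
Qed.

Let Q_expand x y : Q y - Q x - dot (g x) (y - x) =
  F y - F x - dot (grad F x) (y - x) + (2 * alpha)^-1 * dot ((y - x) *m A) (y - x).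
Proof.
rewrite !QE (A_shift x y) /resid dotDl dotZl.
by field; rewrite gt_eqF.
Qed.

(** The penalty is quadratic, with eigenvalues at most (1 - lambda_min W) / alpha. *)
Lemma Q_upper x y : Q y <= Q x + dot (g x) (y - x) +
  (1 - lambda_min W + alpha * L) / (2 * alpha) * norm2 (y - x) ^+ 2.
Proof.
have [dF _ _] := F_smooth.
have := taylor_lipschitz x y dF F_lip; have := Q_expand x y.
have : (2 * alpha)^-1 * dot ((y - x) *m A) (y - x) <=
    (2 * alpha)^-1 * ((1 - lambda_min W) * norm2 (y - x) ^+ 2).
  by rewrite ler_wpM2l// invr_ge0 mulr_ge0// ltW.
rewrite [(1 - _ + _) / _](_ : _ = (2 * alpha)^-1 * (1 - lambda_min W) + L / 2); last first.
  by field; rewrite gt_eqF.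
by set k := _^-1; set N2 := norm2 _ ^+ 2; set D := dot _ _; move: D => D; lra.
Qed.

Lemma Q_cont : continuous Q.
Proof.
have [dF _ _] := F_smooth.
have -> : Q = F + (2 * alpha)^-1 \*: (fun x => dot (x *m A) x).
  by apply/funext => x; rewrite QE.
move=> x; apply: continuousD; first exact: differentiable_continuous.
apply: (@continuousM _ _ (cst (2 * alpha)^-1)); first exact: cst_continuous.
exact: continuous_quadratic.
Qed.

Lemma resid_lip : exists2 C, 0 < C & forall x y, norm2 (g x - g y) <= C * norm2 (x - y).
Proof.
have [C C0 AC] := mulmx_bounded A.
exists (L + alpha^-1 * C + 1) => [|x y].
  by rewrite ltr_pwDr// addr_ge0// mulr_ge0// invr_ge0 ltW.
rewrite /resid opprD addrACA -scalerBr -mulmxBl (le_trans (norm2D _ _))//.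
rewrite norm2Z gtr0_norm ?invr_gt0//.
have := F_lip x y; have := AC (x - y); have := norm2_ge0 (x - y) => h0 h1 h2.
have ia : 0 <= alpha^-1 by rewrite invr_ge0 ltW.
have := ler_wpM2l ia h1; lra.
Qed.

(** Each f_i is bounded below, so that a bound on their sum bounds each of them. *)
Lemma Q_coercive c : exists M, forall x, Q x <= c -> norm2 x <= M.
Proof.
have f_cont i : continuous (f i).
  by move=> x; have [df _ _] := f_smooth i; exact: differentiable_continuous.
have f_bdd i c' : exists M, forall z : 'rV[R]_n, f i z <= c' -> norm2 z <= M.
  by have [M fM] := compact_norm2_bounded (@f_coercive i c'); exists M.
have /choice[b bP] : forall i, exists b, forall z : 'rV[R]_n, b <= f i z.
  move=> i; have [|x _ xmin] := coercive_argmin (f_cont i) closedT _ (f_bdd i).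
    by exists 0.
  by exists (f i x) => y; exact: xmin.
have /choice[M MP] : forall i, exists M, forall z : 'rV[R]_n,
    f i z <= c - \sum_(j | j != i) b j -> norm2 z <= M by move=> i; exact: f_bdd.
exists (Num.sqrt (\sum_i M i ^+ 2)) => x Qx.
apply: norm2_le; first exact: sqrtr_ge0.
rewrite sqr_sqrtr ?sumr_ge0// => [|i _]; last exact: sqr_ge0.
rewrite dotxx norm2_block; apply: ler_sum => i _.
have : norm2 (block x i) <= M i.
  apply: MP; rewrite lerBrDr; apply: le_trans Qx; rewrite QE.
  apply: le_trans (_ : _ <= F x) _; last first.
    by rewrite lerDl mulr_ge0// invr_ge0 mulr_ge0// ltW.
  rewrite /stacked_obj [leRHS](bigD1 i)//= lerD2l; apply: ler_sum => j _; exact: bP.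
move=> h; rewrite ler_pXn2r ?nnegrE ?norm2_ge0//.
exact: le_trans (norm2_ge0 _) h.
Qed.

Let resid_coord x k : g x 0 k = partial k F x + alpha^-1 * (x *m A) 0 k.
Proof. by rewrite /resid [LHS]mxE; congr (_ + _); rewrite mxE. Qed.

Lemma grad_Q x : grad Q x = g x.
Proof.
have [dF _ _] := F_smooth.
have QE' : Q = F + (2 * alpha)^-1 \*: (fun x => dot (x *m A) x).
  by apply/funext => y; rewrite QE.
apply/rowP => k.
rewrite mxE resid_coord /partial QE'.
have dFx : is_derive x (delta_mx 0 k) F ('D_(delta_mx 0 k) F x).
  exact/derivableP/diff_derivable.
have [_ ->] := is_deriveD dFx (is_deriveZ (2 * alpha)^-1
  (is_derive_form x (delta_mx 0 k) A_sym)).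
rewrite dot_delta; congr (_ + _); rewrite /GRing.scale/=.
by field; rewrite gt_eqF.
Qed.

Lemma hess_Q x : hess Q x = hess F x + alpha^-1 *: A.
Proof.
have [_ ddF _] := F_smooth.
have pQ j : partial j Q = partial j F + (alpha^-1 \*: (fun y => (y *m A) 0 j)).
  apply/funext => y; have := congr1 (fun v : 'rV[R]_(m * n) => v 0 j) (grad_Q y).
  by rewrite mxE resid_coord.
apply/matrixP => i j; rewrite [LHS]mxE pQ [RHS]mxE [in RHS]mxE /partial.
have dFx : is_derive x (delta_mx 0 i) (partial j F) ('D_(delta_mx 0 i) (partial j F) x).
  exact/derivableP/diff_derivable.
have [_ ->] := is_deriveD dFx (is_deriveZ alpha^-1 (is_derive_mulmx A x (delta_mx 0 i) j)).
congr (_ + _); rewrite [RHS]mxE /GRing.scale/=; congr (_ * _).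
by rewrite -rowE mxE.
Qed.

(** W being doubly stochastic, the penalty exerts no net force on the nodes. *)
Lemma sum_block_resid x : \sum_i block (g x) i = \sum_i grad (f i) (block x i).
Proof.
rewrite /resid; under eq_bigr do rewrite blockD blockZ block_grad_stacked//.
rewrite big_split/= -scaler_sumr [X in _ + _ *: X](_ : _ = 0) ?scaler0 ?addr0//.
rewrite mulmxBr mulmx1; under eq_bigr do rewrite blockB.
by rewrite big_split/= sumrN (sum_block_What W_mix) subrr.
Qed.

(** NDGD is a noisy gradient descent on the auxiliary function. *)
Lemma ndgdS (x0 : 'rV[R]_(m * n)) (xi : nat -> 'I_m -> 'rV[R]_n) k :
  ndgd f W alpha x0 xi k.+1 =
  ndgd f W alpha x0 xi k - alpha *: (g (ndgd f W alpha x0 xi k) + stack (xi k)).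
Proof.
have [Ws _ _ _ _] := W_mix.
rewrite [LHS]/=; set x := ndgd _ _ _ _ _ k; apply: block_inj => i.
rewrite block_stack blockB blockZ blockD block_stack /resid blockD blockZ.
rewrite block_grad_stacked// mulmxBr mulmx1 blockB block_mul_What.
have -> : \sum_j W i j *: block x j = \sum_j W j i *: block x j.
  by apply: eq_bigr => j _; rewrite -[in LHS]Ws mxE.
move: (block x i) (\sum_j _) (grad _ _) (xi k i) => a b c s.
by apply/rowP => l; rewrite !mxE; field; rewrite gt_eqF.
Qed.

Variables (eps gamma mu delta : R).
Hypotheses (eps_gt0 : 0 < eps) (gamma_gt0 : 0 < gamma) (mu_gt0 : 0 < mu).
Hypothesis alpha_le : alpha * L <= lambda_min W.
Hypothesis regions : region1 f W alpha eps `|` region2 f alpha gamma `|`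
  region3 f W alpha mu delta = [set: 'rV[R]_(m * n)].

(** A point of small gradient lies in the second or the third region.  The second
    one would need an eigenvalue of the Hessian of F below - 1 / alpha, although
    these eigenvalues are at least - L and alpha L <= lambda_min W <= 1. *)
Lemma hess_ge_mu x v : norm2 (g x) < eps -> mu * norm2 v ^+ 2 <= dot (v *m hess F x) v.
Proof.
have mn_gt0 : (0 < m * n)%N by rewrite muln_gt0 m_gt0.
move=> gx; have : [set: 'rV[R]_(m * n)] x by [].
rewrite -regions => -[[|]|[+ _]]; rewrite /region1 /region2 /=.
- by rewrite leNgt gx.
- move=> h1; exfalso; have h2 : - L <= lambda_min (hess F x).
    by apply: lambda_min_ge => // w; exact: hess_ge_lipschitz.
  have h3 : L <= alpha^-1.
    rewrite -(ler_pM2l alpha_gt0) mulfV ?gt_eqF//.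
    by rewrite (le_trans alpha_le)// (lambda_min_le1 m_gt0 W_mix).
  move: gamma_gt0; rewrite ltNge => /negP; apply.
  rewrite -(lerD2r alpha^-1) add0r; apply: le_trans h3.
  by rewrite -lerN2 opprD; exact: le_trans h2 h1.
move=> /(ler_wpM2r (sqr_ge0 (norm2 v)))/le_trans; apply.
by apply: lambda_min_rayleigh => //; exact: hess_sym.
Qed.

Lemma Q_convex x : norm2 (g x) < eps -> exists2 r, 0 < r &
  forall y z, norm2 (y - x) < r -> norm2 (z - x) < r ->
    Q z + dot (g z) (y - z) + mu / 2 * norm2 (y - z) ^+ 2 <= Q y.
Proof.
move=> gx; have [C C0 gC] := resid_lip.
exists ((eps - norm2 (g x)) / C) => [|y z]; first by rewrite divr_gt0// subr_gt0.
rewrite !ltr_pdivlMr// => yx zx.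
have small w : norm2 (w - x) * C < eps - norm2 (g x) -> norm2 (g w) < eps.
  move=> wx; have := gC w x; have := norm2D (g w - g x) (g x); rewrite subrK; lra.
have : F z + dot (grad F z) (y - z) + mu / 2 * norm2 (y - z) ^+ 2 <= F (z + (y - z)).
  apply: taylor_convex => // t /andP[t0 t1]; apply: hess_ge_mu; apply: small.
  have -> : z + t *: (y - z) - x = (1 - t) *: (z - x) + t *: (y - x).
    by apply/rowP => j; rewrite !mxE; ring.
  have := norm2D ((1 - t) *: (z - x)) (t *: (y - x)).
  rewrite !norm2Z !ger0_norm ?subr_ge0// => h.
  apply: le_lt_trans (ler_wpM2r (ltW C0) h) _; rewrite mulrDl -!mulrA.
  have [t1' | t1'] := eqVneq t 1; first by rewrite t1' subrr; lra.
  have := ltr_pM2l (_ : 0 < 1 - t) (norm2 (z - x) * C) (eps - norm2 (g x)).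
  rewrite subr_gt0 lt_neqAle t1' t1 => /(_ isT); rewrite zx => {}zx.
  have := ler_wpM2l t0 (ltW yx); lra.
rewrite [z + _]addrC subrK => Fy.
have := Q_expand z y; have : 0 <= (2 * alpha)^-1 * dot ((y - z) *m A) (y - z).
  by rewrite mulr_ge0// invr_ge0 mulr_ge0// ltW.
by lra.
Qed.

Lemma local_minimizers_Q x : local_minimizers Q x <-> g x = 0.
Proof.
split=> [[+ _]|gx]; first by rewrite grad_Q.
split=> [|v v0]; first by rewrite grad_Q.
rewrite mulmx_trE hess_Q mulmxDr -scalemxAr dotDl dotZl.
have nv := norm2_gt0 v0.
have : mu * norm2 v ^+ 2 <= dot (v *m hess F x) v.
  by apply: hess_ge_mu; rewrite gx norm2_0.
have : 0 < mu * norm2 v ^+ 2 by rewrite mulr_gt0// exprn_gt0.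
have : 0 <= alpha^-1 * dot (v *m A) v by rewrite mulr_ge0// invr_ge0 ltW.
lra.
Qed.

End Auxiliary.

(** * Independent random vectors *)

Section BorelVectors.
Variables (R : realType) (n : nat).

Lemma open_measurable_rV (A : set 'rV[R]_n) : open A -> measurable (A : set (borel_rV R n)).
Proof. by move=> Ao; apply: sub_sigma_algebra. Qed.

Lemma closed_measurable_rV (A : set 'rV[R]_n) : closed A -> measurable (A : set (borel_rV R n)).
Proof.
by move=> /closed_openC/open_measurable_rV/measurableC; rewrite setCK.
Qed.

Lemma continuous_measurable_rV (h : 'rV[R]_n -> R) : continuous h ->
  measurable_fun setT (h : borel_rV R n -> R).
Proof.
move=> hc; apply: (measurability _ (RGenOInfty.measurableE R)).
move=> _ [_ [x ->] <-]; rewrite setTI; apply: open_measurable_rV.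
apply: open_comp => [? _|]; first exact: hc.
exact: interval_open.
Qed.

End BorelVectors.

Import HBNNSimple.

Section Factor.
Variables (R : realType) (d : measure_display) (T : measurableType d).
Variables (P : probability T R).
Variables (d' : measure_display) (T' : measurableType d') (X : T -> T').
Hypothesis X_meas : measurable_fun setT X.

Let factor_simple (Y : T -> R) (c : R) (h : {nnsfun T' >-> R}) :
  measurable_fun setT Y -> (forall w, 0 <= Y w) ->
  (forall B, measurable B ->
    \int[P]_w (Y w * \1_B (X w))%:E = c%:E * P (X @^-1` B))%E ->
  (\int[P]_w (Y w * h (X w))%:E = c%:E *
   \sum_(y <- finmap.enum_fset (fset_set (range h))) `|y|%:E * P (X @^-1` (h @^-1` [set y])))%E.
Proof.
move=> mY Y0 YB; set s := finmap.enum_fset _.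
have s0 y : y \in s -> 0 <= y.
  by rewrite in_fset_set ?inE//= => -[x _ <-]; exact: fun_ge0.
have mB y : measurable (h @^-1` [set y]).
  by rewrite -[X in measurable X]setTI; exact: (@measurable_funP _ _ _ _ _ h).
have m1 y : measurable_fun setT (fun w => Y w * \1_(h @^-1` [set y]) (X w)).
  by apply: measurable_funM => //; exact: (measurableT_comp (measurable_indic (mB y))).
have E w : (Y w * h (X w))%:E =
    (\sum_(y <- s) (`|y|%:E * (Y w * \1_(h @^-1` [set y]) (X w))%:E))%E.
  rewrite sumEFin {1}fimfunE fsbig_finite//= -/s mulr_sumr; congr _%:E.
  by apply: eq_big_seq => y /s0 y0; rewrite ger0_norm//; ring.
under eq_integral => w _ do rewrite E.
rewrite ge0_integral_sum//; last 2 first.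
- by move=> y; apply: emeasurable_funM => //; exact/measurable_EFinP.
- by move=> y w _; rewrite mule_ge0 ?lee_fin// mulr_ge0// indicE.
transitivity (\sum_(y <- s) (c%:E * (`|y|%:E * P (X @^-1` (h @^-1` [set y])))))%E.
  apply: eq_bigr => y _; rewrite ge0_integralZl//.
  - by rewrite YB// muleCA.
  - exact/measurable_EFinP.
  - by move=> w _; rewrite lee_fin mulr_ge0// indicE.
by rewrite ge0_sume_distrr// => y _; rewrite mule_ge0// lee_fin.
Qed.

(** If conditioning on X does not change the mean of Y, then neither does
    weighting by a function of X. *)
Lemma factor_integral (Y : T -> R) (c : R) (h : T' -> R) :
  measurable_fun setT Y -> (forall w, 0 <= Y w) ->
  measurable_fun setT h -> (forall x, 0 <= h x) ->
  (forall B, measurable B ->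
    \int[P]_w (Y w * \1_B (X w))%:E = c%:E * P (X @^-1` B))%E ->
  (\int[P]_w (Y w * h (X w))%:E = c%:E * \int[P]_w (h (X w))%:E)%E.
Proof.
move=> mY Y0 mh h0 YB.
have mh' : measurable_fun setT (EFin \o h) by exact/measurable_EFinP.
pose a := nnsfun_approx measurableT mh'.
have ah x : (EFin (a k x) @[k --> \oo] --> (h x)%:E)%E.
  by apply: (cvg_nnsfun_approx measurableT mh') => // y _; rewrite lee_fin.
have nda x : {homo (fun k => a k x) : i j / (i <= j)%N >-> i <= j}.
  by move=> i j ij; have /lefP := nd_nnsfun_approx measurableT mh' ij; exact.
have one_B B : measurable B ->
    (\int[P]_w (1 * \1_B (X w))%:E = 1%:E * P (X @^-1` B))%E.
  move=> mB; under eq_integral => w _ do rewrite mul1r.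
  have mXB : measurable (X @^-1` B) by rewrite -[X in measurable X]setTI; exact: X_meas.
  by rewrite (integral_indic _ measurableT mXB) setIT mul1e.
have key (Z : T -> R) : measurable_fun setT Z -> (forall w, 0 <= Z w) ->
    (\int[P]_w (Z w * a k (X w))%:E @[k --> \oo] --> \int[P]_w (Z w * h (X w))%:E)%E.
  move=> mZ Z0.
  have -> : (\int[P]_w (Z w * h (X w))%:E =
      \int[P]_w limn (fun k => (Z w * a k (X w))%:E))%E.
    apply: eq_integral => w _; apply/esym/cvg_lim => //.
    under eq_fun do rewrite EFinM; rewrite EFinM.
    by apply: cvgeZl; [|exact: ah].
  apply: cvg_monotone_convergence => //.
  - move=> k; apply/measurable_EFinP; apply: measurable_funM => //.
    by apply: (measurableT_comp _ X_meas); exact: measurable_funP.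
  - by move=> k w _; rewrite lee_fin mulr_ge0.
  - by move=> w _ i j ij; rewrite lee_fin ler_wpM2l// nda.
have l1 := key Y mY Y0.
have m1 : measurable_fun setT (cst 1 : T -> R) by exact: measurable_cst.
have := key (cst 1) m1 (fun=> ler01).
move=> /(@cvgeZl _ _ _ _ _ c%:E isT) l2.
have e1 : (fun k => c%:E * \int[P]_w (cst 1 w * a k (X w))%:E)%E =
    (fun k => \int[P]_w (Y w * a k (X w))%:E)%E.
  apply/funext => k; rewrite (factor_simple _ mY Y0 YB).
  by rewrite (factor_simple _ m1 (fun=> ler01) one_B) mul1e.
rewrite e1 in l2; rewrite (cvg_unique _ l1 l2)//; congr (_ * _)%E.
by apply: eq_integral => w _; rewrite mul1r.
Qed.

End Factor.

Section Independence.
Variables (R : realType) (d : measure_display) (T : measurableType d).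
Variables (P : probability T R) (n : nat) (I : eqType) (X : I -> T -> 'rV[R]_n).
Hypothesis X_meas : forall i, measurable_fun setT (X i : T -> borel_rV R n).
Hypothesis X_indep : forall (s : seq I) (B : I -> set (borel_rV R n)), uniq s ->
  (forall i, measurable (B i)) ->
  P (\bigcap_(i in [set` s]) (X i @^-1` B i)) = (\prod_(i <- s) P (X i @^-1` B i))%E.
Variables (h : I -> 'rV[R]_n -> R) (M : I -> R).
Hypothesis h_meas : forall i, measurable_fun setT (h i : borel_rV R n -> R).
Hypothesis h_ge0 : forall i x, 0 <= h i x.
Hypothesis h_int : forall i, (\int[P]_w (h i (X i w))%:E = (M i)%:E)%E.

Let XB_meas i (B : set (borel_rV R n)) : measurable B -> measurable (X i @^-1` B).
Proof. by move=> mB; rewrite -[X in measurable X]setTI; exact: X_meas. Qed.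

Let p i (B : set (borel_rV R n)) : R := fine (P (X i @^-1` B)).

Let pE i (B : set (borel_rV R n)) : measurable B -> P (X i @^-1` B) = (p i B)%:E.
Proof. by move=> /(@XB_meas i) mB; rewrite fineK// fin_num_measure. Qed.

Let measurable_prod (s : seq I) (F : I -> T -> R) :
  (forall i, measurable_fun setT (F i)) ->
  measurable_fun setT (fun w => \prod_(i <- s) F i w).
Proof.
move=> mF; elim: s => [|i s IH].
  by under eq_fun do rewrite big_nil; exact: measurable_cst.
by under eq_fun do rewrite big_cons; exact: measurable_funM.
Qed.

(** The functions are brought in one at a time, the remaining vectors being
    handled by events. *)
Let indep_mixed (s t : seq I) (B : I -> set (borel_rV R n)) : uniq (s ++ t) ->
  (forall i, measurable (B i)) ->
  (\int[P]_w ((\prod_(i <- s) h i (X i w)) * \prod_(i <- t) \1_(B i) (X i w))%:E =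
   ((\prod_(i <- s) M i) * \prod_(i <- t) p i (B i))%:E)%E.
Proof.
elim: s t B => [|i s IH] t B; rewrite ?cat0s => u mB.
  rewrite big_nil mul1r.
  have -> : ((\prod_(i <- t) p i (B i))%:E =
      P (\bigcap_(i in [set` t]) (X i @^-1` B i)))%E.
    by rewrite X_indep// -prodEFin; apply: eq_bigr => i _; rewrite pE.
  have mI : measurable (\bigcap_(i in [set` t]) (X i @^-1` B i)).
    by apply: fin_bigcap_measurable => // i _; exact: XB_meas.
  rewrite -[X in P X]setIT -(integral_indic _ measurableT mI).
  apply: eq_integral => w _; rewrite big_nil mul1r; congr _%:E.
  rewrite indicE; have [wt|wt] := boolP (w \in _).
    rewrite big_seq big1// => i it; rewrite indicE mem_set//.
    by have := set_mem wt; exact.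
  have [i [it wi]] : exists i, i \in t /\ ~ B i (X i w).
    apply: contrapT => nex; move: wt; rewrite notin_setE; apply=> i /= it.
    by apply: contrapT => wi; apply: nex; exists i.
  by rewrite (big_rem i)//= indicE memNset// mul0r.
pose Y w := (\prod_(j <- s) h j (X j w)) * \prod_(j <- t) \1_(B j) (X j w).
have mY : measurable_fun setT Y.
  apply: measurable_funM; apply: measurable_prod => j.
    exact: (measurableT_comp (@h_meas j) (@X_meas j)).
  exact: (measurableT_comp (measurable_indic (mB j)) (@X_meas j)).
have Y0 w : 0 <= Y w.
  by rewrite mulr_ge0 ?prodr_ge0// => j _; rewrite indicE.
move: u; rewrite cat_cons cons_uniq => /andP[]; rewrite mem_cat negb_or => /andP[is_ it] u.
have YB (B' : set (borel_rV R n)) : measurable B' -> (\int[P]_w (Y w * \1_B' (X i w))%:E =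
    ((\prod_(j <- s) M j) * \prod_(j <- t) p j (B j))%:E * P (X i @^-1` B'))%E.
  move=> mB'; pose C j := if j == i then B' else B j.
  have mC j : measurable (C j) by rewrite /C; case: ifP.
  have CC : C i = B' by rewrite /C eqxx.
  have Ct (F : I -> set (borel_rV R n) -> R) :
      \prod_(j <- t) F j (C j) = \prod_(j <- t) F j (B j).
    apply: eq_big_seq => j jt; rewrite /C; case: eqP => // ji.
    by move: it; rewrite -ji jt.
  have := IH (i :: t) C; rewrite big_cons CC (Ct p) pE//.
  have -> : uniq (s ++ i :: t).
    by rewrite -[i :: t]cat1s uniq_catCA /= mem_cat negb_or is_ it u.
  move=> /(_ isT mC) E; transitivity (\int[P]_w
    ((\prod_(j <- s) h j (X j w)) * \prod_(j <- i :: t) \1_(C j) (X j w))%:E)%E.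
    apply: eq_integral => w _; rewrite big_cons CC /Y.
    by rewrite (Ct (fun j A => \1_A (X j w))); congr _%:E; ring.
  by rewrite E -EFinM; congr _%:E; ring.
have := factor_integral (@X_meas i) mY Y0 (@h_meas i) (@h_ge0 i) YB.
rewrite h_int -EFinM => E; transitivity (\int[P]_w (Y w * h i (X i w))%:E)%E.
  by apply: eq_integral => w _; rewrite big_cons /Y; congr _%:E; ring.
by rewrite E big_cons; congr _%:E; ring.
Qed.

Lemma indep_prod (s : seq I) : uniq s ->
  (\int[P]_w (\prod_(i <- s) h i (X i w))%:E = (\prod_(i <- s) M i)%:E)%E.
Proof.
move=> u; have := @indep_mixed s [::] (fun=> setT).
rewrite cats0 big_nil mulr1 => /(_ u (fun=> measurableT)) <-.
by apply: eq_integral => w _; rewrite big_nil mulr1.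
Qed.

End Independence.

(** * Exponential moments of bounded noise *)

Section Moments.
Variables (R : realType) (d : measure_display) (T : measurableType d).
Variables (P : probability T R).

Lemma expR_le_quadratic (x : R) : x <= 1 / 2 -> expR x <= 1 + x + 2 * x ^+ 2.
Proof.
move=> x12; have := expR_ge1Dx (- x) => ex.
have q0 : 0 < 1 + x + 2 * x ^+ 2 by have := sqr_ge0 (x + 1 / 4); lra.
rewrite -[x in expR x]opprK expRN -(ler_pM2l (expR_gt0 (- x))) mulfV ?gt_eqF ?expR_gt0//.
have := ler_wpM2r (ltW q0) ex; apply: le_trans.
have : 0 <= x ^+ 2 * (1 / 2 - x) by rewrite mulr_ge0 ?sqr_ge0// subr_ge0.
by rewrite !expr2; lra.
Qed.

Variables (X : T -> R) (sigma : R).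
Hypothesis X_meas : measurable_fun setT X.
Hypothesis X_mean : (\int[P]_w (X w)%:E = 0)%E.
Hypothesis X_var : (\int[P]_w (X w * X w)%:E = (sigma ^+ 2)%:E)%E.

Lemma sqr_integrable : P.-integrable setT (fun w => (X w * X w)%:E).
Proof.
apply/integrableP; split.
  by apply/measurable_EFinP; exact: measurable_funM.
under eq_integral do rewrite gee0_abs ?lee_fin -?expr2 ?sqr_ge0// expr2.
by rewrite X_var ltry.
Qed.

Lemma lin_integrable : P.-integrable setT (fun w => (X w)%:E).
Proof.
have i1 : P.-integrable setT (fun w => (cst 1 w)%:E + (X w * X w)%:E)%E.
  apply: integrableD => //; last exact: sqr_integrable.
  exact: finite_measure_integrable_cst.
apply: le_integrable i1 => //; first exact/measurable_EFinP.
move=> w _; rewrite -EFinD !abse_EFin lee_fin /cst.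
have := sqr_ge0 (`|X w| - 1 / 2); have : `|X w| ^+ 2 = X w * X w.
  by rewrite real_normK ?num_real// expr2.
have := ler_norm (1 + X w * X w); rewrite !expr2; lra.
Qed.

Lemma quadratic_integrable (a b c : R) :
  P.-integrable setT (fun w => (a + b * X w + c * (X w * X w))%:E).
Proof.
have i0 : P.-integrable setT (fun w : T => (cst a w)%:E).
  exact: finite_measure_integrable_cst.
have i1 := integrableZl measurableT b lin_integrable.
have i2 := integrableZl measurableT c sqr_integrable.
have := integrableD measurableT (integrableD measurableT i0 i1) i2.
by congr (P.-integrable setT _).
Qed.

Lemma integral_quadratic (a b c : R) :
  (\int[P]_w (a + b * X w + c * (X w * X w))%:E = (a + c * sigma ^+ 2)%:E)%E.
Proof.
have i0 : P.-integrable setT (fun w : T => (cst a w)%:E).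
  exact: finite_measure_integrable_cst.
have i1 := integrableZl measurableT b lin_integrable.
have i2 := integrableZl measurableT c sqr_integrable.
transitivity (\int[P]_w (((cst a w)%:E + b%:E * (X w)%:E) + c%:E * (X w * X w)%:E))%E.
  by apply: eq_integral => w _; rewrite !EFinD !EFinM.
rewrite integralD//; last exact: integrableD.
rewrite integralD// !integralZl//; [|exact: sqr_integrable|exact: lin_integrable].
rewrite (_ : (\int[P]_w (cst a w)%:E = a%:E)%E); last first.
  rewrite [LHS](integral_cst P measurableT a%:E) -[RHS]mule1; congr (_ * _)%E.
  exact: probability_setT.
by rewrite X_mean X_var mule0 adde0 -EFinM -EFinD.
Qed.

Variable G : R.
Hypothesis X_bdd : {ae P, forall w, `|X w| <= G}.

(** For small s, expR (s x) is below a quadratic polynomial, the mean of which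
    involves the first two moments only: G limits the admissible values of s but
    does not enter the exponent. *)
Lemma mgf_le (s : R) : `|s| * G <= 1 / 2 ->
  (\int[P]_w (expR (s * X w))%:E <= (expR (2 * s ^+ 2 * sigma ^+ 2))%:E)%E.
Proof.
move=> sG.
have m1 : measurable_fun setT (fun w => expR (s * X w)).
  have m0 : measurable_fun setT (fun w => s * X w) by exact: measurable_funM.
  exact: (measurableT_comp (@measurable_expR R) m0).
apply: (@le_trans _ _ (\int[P]_w (1 + s * X w + 2 * s ^+ 2 * (X w * X w))%:E)%E).
  apply: ae_ge0_le_integral => //.
  - exact/measurable_EFinP.
  - move=> w _; rewrite lee_fin.
    by have := sqr_ge0 (s * X w + 1 / 4); rewrite !expr2; lra.
  - apply/measurable_EFinP; apply: measurable_funD.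
      by apply: measurable_funD => //; exact: measurable_funM.
    by apply: measurable_funM => //; exact: measurable_funM.
  apply: filterS X_bdd => w Xw _; rewrite lee_fin.
  rewrite [2 * _ * _](_ : _ = 2 * (s * X w) ^+ 2); last by rewrite !expr2; ring.
  apply: expR_le_quadratic; apply: le_trans (ler_norm _) _; rewrite normrM.
  by apply: le_trans sG; rewrite ler_wpM2l.
rewrite integral_quadratic lee_fin; apply: le_trans (expR_ge1Dx _).
by rewrite lerD2l.
Qed.

End Moments.

Section Chernoff.
Variables (R : realType) (d : measure_display) (T : measurableType d).
Variables (P : probability T R) (n : nat) (I : eqType) (X : I -> T -> 'rV[R]_n).
Variables (sigma G : R) (a : 'I_n).
Hypothesis X_iid : iid P X.
Hypothesis X_var : forall i, zero_mean_var P (X i) sigma.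
Hypothesis X_bdd : forall i, {ae P, forall w, `|X i w 0 a| <= G}.

Lemma coord_measurable i : measurable_fun setT (fun w => X i w 0 a).
Proof.
have [mX _ _] := X_iid.
by apply: (measurableT_comp (continuous_measurable_rV (@coord_continuous _ _ _ 0 a)) (mX i)).
Qed.

Lemma coord_mean i : (\int[P]_w (X i w 0 a)%:E = 0)%E.
Proof. by have [+ _] := X_var i => /(_ a); rewrite unlock. Qed.

Lemma coord_var i : (\int[P]_w (X i w 0 a * X i w 0 a)%:E = (sigma ^+ 2)%:E)%E.
Proof. by have [_ +] := X_var i => /(_ a a); rewrite unlock eqxx. Qed.

Variables (s : seq I) (c : I -> R) (v theta : R).
Hypothesis s_uniq : uniq s.
Hypothesis c_sum : \sum_(i <- s) c i ^+ 2 <= v.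
Hypothesis theta_ge0 : 0 <= theta.
Hypothesis theta_small : forall i, `|theta * c i| * G <= 1 / 2.

Let Z w := \sum_(i <- s) c i * X i w 0 a.

Lemma comb_measurable : measurable_fun setT Z.
Proof.
apply: measurable_sum => i.
by apply: measurable_funM => //; exact: coord_measurable.
Qed.

Lemma mgf_comb :
  (\int[P]_w (expR (theta * Z w))%:E <= (expR (2 * theta ^+ 2 * sigma ^+ 2 * v))%:E)%E.
Proof.
have [mX _ indep] := X_iid.
pose h i (x : 'rV[R]_n) := expR (theta * c i * x 0 a).
have le1 i : (\int[P]_w (h i (X i w))%:E <=
    (expR (2 * (theta * c i) ^+ 2 * sigma ^+ 2))%:E)%E.
  apply: (mgf_le (@coord_measurable i) (@coord_mean i) (@coord_var i) (@X_bdd i)).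
  exact: theta_small.
have ge0 i : (0 <= \int[P]_w (h i (X i w))%:E)%E.
  by apply: integral_ge0 => w _; rewrite lee_fin expR_ge0.
have hM i : (\int[P]_w (h i (X i w))%:E = (fine (\int[P]_w (h i (X i w))%:E))%:E)%E.
  by rewrite fineK// ge0_fin_numE// (le_lt_trans (le1 i))// ltry.
have mh i : measurable_fun setT (h i : borel_rV R n -> R).
  have m0 : measurable_fun setT (fun x : borel_rV R n => theta * c i * (x : 'rV[R]_n) 0 a).
    apply: measurable_funM => //.
    by apply: continuous_measurable_rV; exact: coord_continuous.
  exact: (measurableT_comp (@measurable_expR R) m0).
have := indep_prod mX indep mh (fun i x => expR_ge0 _) hM s_uniq.
rewrite (_ : (\int[P]_w _)%E = (\int[P]_w (expR (theta * Z w))%:E)%E); last first.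
  apply: eq_integral => w _; congr _%:E; rewrite /Z mulr_sumr expR_sum.
  by apply: eq_bigr => i _; rewrite /h mulrA.
move=> ->; rewrite lee_fin.
apply: (@le_trans _ _ (\prod_(i <- s) expR (2 * (theta * c i) ^+ 2 * sigma ^+ 2))).
  apply: ler_prod => i _; rewrite fine_ge0//=.
  by rewrite -lee_fin -hM.
rewrite -expR_sum ler_expR.
rewrite (_ : \sum_(i <- s) _ = 2 * theta ^+ 2 * sigma ^+ 2 * \sum_(i <- s) c i ^+ 2).
  by rewrite ler_wpM2l// mulr_ge0 ?sqr_ge0// mulr_ge0 ?sqr_ge0.
by rewrite mulr_sumr; apply: eq_bigr => i _; rewrite !expr2; ring.
Qed.

Lemma chernoff (t : R) :
  (P [set w | (t <= Z w)%R] <= (expR (- theta * t + 2 * theta ^+ 2 * sigma ^+ 2 * v))%:E)%E.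
Proof.
have mZ := comb_measurable.
have mA : measurable [set w | t <= Z w].
  rewrite (_ : mkset _ = Z @^-1` `[t, +oo[%classic); last first.
    by apply/seteqP; split => w /=; rewrite in_itv/= andbT.
  by rewrite -[X in measurable X]setTI; exact: mZ.
rewrite expRD mulNr expRN EFinM.
have -> : (P [set w | (t <= Z w)%R] = ((expR (theta * t))^-1)%:E *
    ((expR (theta * t))%:E * P [set w | (t <= Z w)%R]))%E.
  by rewrite muleA -EFinM mulVf ?gt_eqF ?expR_gt0// mul1e.
rewrite lee_pmul2l//; last by rewrite lte_fin invr_gt0 expR_gt0.
apply: (le_trans _ mgf_comb).
rewrite -[X in P X]setIT -(integral_indic _ measurableT mA) -ge0_integralZl//; last first.
  by apply/measurable_EFinP; exact: measurable_indic.
apply: ge0_le_integral => //.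
- by apply: emeasurable_funM => //; apply/measurable_EFinP; exact: measurable_indic.
- have m0 : measurable_fun setT (fun w => theta * Z w) by exact: measurable_funM.
  by apply/measurable_EFinP; exact: (measurableT_comp (@measurable_expR R) m0).
move=> w _; rewrite -EFinM lee_fin indicE; have [wA|wA] := boolP (w \in _).
  by rewrite mulr1 ler_expR ler_wpM2l//; exact: (set_mem wA).
by rewrite mulr0 expR_ge0.
Qed.

End Chernoff.

(** * The support of the noise *)

Lemma ae_witness (R : realType) (d : measure_display) (T : measurableType d)
    (P : probability T R) (A : T -> Prop) :
  {ae P, forall w, A w} -> exists w, A w.
Proof.
move=> [N [mN PN0 nAN]]; apply: contrapT => /forallNP nA.
have : (P setT <= 0)%E.
  rewrite -PN0; apply: le_measure; [exact: mem_set|exact: mem_set|move=> w _].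
  exact/nAN/nA.
by rewrite probability_setT; apply/negP; rewrite -ltNge lte01.
Qed.

Section Support.
Variables (R : realType) (d : measure_display) (T : measurableType d).
Variables (P : probability T R) (n : nat) (X : T -> 'rV[R]_n).
Hypothesis X_meas : measurable_fun setT (X : T -> borel_rV R n).

Definition support : set 'rV[R]_n :=
  [set s | forall r, 0 < r -> (0 < P (X @^-1` [set y | (norm2 (y - s) < r)%R]))%E].

Let preim_open (A : set 'rV[R]_n) : open A -> measurable (X @^-1` A).
Proof.
move=> /open_measurable_rV mA; rewrite -[X in measurable X]setTI; exact: X_meas.
Qed.

Let preim_closed (A : set 'rV[R]_n) : closed A -> measurable (X @^-1` A).
Proof.
move=> /closed_measurable_rV mA; rewrite -[X in measurable X]setTI; exact: X_meas.
Qed.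

(** Otherwise a countable union of compact sets, each covered by finitely many
    null balls, would exhaust C. *)
Lemma support_meets (C : set 'rV[R]_n) : closed C -> (0 < P (X @^-1` C))%E ->
  exists2 s, C s & support s.
Proof.
move=> Ccl PC; apply: contrapT => nsupp.
have /choice[r rP] : forall s, exists r : R, C s ->
    0 < r /\ P (X @^-1` [set y | norm2 (y - s) < r]) = 0%E.
  move=> s; have [Cs|] := pselect (C s); last by exists 0.
  have : ~ support s by move=> ss; apply: nsupp; exists s.
  move=> /existsNP[r /not_implyP[r0 /negP]]; rewrite -leNgt => Pr.
  by exists r => _; split=> //; apply/eqP; rewrite eq_le Pr measure_ge0.
have null k : P.-negligible (X @^-1` (C `&` [set y | norm2 (y - 0) <= k%:R])).
  have Kcpt : compact (C `&` [set y | norm2 (y - 0) <= k%:R]).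
    apply: (closed_bounded_compact (M := k%:R)) => [|y [_ /=]]; last by rewrite subr0.
    by apply: closedI => //; exact: closed_norm2_ball.
  move: Kcpt; rewrite compact_cover => /(_ _ C (fun s => [set y | norm2 (y - s) < r s])).
  case=> [s Cs|y [Cy _]|D DC].
  - exact: open_norm2_ball.
  - by exists y => //=; rewrite subrr norm2_0; have [] := rP y Cy.
  move=> KD; have N : P.-negligible
      (X @^-1` (\bigcup_(s in [set` D]) [set y | norm2 (y - s) < r s])).
    rewrite preimage_bigcup bigcup_fset big_seq; elim/big_ind : _.
    - exact: negligible_set0.
    - by move=> A B; exact: negligibleU.
    move=> s /DC/set_mem Cs; have [_ Ps] := rP s Cs.
    by apply/negligibleP => //; apply: preim_open; exact: open_norm2_ball.
  by apply: negligibleS N => w /KD.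
have := negligible_bigcup null; rewrite -preimage_bigcup -setI_bigcupr.
rewrite (_ : \bigcup_k _ = setT); last first.
  apply/seteqP; split => // y _.
  have := archi_boundP (norm2_ge0 (y - 0)) => yk; eexists => //=; exact: ltW yk.
rewrite setIT => /(negligibleP _ (preim_closed Ccl)) P0.
by rewrite P0 ltxx in PC.
Qed.

(** The quadratic expression has mean b n sigma^2, so that the closed set where it
    is at most its mean is not null. *)
Lemma support_small (sigma b k : R) (g : 'rV[R]_n) : zero_mean_var P X sigma ->
  exists2 s, support s & b * norm2 s ^+ 2 - k * dot g s <= b * n%:R * sigma ^+ 2.
Proof.
move=> [Xm Xv].
pose q (x : 'rV[R]_n) := b * norm2 x ^+ 2 - k * dot g x.
have dot_cont : continuous (dot g).
    apply: (@lip_continuousR _ _ _ (norm2 g)) => x y.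
    by rewrite -dotBr ler_dot.
have q_cont : continuous q.
  have -> : q = (cst b \* (@norm2 R n \* @norm2 R n)) - (cst k \* dot g).
    by apply/funext => x; rewrite /q expr2.
  move=> x; apply: continuousB.
    apply: continuousM; first exact: cst_continuous.
    by apply: continuousM; exact: continuous_norm2.
  by apply: continuousM; [exact: cst_continuous|exact: dot_cont].
pose C := [set x | q x <= b * n%:R * sigma ^+ 2].
have Ccl : closed C.
  rewrite (_ : C = q @^-1` [set t | t <= b * n%:R * sigma ^+ 2])//.
  by apply: preimage_closed; [move=> ? _; exact: q_cont|exact: closed_le].
suff : (0 < P (X @^-1` C))%E by move=> /(support_meets Ccl)[s Cs ss]; exists s.
rewrite lt0e measure_ge0 andbT; apply/eqP => PC0.
have mX a : measurable_fun setT (fun w => X w 0 a).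
  by apply: (measurableT_comp (continuous_measurable_rV (@coord_continuous _ _ _ 0 a)) X_meas).
have Ea a : (\int[P]_w (X w 0 a)%:E = 0)%E by have := Xm a; rewrite unlock.
have Va a : (\int[P]_w (X w 0 a * X w 0 a)%:E = (sigma ^+ 2)%:E)%E.
  by have := Xv a a; rewrite unlock eqxx.
(* The expression minus its mean is a sum over the coordinates. *)
pose Y a w : R := - (b * sigma ^+ 2) + (- (k * g 0 a)) * X w 0 a + b * (X w 0 a * X w 0 a).
have iY a : P.-integrable setT (fun w => (Y a w)%:E).
  exact: (quadratic_integrable (mX a) (Va a)).
have EY a : (\int[P]_w (Y a w)%:E = 0)%E.
  by rewrite (integral_quadratic (mX a) (Ea a) (Va a)) addNr.
pose Z w := \sum_a Y a w.
have ZE w : Z w = q (X w) - b * n%:R * sigma ^+ 2.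
  rewrite /Z /q -dotxx /dot !big_split/= -!mulr_sumr.
  have -> : \sum_(a < n) - (b * sigma ^+ 2) = - (b * n%:R * sigma ^+ 2).
    by rewrite big_const iter_addr_0 card_ord mulNrn -mulr_natr; congr (- _); ring.
  have -> : \sum_(a < n) - (k * g 0 a) * X w 0 a = - (k * \sum_j g 0 j * X w 0 j).
    by rewrite mulr_sumr -sumrN; apply: eq_bigr => a _; ring.
  by ring.
have iZ : P.-integrable setT (fun w => (Z w)%:E).
  by rewrite /Z; under eq_fun do rewrite -sumEFin; exact: integrable_sum.
have EZ : (\int[P]_w (Z w)%:E = 0)%E.
  rewrite /Z; under eq_integral do rewrite -sumEFin.
  by rewrite integral_sum//; apply: big1 => a _; exact: EY.
have Zpos : {ae P, forall w, (0 < Z w)}.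
  exists (X @^-1` C); split=> //; first exact: preim_closed.
  move=> w /= /negP; rewrite -leNgt ZE subr_le0; exact.
have ZZ : ae_eq P setT (fun w => `|(Z w)%:E|)%E (fun w => (Z w)%:E).
  by apply: filterS Zpos => w Zw _; rewrite gee0_abs// lee_fin ltW.
have mZ : measurable_fun setT (fun w => (Z w)%:E) by have /integrableP[] := iZ.
have : (\int[P]_w `|(Z w)%:E| = 0)%E.
  by rewrite -EZ; apply: ae_eq_integral => //; exact: measurableT_comp.
move=> /(ae_eq_integral_abs P measurableT mZ) Z0.
suff : exists w : T, False by case.
apply: (@ae_witness _ _ _ P (fun=> False)).
by apply: filterS2 Zpos Z0 => w Zw /(_ I) /= [Zw0]; rewrite Zw0 ltxx in Zw.
Qed.

End Support.

(** * Consequences of the almost sure bound on the auxiliary function *)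

Section Bounded.
Variables (R : realType) (m n : nat) (f : 'I_m -> 'rV[R]_n -> R).
Variables (e : rel 'I_m) (W : 'M[R]_m) (L alpha : R).
Hypotheses (m_gt0 : (0 < m)%N) (n_gt0 : (0 < n)%N).
Hypothesis f_smooth : forall i, smooth (f i).
Hypothesis W_mix : mixing_matrix e W.
Hypothesis f_lip : forall i, lipschitz_grad (f i) L.
Hypothesis f_coercive : forall i, coercive (f i).
Hypotheses (L_ge0 : 0 <= L) (alpha_gt0 : 0 < alpha).
Variables (eps gamma mu delta : R).
Hypotheses (eps_gt0 : 0 < eps) (gamma_gt0 : 0 < gamma) (mu_gt0 : 0 < mu).
Hypothesis alpha_le : alpha * L <= lambda_min W.
Hypothesis regions : region1 f W alpha eps `|` region2 f alpha gamma `|`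
  region3 f W alpha mu delta = [set: 'rV[R]_(m * n)].
Implicit Types x y : 'rV[R]_(m * n).

Local Notation Q := (Qfun f W alpha).
Local Notation g := (resid f W alpha).
Local Notation lam := (lambda_min W).

(** The previous results apply to the auxiliary function, with one constant Lq for
    both the Lipschitz bound and the quadratic upper bound. *)
Lemma landscape : exists xs,
  [/\ g xs = 0, forall x, g x = 0 -> x = xs, forall x, Q xs <= Q x,
      forall x, norm2 (g x) < eps -> Q x - Q xs <= norm2 (g x) ^+ 2 / mu &
      forall x th, 0 < th < eps -> norm2 (x - xs) <= (Q x - Q xs) / th + 2 * th / mu].
Proof.
have [C C0 gC] := resid_lip W f_smooth f_lip L_ge0 alpha_gt0.
have l1 := lambda_min_le1 m_gt0 W_mix.
pose K := (1 - lam + alpha * L) / (2 * alpha).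
have al0 := ltW alpha_gt0.
have aL0 : 0 <= alpha * L by exact: mulr_ge0.
have K0 : 0 <= K by rewrite /K divr_ge0//; [lra|exact: mulr_ge0].
have gLq x y : norm2 (g x - g y) <= (C + 2 * K) * norm2 (x - y).
  by apply: le_trans (gC x y) _; rewrite ler_wpM2r ?norm2_ge0// lerDl mulr_ge0.
have QLq x y : Q y <= Q x + dot (g x) (y - x) + (C + 2 * K) / 2 * norm2 (y - x) ^+ 2.
  apply: le_trans (Q_upper m_gt0 f_smooth W_mix f_lip L_ge0 alpha_gt0 x y) _.
  by rewrite lerD2l ler_wpM2r ?sqr_ge0// -/K; lra.
have Lq0 : 0 < C + 2 * K by rewrite ltr_wpDr// mulr_ge0.
have Qc : continuous Q := Q_cont f_smooth.
have Qco := Q_coercive f_smooth W_mix f_coercive alpha_gt0.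
have Qcv : forall x, norm2 (g x) < eps -> exists2 r, 0 < r & forall y z,
    norm2 (y - x) < r -> norm2 (z - x) < r ->
    Q z + dot (g z) (y - z) + mu / 2 * norm2 (y - z) ^+ 2 <= Q y.
  by move=> x; exact: (Q_convex m_gt0 n_gt0 f_smooth W_mix f_lip L_ge0 alpha_gt0
      gamma_gt0 alpha_le regions).
have [xs gxs _] := minimum Lq0 Qc QLq Qco.
exists xs; split => [//|x gx|x|x gx|x th th0].
- exact: (critical_point_unique Lq0 eps_gt0 mu_gt0 Qc gLq QLq Qco Qcv).
- exact: (minimum_xs Lq0 eps_gt0 mu_gt0 Qc gLq QLq Qco Qcv).
- exact: (gap_le_grad Lq0 eps_gt0 mu_gt0 Qc gLq QLq Qco Qcv).
- exact: (dist_le_gap Lq0 eps_gt0 mu_gt0 Qc gLq QLq Qco Qcv).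
Qed.

Lemma norm2_stack (y : 'I_m -> 'rV[R]_n) (r : R) : 0 <= r ->
  (forall i, norm2 (y i) <= r) -> norm2 (stack y) <= m%:R * r.
Proof.
move=> r0 yr; apply: norm2_le; first by rewrite mulr_ge0.
rewrite dotxx norm2_block; apply: (@le_trans _ _ (\sum_(i < m) r ^+ 2)).
  by apply: ler_sum => i _; rewrite block_stack ler_pXn2r ?nnegrE ?norm2_ge0.
rewrite sumr_const card_ord exprMn -[leLHS]mulr_natl ler_wpM2r ?sqr_ge0//.
by rewrite -natrX ler_nat leq_pmulr.
Qed.

Lemma ndgd_continuous (x0 : 'rV[R]_(m * n)) (s : nat -> 'I_m -> 'rV[R]_n) k (eta : R) :
  0 < eta -> exists2 r, 0 < r & forall xi : nat -> 'I_m -> 'rV[R]_n,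
    (forall j i, (j < k)%N -> norm2 (xi j i - s j i) < r) ->
    norm2 (ndgd f W alpha x0 xi k - ndgd f W alpha x0 s k) < eta.
Proof.
have [C C0 gC] := resid_lip W f_smooth f_lip L_ge0 alpha_gt0.
elim: k eta => [|k IH] eta eta0; first by exists 1 => // xi _; rewrite subrr norm2_0.
have aC : 0 < 1 + alpha * C by rewrite ltr_wpDr// mulr_ge0// ltW.
have q0 : 0 < eta / (2 * (1 + alpha * C)) by rewrite divr_gt0 ?mulr_gt0.
have [r1 r10 IHr] := IH _ q0.
have am0 : 0 < 4 * (alpha * m%:R) by rewrite !mulr_gt0 ?ltr0n.
pose r := Num.min r1 (eta / (4 * (alpha * m%:R))).
have r0 : 0 < r by rewrite lt_min r10 divr_gt0.
exists r => // xi h; rewrite !(ndgdS f_smooth W_mix alpha_gt0).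
have : norm2 (ndgd f W alpha x0 xi k - ndgd f W alpha x0 s k) < eta / (2 * (1 + alpha * C)).
  by apply: IHr => j i jk; apply: lt_le_trans (h _ _ (ltnW jk)) _; rewrite ge_min lexx.
move: (ndgd _ _ _ _ xi k) (ndgd _ _ _ _ s k) => x y; rewrite ltr_pdivlMr ?mulr_gt0// => xy.
have -> : x - alpha *: (g x + stack (xi k)) - (y - alpha *: (g y + stack (s k))) =
    (x - y) - alpha *: ((g x - g y) + stack (fun i => xi k i - s k i)).
  move: (g x) (g y) => u v; apply/rowP => l; rewrite !mxE; ring.
have hS : norm2 (stack (fun i => xi k i - s k i)) <= m%:R * r.
  by apply: norm2_stack => [|i]; rewrite ltW// h.
have rle : r * (4 * (alpha * m%:R)) <= eta.
  by rewrite -ler_pdivlMr// /r ge_min lexx orbT.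
apply: le_lt_trans (norm2B _ _) _; rewrite norm2Z gtr0_norm//.
have := norm2D (g x - g y) (stack (fun i => xi k i - s k i)).
move=> /(ler_wpM2l (ltW alpha_gt0)); rewrite mulrDr.
have := ler_wpM2l (ltW alpha_gt0) (gC x y).
have := ler_wpM2l (ltW alpha_gt0) hS.
by move: xy rle; move: (norm2 (x - y)) => t; lra.
Qed.

Variables (d : measure_display) (T : measurableType d) (P : probability T R).
Variables (xi : nat -> 'I_m -> T -> 'rV[R]_n) (sigma B : R) (x0 : 'rV[R]_(m * n)).
Hypothesis xi_iid : iid P (fun ki : nat * 'I_m => xi ki.1 ki.2).
Hypothesis xi_var : forall k i, zero_mean_var P (xi k i) sigma.
Hypothesis sigma_le : sigma ^+ 2 <= lam * eps ^+ 2 / (m * n)%:R.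
Hypothesis Q_bounded : {ae P, forall w, forall k,
  `|Q (ndgd f W alpha x0 (fun k i => xi k i w) k)| <= B}.

Let i0 : 'I_m := Ordinal m_gt0.
Let supp := support P (xi 0%N i0).

(** Any finite noise sequence drawn from the support is approximated with positive
    probability, so that the almost sure bound extends to it by continuity. *)
Lemma support_path_bounded (s : nat -> 'I_m -> 'rV[R]_n) k :
  (forall j i, supp (s j i)) -> `|Q (ndgd f W alpha x0 s k)| <= B.
Proof.
move=> ss; rewrite leNgt; apply/negP => Qk.
have Qc : continuous Q := Q_cont f_smooth.
have : nbhs (Q (ndgd f W alpha x0 s k)) [set t | B < `|t|].
  apply: open_nbhs_nbhs; split => //.
  apply: (@open_comp _ _ (@Num.norm _ R) [set t | B < t]); last exact: open_gt.
  by move=> t _; exact: norm_continuous.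
move=> /(Qc _)/nbhs_norm2P[eta eta0 etaP].
have [r r0 rP] := ndgd_continuous x0 s k eta0.
have [mX ident indep] := xi_iid.
pose idx := [seq (j, i) | j <- iota 0 k, i <- enum 'I_m].
have idxP j i : (j < k)%N -> (j, i) \in idx.
  by move=> jk; apply/allpairsP; exists (j, i); rewrite mem_iota mem_enum.
have idx_uniq : uniq idx by apply: allpairs_uniq => [||[? ?] [? ?] _ _ [-> ->]//];
  [exact: iota_uniq|exact: enum_uniq].
pose U (p : nat * 'I_m) : set (borel_rV R n) := [set y | norm2 ((y : 'rV[R]_n) - s p.1 p.2) < r].
have mU p : measurable (U p) by apply: open_measurable_rV; exact: open_norm2_ball.
pose A := \bigcap_(p in [set` idx]) (xi p.1 p.2 @^-1` U p).
have PA : (0 < P A)%E.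
  rewrite /A (indep idx U idx_uniq mU); elim/big_ind : _ => //.
    by move=> a b; exact: mule_gt0.
  move=> p _; rewrite (ident p (0%N, i0))//=; exact: ss.
have : P.-negligible A.
  apply: negligibleS Q_bounded => w wA; apply/existsNP; exists k; apply/negP.
  rewrite -ltNge; apply: etaP; apply: rP => j i jk.
  exact: (wA (j, i) (idxP _ _ jk)).
have mA : measurable A.
  apply: fin_bigcap_measurable => // p _.
  by rewrite -[X in measurable X]setTI; exact: (mX p).
by move=> /(negligibleP _ mA) PA0; rewrite PA0 ltxx in PA.
Qed.

Let B_ge0 : 0 <= B.
Proof.
have [mX _ _] := xi_iid.
have PT : (0 < P (xi 0%N i0 @^-1` setT))%E.
  by rewrite preimage_setT; apply: lt_le_trans lte01 _; rewrite (probability_setT P).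
have [s _ ss] := support_meets (mX (0%N, i0)) closedT PT.
by apply: le_trans (support_path_bounded 0 (s := fun _ _ => s) _).
Qed.

Variable xs : 'rV[R]_(m * n).
Hypothesis alpha_small : alpha * L <= 1 / 2.
Hypothesis Q_gap : forall x, norm2 (g x) < eps -> Q x - Q xs <= norm2 (g x) ^+ 2 / mu.

(** Whatever the current point is, some noise value of the support does not
    exceed the mean of the descent estimate.  Following such values, Q would
    decrease forever if the gradient never became small. *)
Lemma minimum_ge : - B - eps ^+ 2 / mu <= Q xs.
Proof.
have l1 := lambda_min_le1 m_gt0 W_mix.
pose a := 1 - lam + alpha * L.
have a0 : 0 <= a by rewrite addr_ge0 ?subr_ge0// mulr_ge0// ltW.
have a1 : a <= 1 by have := alpha_le; rewrite /a; lra.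
have /choice[sel selP] : forall v : 'rV[R]_n, exists s, supp s /\
    a / 2 * norm2 s ^+ 2 - (1 - a) * dot v s <= a / 2 * n%:R * sigma ^+ 2.
  move=> v; have [mX _ _] := xi_iid.
  have [s ss sP] := support_small (mX (0%N, i0)) (a / 2) (1 - a) v (xi_var 0%N i0).
  by exists s.
pose noise x i := sel (block (g x) i).
pose st k := iter k (fun x => x - alpha *: (g x + stack (noise x))) x0.
have stE k : ndgd f W alpha x0 (fun k => noise (st k)) k = st k.
  by elim: k => // k IH; rewrite (ndgdS f_smooth W_mix alpha_gt0) IH.
have Qst k : `|Q (st k)| <= B.
  by rewrite -stE; apply: support_path_bounded => j i; have [] := selP (block (g (st j)) i).
have dec x : eps <= norm2 (g x) -> Q (x - alpha *: (g x + stack (noise x))) <=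
    Q x - alpha * eps ^+ 2 * (1 - a / 2 - a / 2 * lam).
  move=> gx; apply: le_trans (Q_upper m_gt0 f_smooth W_mix f_lip L_ge0 alpha_gt0 x _) _.
  rewrite -/a [_ - _ - x]addrAC subrr add0r dotNr dotZr norm2N norm2Z gtr0_norm// exprMn.
  rewrite dotDr dotxx (sqr_norm2D (g x) (stack _)).
  have S : a / 2 * norm2 (stack (noise x)) ^+ 2 - (1 - a) * dot (g x) (stack (noise x)) <=
      a / 2 * lam * eps ^+ 2.
    rewrite norm2_block dot_block !mulr_sumr -sumrB.
    apply: (@le_trans _ _ (\sum_(i < m) (a / 2 * n%:R * sigma ^+ 2))).
      by apply: ler_sum => i _; rewrite block_stack; have [] := selP (block (g x) i).
    rewrite sumr_const card_ord -[leLHS]mulr_natr.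
    have mn0 : 0 < (m * n)%:R :> R by rewrite ltr0n muln_gt0 m_gt0.
    have := sigma_le; rewrite ler_pdivlMr// natrM.
    by move=> /(ler_wpM2l (divr_ge0 a0 (ler0n _ 2))); lra.
  have e1 X : a / (2 * alpha) * (alpha ^+ 2 * X) = alpha * (a / 2 * X).
    by field; rewrite gt_eqF.
  rewrite e1.
  have G : eps ^+ 2 <= norm2 (g x) ^+ 2 by rewrite ler_pXn2r ?nnegrE ?norm2_ge0// ltW.
  have a2 : 0 <= alpha * (1 - a / 2) by apply: mulr_ge0; [exact: ltW|lra].
  have := ler_wpM2l a2 G; have := ler_wpM2l (ltW alpha_gt0) S.
  by move: (norm2 (g x) ^+ 2) (norm2 (stack _) ^+ 2) (dot _ _) => u v t; lra.
have c0 : 0 < alpha * eps ^+ 2 * (1 - a / 2 - a / 2 * lam).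
  have lam0 : 0 <= lam by rewrite (le_trans _ alpha_le)// mulr_ge0// ltW.
  have : a * (1 + lam) <= (3 / 2 - lam) * (1 + lam).
    by apply: ler_wpM2r; [lra|have := alpha_small; rewrite /a; lra].
  have := sqr_ge0 (lam - 1 / 4); rewrite expr2 => h1 h2.
  by rewrite mulr_gt0 ?mulr_gt0 ?exprn_gt0//; lra.
have [k gk] : exists k, norm2 (g (st k)) < eps.
  apply: contrapT => /forallNP ng.
  have Qk k : Q (st k) <= Q x0 - k%:R * (alpha * eps ^+ 2 * (1 - a / 2 - a / 2 * lam)).
    elim: k => [|k IH]; first by rewrite mul0r subr0.
    have /negP := ng k; rewrite -leNgt => /dec h; apply: le_trans h _.
    rewrite (_ : k.+1%:R = k%:R + 1 :> R); last by rewrite natr1.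
    by rewrite (mulrDl k%:R) mul1r; lra.
  have Qx0 := Qst 0%N; have /= := archi_boundP (divr_ge0 (addr_ge0 B_ge0 B_ge0) (ltW c0)).
  rewrite ltr_pdivrMr// ltNge => /negP; apply; set k := Num.bound _.
  by have := Qst k; have := Qk k; move: Qx0; rewrite /st /= !ler_norml; lra.
have := Q_gap gk; have := Qst k; rewrite ler_norml => /andP[h1 _] h2.
have : norm2 (g (st k)) ^+ 2 / mu <= eps ^+ 2 / mu.
  by rewrite ler_pM2r ?invr_gt0// ler_pXn2r ?nnegrE ?norm2_ge0// ltW.
lra.
Qed.

Variable D : R.
Hypothesis g_xs : g xs = 0.
Hypothesis D_bound : forall x, Q x <= B -> norm2 (x - xs) <= D.

(** Repeating a value of the support shifts the mean of the nodes at a constant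
    speed; to keep it bounded, the gradients must compensate for the noise. *)
Lemma support_coord_lt s a : supp s -> `|s 0 a| < L * D + 1.
Proof.
move=> ss; pose st k := ndgd f W alpha x0 (fun _ _ => s) k.
have stD k : norm2 (st k - xs) <= D.
  apply: D_bound; apply: le_trans (ler_norm _) _.
  exact: support_path_bounded.
have D0 : 0 <= D by exact: le_trans (norm2_ge0 _) (stD 0%N).
pose S k := \sum_i block (st k) i 0 a.
pose G k := \sum_i grad (f i) (block (st k) i) 0 a.
have SS k : S k.+1 = S k - alpha * (G k + m%:R * s 0 a).
  rewrite /S /st (ndgdS f_smooth W_mix alpha_gt0) -/(st k).
  have -> : G k = \sum_i block (g (st k)) i 0 a.
    by rewrite /G -!summxE (sum_block_resid alpha f_smooth W_mix).
  have -> : m%:R * s 0 a = \sum_(i < m) s 0 a by rewrite sumr_const card_ord mulr_natl.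
  rewrite -big_split/= mulr_sumr -sumrB.
  by apply: eq_bigr => i _; rewrite blockB blockZ blockD block_stack !mxE.
have Gle k : `|G k| <= m%:R * (L * D).
  have -> : G k = \sum_i (grad (f i) (block (st k) i) - grad (f i) (block xs i)) 0 a.
    under [RHS]eq_bigr do rewrite mxE; rewrite big_split/= -[LHS]addr0; congr (_ + _).
    have := congr1 (fun v : 'rV[R]_n => v 0 a) (sum_block_resid alpha f_smooth W_mix xs).
    rewrite g_xs big1 => [|i _]; last by apply/rowP => j; rewrite !mxE.
    rewrite mxE summxE => Z; under [RHS]eq_bigr do rewrite mxE.
    by rewrite sumrN -Z oppr0.
  apply: le_trans (ler_norm_sum _ _ _) _.
  apply: (@le_trans _ _ (\sum_(i < m) L * D)); last first.
    by rewrite sumr_const card_ord -[leLHS]mulr_natl.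
  apply: ler_sum => i _; apply: le_trans (coord_le_norm2 _ _) _.
  apply: le_trans (f_lip _ _ _) _; rewrite ler_wpM2l// -blockB.
  by apply: le_trans (norm2_block_le _ _) (stD k).
have Sbd k : `|S k - S 0%N| <= m%:R * (2 * D).
  rewrite /S -sumrB; apply: le_trans (ler_norm_sum _ _ _) _.
  apply: (@le_trans _ _ (\sum_(i < m) 2 * D)); last first.
    by rewrite sumr_const card_ord -[leLHS]mulr_natl.
  apply: ler_sum => i _.
  rewrite (_ : _ - _ = block (st k - st 0%N) i 0 a); last by rewrite !mxE.
  apply: le_trans (coord_le_norm2 _ _) _; apply: le_trans (norm2_block_le _ _) _.
  apply: le_trans (norm2_dist _ xs _) _; rewrite (norm2_sub xs).
  by have := stD k; have := stD 0%N; lra.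
have drift k : `|S k - S 0%N + k%:R * (alpha * m%:R * s 0 a)| <=
    k%:R * (alpha * m%:R * (L * D)).
  elim: k => [|k IH]; first by rewrite subrr !mul0r addr0 normr0.
  rewrite SS -[k.+1]addn1 natrD !mulrDl !mul1r.
  have := ler_wpM2l (ltW alpha_gt0) (Gle k); rewrite -{1}(gtr0_norm alpha_gt0) -normrM => h.
  rewrite (_ : _ - _ + _ = (S k - S 0%N + k%:R * (alpha * m%:R * s 0 a)) - alpha * G k);
    last by ring.
  by apply: le_trans (ler_normB _ _) _; move: IH h; lra.
have m0 : 0 < m%:R :> R by rewrite ltr0n.
have := archi_boundP (divr_ge0 (mulr_ge0 (ler0n _ 2) D0) (ltW alpha_gt0)).
set N := Num.bound _; rewrite ltr_pdivrMr// => N2D.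
have N0 : 0 < N%:R * alpha by apply: le_lt_trans N2D; rewrite mulr_ge0.
have : N%:R * (alpha * m%:R) * `|s 0 a| <= N%:R * (alpha * m%:R * (L * D)) + m%:R * (2 * D).
  have -> : N%:R * (alpha * m%:R) * `|s 0 a| = `|N%:R * (alpha * m%:R * s 0 a)|.
    rewrite [in RHS]mulrA [RHS]normrM; congr (_ * _).
    by rewrite ger0_norm// mulr_ge0// mulr_ge0// ltW.
  have := drift N; have := Sbd N; rewrite !ler_norml => /andP[h1 h2] /andP[h3 h4].
  by apply/andP; split; lra.
rewrite -(ltr_pM2l (mulr_gt0 N0 m0)).
have := ltr_pM2l m0 (2 * D) (N%:R * alpha); rewrite N2D => h1 h2.
by apply: le_lt_trans (_ : _ <= N%:R * (alpha * m%:R) * `|s 0 a|) _; lra.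
Qed.

Lemma noise_bounded k i a : {ae P, forall w, `|xi k i w 0 a| <= L * D + 1}.
Proof.
have [mX ident _] := xi_iid.
pose C := [set y : 'rV[R]_n | L * D + 1 <= `|y 0 a|].
have Ccl : closed C.
  rewrite (_ : C = (fun y : 'rV[R]_n => `|y 0 a|) @^-1` [set t | L * D + 1 <= t])//.
  apply: preimage_closed; last exact: closed_ge.
  move=> y _; apply: (@continuous_comp _ _ _ (fun y : 'rV[R]_n => y 0 a)).
    exact: coord_continuous.
  exact: norm_continuous.
have PC : P (xi k i @^-1` C) = 0%E.
  have mC := closed_measurable_rV Ccl.
  rewrite (ident (k, i) (0%N, i0) _ mC)/=.
  apply/eqP; rewrite eq_le measure_ge0 andbT leNgt; apply/negP => PC.
  have [s Cs ss] := support_meets (mX (0%N, i0)) Ccl PC.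
  by have := support_coord_lt a ss; rewrite ltNge => /negP; apply.
exists (xi k i @^-1` C); split=> //.
  have mC := closed_measurable_rV Ccl.
  by rewrite -[X in measurable X]setTI; exact: (mX (k, i)).
by move=> w /= /negP; rewrite -ltNge => /ltW.
Qed.

End Bounded.

(** * The filtered noise *)

Section UnionBound.
Variables (R : realType) (d : measure_display) (T : measurableType d).
Variables (P : probability T R).

Lemma union_bound (I : Type) (r : seq I) (A : I -> set T) (c : R) :
  (forall i, measurable (A i)) -> (forall i, (P (A i) <= c%:E)%E) ->
  (P (\big[setU/set0]_(i <- r) A i) <= ((size r)%:R * c)%:E)%E.
Proof.
move=> mA PA; elim: r => [|i r IH]; first by rewrite big_nil measure0 mul0r.
have mr : measurable (\big[setU/set0]_(i <- r) A i) by exact: bigsetU_measurable.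
rewrite big_cons; apply: (le_trans (measureU2 P (mA i) mr)).
rewrite (_ : (size (i :: r))%:R = 1 + (size r)%:R :> R); last by rewrite addrC natr1.
rewrite mulrDl mul1r EFinD; apply: leeD; [exact: PA|exact: IH].
Qed.

End UnionBound.

Section Coefficients.
Variables (R : realType) (m : nat) (e : rel 'I_m) (W : 'M[R]_m) (alpha mu : R).
Hypotheses (m_gt0 : (0 < m)%N) (W_mix : mixing_matrix e W).
Hypotheses (alpha_gt0 : 0 < alpha) (mu_gt0 : 0 < mu).
Hypothesis alpha_mu : alpha * mu <= lambda_min W.

(** The noise is filtered through W - alpha mu I instead of W, which would let the
    mean over the nodes perform a random walk.  The damping keeps the variance of
    order alpha at all times; it costs an error of norm mu |z| in the gradient. *)
Definition damped (i l : 'I_m) : R := W i l - alpha * mu * (i == l)%:R.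

Lemma lambda_min_diag i : lambda_min W <= W i i.
Proof.
have [Ws _ _ _ _] := W_mix.
have := lambda_min_rayleigh (delta_mx 0 i) m_gt0 Ws.
by rewrite -dotxx !dot_delta mxE !eqxx mulr1 -rowE mxE.
Qed.

Lemma damped_ge0 i l : 0 <= damped i l.
Proof.
rewrite /damped; case: eqVneq => [<-|_]; last first.
  by rewrite mulr0 subr0; exact: mixing_ge0 W_mix _ _.
by rewrite mulr1 subr_ge0 (le_trans alpha_mu)// lambda_min_diag.
Qed.

Lemma damped_sum i : \sum_l damped i l = 1 - alpha * mu.
Proof.
have [_ rows _ _ _] := W_mix.
rewrite sumrB rows -mulr_sumr (bigD1 i)//= eqxx big1 ?addr0 ?mulr1// => l li.
by rewrite eq_sym (negbTE li).
Qed.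

Let am1 : alpha * mu <= 1.
Proof. exact: le_trans alpha_mu (lambda_min_le1 m_gt0 W_mix). Qed.

Let am0 : 0 < alpha * mu. Proof. exact: mulr_gt0. Qed.

(** The coefficient with which the noise vector of index p enters component i of
    the filtered noise at time k. *)
Fixpoint coef (k : nat) (i : 'I_m) (p : nat * 'I_m) : R :=
  if k is k'.+1 then \sum_l damped i l * coef k' l p - alpha * (p == (k', i))%:R
  else 0.

Lemma coef_late k i p : (k <= p.1)%N -> coef k i p = 0.
Proof.
elim: k i => //= k IH i kp; rewrite big1 => [|l _]; last by rewrite IH ?mulr0// ltnW.
by case: eqP kp => [->|_ _]; [rewrite ltnn|rewrite mulr0 subr0].
Qed.

Lemma coef_le k i p : `|coef k i p| <= alpha.
Proof.
elim: k i => [|k IH] i /=; first by rewrite normr0 ltW.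
case: eqP => [->|_].
  rewrite big1 => [|l _]; last by rewrite coef_late ?mulr0.
  by rewrite mulr1 add0r normrN gtr0_norm.
rewrite mulr0 subr0; apply: le_trans (ler_norm_sum _ _ _) _.
apply: (@le_trans _ _ (\sum_l damped i l * alpha)).
  by apply: ler_sum => l _; rewrite normrM ger0_norm ?damped_ge0// ler_wpM2l ?damped_ge0.
rewrite -mulr_suml damped_sum ler_piMl ?(ltW alpha_gt0)//.
by have := am0; lra.
Qed.

(** Jensen's inequality for the weights of a row. *)
Lemma damped_sqr i (c : 'I_m -> R) : (\sum_l damped i l * c l) ^+ 2 <=
  (1 - alpha * mu) * \sum_l damped i l * c l ^+ 2.
Proof.
rewrite -(damped_sum i) expr2 !mulr_suml; apply: le_trans (_ : _ <=
  \sum_l \sum_l' damped i l * damped i l' * ((c l ^+ 2 + c l' ^+ 2) / 2)) _.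
  apply: ler_sum => l _; rewrite mulr_sumr; apply: ler_sum => l' _.
  have := mulr_ge0 (mulr_ge0 (damped_ge0 i l) (damped_ge0 i l')) (sqr_ge0 (c l - c l')).
  by rewrite !expr2; lra.
rewrite le_eqVlt; apply/orP; left; apply/eqP.
transitivity (\sum_l \sum_l' (damped i l * damped i l' * c l' ^+ 2 / 2 +
                              damped i l' * damped i l * c l ^+ 2 / 2)).
  by apply: eq_bigr => l _; apply: eq_bigr => l' _; lra.
under eq_bigr do rewrite big_split.
rewrite big_split/= [X in _ + X]exchange_big -big_split/=; apply: eq_bigr => l _.
rewrite mulr_sumr -big_split/=; apply: eq_bigr => l' _; lra.
Qed.

(** The damping makes the variances sum to a geometric series. *)
Lemma coef_sqr_sum k i (r : seq (nat * 'I_m)) : uniq r ->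
  \sum_(p <- r) coef k i p ^+ 2 <= alpha / mu.
Proof.
move=> ur; elim: k i => [|k IH] i.
  by rewrite big1 => [|p _]; [rewrite divr_ge0// ltW|rewrite expr0n].
have delta1 : \sum_(p <- r) (p == (k, i))%:R <= 1 :> R.
  rewrite -natr_sum (_ : (\sum_(p <- r) (p == (k, i)))%N = count_mem (k, i) r).
    by rewrite count_uniq_mem// (ler_nat _ _ 1) leq_b1.
  by rewrite -sum1_count [RHS]big_mkcond; apply: eq_bigr => p _ /=; case: eqP.
apply: (@le_trans _ _ (\sum_(p <- r) ((1 - alpha * mu) * (\sum_l damped i l * coef k l p ^+ 2) +
    alpha ^+ 2 * (p == (k, i))%:R))).
  apply: ler_sum => p _ /=; case: eqP => [->|_].
    rewrite big1 => [|l _]; last by rewrite coef_late ?mulr0.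
    rewrite big1 => [|l _]; last by rewrite coef_late ?expr0n ?mulr0.
    by rewrite !mulr1 mulr0 !add0r sqrrN.
  by rewrite !mulr0 subr0 addr0; exact: damped_sqr.
rewrite big_split/= -!mulr_sumr exchange_big/=.
have h1 : \sum_l \sum_(p <- r) damped i l * coef k l p ^+ 2 <= (1 - alpha * mu) * (alpha / mu).
  rewrite -(damped_sum i) mulr_suml; apply: ler_sum => l _.
  by rewrite -mulr_sumr ler_wpM2l ?damped_ge0.
have rho0 : 0 <= 1 - alpha * mu by rewrite subr_ge0.
have := ler_wpM2l rho0 h1; have := ler_wpM2l (sqr_ge0 alpha) delta1.
have : (1 - alpha * mu) * ((1 - alpha * mu) * (alpha / mu)) + alpha ^+ 2 =
    alpha / mu - alpha ^+ 2 * (1 - alpha * mu) by field; rewrite gt_eqF.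
have := mulr_ge0 (sqr_ge0 alpha) rho0.
lra.
Qed.

Variable n : nat.

Fixpoint filtered (xi : nat -> 'I_m -> 'rV[R]_n) (k : nat) : 'rV[R]_(m * n) :=
  if k is k'.+1 then
    filtered xi k' *m What n W - (alpha * mu) *: filtered xi k' - alpha *: stack (xi k')
  else 0.

Definition noise_index (K : nat) : seq (nat * 'I_m) :=
  [seq (j, i) | j <- iota 0 K, i <- enum 'I_m].

Lemma noise_index_uniq K : uniq (noise_index K).
Proof.
by apply: allpairs_uniq => [||[? ?] [? ?] _ _ [-> ->]//]; [exact: iota_uniq|exact: enum_uniq].
Qed.

Lemma filteredE xi K k i a : (k <= K)%N ->
  block (filtered xi k) i 0 a =
  \sum_(p <- noise_index K) coef k i p * xi p.1 p.2 0 a.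
Proof.
have [Ws _ _ _ _] := W_mix.
elim: k i => [|k IH] i kK /=.
  by rewrite big1 => [|p _]; [rewrite !mxE|rewrite mul0r].
rewrite !blockB !blockZ block_stack block_mul_What.
under [RHS]eq_bigr do rewrite mulrBl mulr_suml -mulrA.
rewrite sumrB exchange_big/= -mulr_sumr.
have -> : \sum_(p <- noise_index K) (p == (k, i))%:R * xi p.1 p.2 0 a = xi k i 0 a.
  rewrite (bigD1_seq (k, i))/=; last exact: noise_index_uniq.
    by rewrite eqxx mul1r big1 ?addr0// => p /negbTE ->; rewrite mul0r.
  by apply/allpairsP; exists (k, i); rewrite mem_iota mem_enum.
under [X in _ = X - _]eq_bigr => l _.
  under eq_bigr do rewrite -mulrA.
  rewrite -mulr_sumr -IH ?(ltnW kK)//.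
  over.
rewrite mxE; congr (_ + _); last by rewrite !mxE.
rewrite mxE summxE /damped.
under [RHS]eq_bigr do rewrite mulrBl.
rewrite sumrB; congr (_ + _).
  by apply: eq_bigr => l _; rewrite mxE -{1}Ws mxE.
rewrite mxE [in LHS]mxE (bigD1 i)//= eqxx mulr1 big1 ?addr0// => l li.
by rewrite eq_sym (negbTE li) mulr0 mul0r.
Qed.

End Coefficients.

Section NoiseEvent.
Variables (R : realType) (m n : nat) (e : rel 'I_m) (W : 'M[R]_m) (alpha mu : R).
Hypotheses (m_gt0 : (0 < m)%N) (W_mix : mixing_matrix e W).
Hypotheses (alpha_gt0 : 0 < alpha) (mu_gt0 : 0 < mu).
Hypothesis alpha_mu : alpha * mu <= lambda_min W.
Variables (d : measure_display) (T : measurableType d) (P : probability T R).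
Variables (xi : nat -> 'I_m -> T -> 'rV[R]_n) (sigma G : R).
Hypothesis xi_iid : iid P (fun ki : nat * 'I_m => xi ki.1 ki.2).
Hypothesis xi_var : forall k i, zero_mean_var P (xi k i) sigma.
Hypothesis xi_bdd : forall k i a, {ae P, forall w, `|xi k i w 0 a| <= G}.
Hypothesis G_ge0 : 0 <= G.

(** Each coordinate of the filtered noise is a sum of independent variables with
    total variance at most sigma^2 alpha / mu; the union bound runs over the times,
    the nodes, the coordinates and both signs. *)
Lemma noise_event (K : nat) (theta t : R) : 0 <= theta -> theta * alpha * G <= 1 / 2 ->
  exists E : set T, [/\ measurable E,
    ((1 - (K.+1 * m * n)%:R * (2 * expR (- theta * t +
       2 * theta ^+ 2 * sigma ^+ 2 * (alpha / mu))))%:E <= P E)%E &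
    forall w, E w -> forall k i a, (k <= K)%N ->
      `|block (filtered W alpha mu (fun k i => xi k i w) k) i 0 a| <= t].
Proof.
move=> th0 thG; set b := expR _.
pose Z (c : nat * 'I_m -> R) a w := \sum_(p <- noise_index m K) c p * xi p.1 p.2 w 0 a.
pose A (q : 'I_K.+1 * 'I_m * 'I_n) :=
  [set w | t <= Z (coef W alpha mu q.1.1 q.1.2) q.2 w] `|`
  [set w | t <= Z (fun p => - coef W alpha mu q.1.1 q.1.2 p) q.2 w].
have mZ c a : measurable [set w | t <= Z c a w].
  have := comb_measurable a xi_iid (noise_index m K) c => mZ.
  rewrite (_ : mkset _ = Z c a @^-1` `[t, +oo[%classic); last first.
    by apply/seteqP; split => w /=; rewrite in_itv/= andbT.
  by rewrite -[X in measurable X]setTI; exact: mZ.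
have small (c : nat * 'I_m -> R) : (forall p, `|c p| <= alpha) ->
    forall p, `|theta * c p| * G <= 1 / 2.
  move=> cle p; apply: le_trans thG; rewrite ler_wpM2r// normrM ger0_norm//.
  by rewrite ler_wpM2l.
have PZ c a : (forall p, `|c p| <= alpha) ->
    \sum_(p <- noise_index m K) c p ^+ 2 <= alpha / mu ->
    (P [set w | (t <= Z c a w)%R] <= b%:E)%E.
  move=> cle csum; apply: (chernoff xi_iid (fun p => xi_var p.1 p.2)
    (fun p => xi_bdd p.1 p.2 a) (noise_index_uniq m K) csum th0).
  exact: small.
have mA q : measurable (A q) by apply: measurableU; exact: mZ.
have PA q : (P (A q) <= (2 * b)%:E)%E.
  apply: (le_trans (measureU2 P (mZ _ _) (mZ _ _))).
  rewrite (_ : 2 * b = b + b); last by rewrite mulr_natl mulr2n.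
  rewrite EFinD; apply: leeD; apply: PZ => [p|].
  - exact: (coef_le m_gt0 W_mix).
  - exact: (coef_sqr_sum m_gt0 W_mix alpha_gt0 mu_gt0 alpha_mu _ _ (noise_index_uniq m K)).
  - by rewrite normrN; exact: (coef_le m_gt0 W_mix).
  under eq_bigr do rewrite sqrrN.
  exact: (coef_sqr_sum m_gt0 W_mix alpha_gt0 mu_gt0 alpha_mu _ _ (noise_index_uniq m K)).
exists (~` \big[setU/set0]_(q : 'I_K.+1 * 'I_m * 'I_n) A q); split.
- by apply: measurableC; exact: bigsetU_measurable.
- rewrite probability_setC; last exact: bigsetU_measurable.
  rewrite EFinB; apply: leeB => //.
  apply: (le_trans (union_bound _ mA PA)).
  by rewrite -sum1_size sum1_card !card_prod !card_ord.
move=> w /= nA k i a kK.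
have kK1 : (k < K.+1)%N by [].
have /not_orP[/negP + /negP] : ~ A ((Ordinal kK1, i), a) w.
  by move=> Aw; apply: nA; rewrite (bigD1 ((Ordinal kK1, i), a))//=; left.
rewrite /A /= -!ltNge (filteredE _ _ W_mix _ _ _ kK) => h1.
under [X in X < _ -> _]eq_bigr do rewrite mulNr.
rewrite sumrN => h2.
by rewrite ler_norml; move: h1 h2; rewrite /Z; lra.
Qed.

End NoiseEvent.

(** * Tracking the noiseless descent *)

Section Tracking.
Variables (R : realType) (m n : nat) (f : 'I_m -> 'rV[R]_n -> R).
Variables (e : rel 'I_m) (W : 'M[R]_m) (L alpha mu : R).
Hypothesis m_gt0 : (0 < m)%N.
Hypothesis f_smooth : forall i, smooth (f i).
Hypothesis W_mix : mixing_matrix e W.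
Hypothesis f_lip : forall i, lipschitz_grad (f i) L.
Hypotheses (L_ge0 : 0 <= L) (alpha_gt0 : 0 < alpha) (mu_gt0 : 0 < mu).
Hypothesis alpha_le : alpha * L <= lambda_min W.
Implicit Types x y z : 'rV[R]_(m * n).

Local Notation F := (stacked_obj f).
Local Notation Q := (Qfun f W alpha).
Local Notation g := (resid f W alpha).

(** The curvature of Q is at most 1 / alpha, which makes the terms that mix the
    gradient and its error cancel. *)
Lemma descent_perturbed y v :
  Q (y - alpha *: (g y + v)) <=
  Q y - alpha / 2 * norm2 (g y) ^+ 2 + alpha / 2 * norm2 v ^+ 2.
Proof.
apply: le_trans (Q_upper m_gt0 f_smooth W_mix f_lip L_ge0 alpha_gt0 y _) _.
rewrite [_ - _ - y]addrAC subrr add0r dotNr dotZr norm2N norm2Z gtr0_norm// exprMn.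
rewrite dotDr dotxx (sqr_norm2D (g y) v).
have e1 a X : a / (2 * alpha) * (alpha ^+ 2 * X) = alpha / 2 * (a * X).
  by field; rewrite gt_eqF.
rewrite e1; have X0 := sqr_ge0 (norm2 (g y + v)); rewrite (sqr_norm2D (g y) v) in X0.
have a1 : 1 - lambda_min W + alpha * L <= 1 by have := alpha_le; lra.
have := ler_wpM2l (divr_ge0 (ltW alpha_gt0) (ler0n _ 2)) (ler_wpM2r X0 a1).
by move: (norm2 (g y) ^+ 2) (norm2 v ^+ 2) (dot _ _) => u s t; lra.
Qed.

(** Subtracting the filtered noise from the iterates leaves a gradient descent
    whose gradients are only slightly wrong. *)
Lemma tracking_step x z s : exists2 v, norm2 v <= (L + mu) * norm2 z &
  (x - alpha *: (g x + s)) - (z *m What n W - (alpha * mu) *: z - alpha *: s) =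
  (x - z) - alpha *: (g (x - z) + v).
Proof.
exists (grad F x - grad F (x - z) - mu *: z).
  rewrite mulrDl; apply: le_trans (norm2B _ _) _; rewrite norm2Z gtr0_norm// lerD2r.
  apply: le_trans (lipschitz_stacked f_smooth L_ge0 f_lip _ _) _.
  by rewrite opprB addrC subrK.
rewrite /resid; move: (grad F x) (grad F (x - z)) => u v.
rewrite !mulmxBr !mulmx1 mulmxBl.
move: (x *m What n W) (z *m What n W) => wx wz.
by apply/rowP => l; rewrite !mxE; field; rewrite gt_eqF.
Qed.

Variables (eps kappa H0 eta : R) (xs x0 : 'rV[R]_(m * n)) (xi : nat -> 'I_m -> 'rV[R]_n).
Variable K : nat.
Hypothesis Q_min : forall x, Q xs <= Q x.
Hypothesis Q_gap : forall x, norm2 (g x) < eps -> Q x - Q xs <= norm2 (g x) ^+ 2 / mu.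
Hypotheses (kappa_gt0 : 0 < kappa) (kappa_mu : 2 * kappa <= mu).
Hypothesis kappa_eps : 2 * kappa * H0 <= eps ^+ 2.
Hypothesis alpha_kappa : alpha * kappa <= 1.
Hypothesis eta_small : ((L + mu) * eta) ^+ 2 <= 2 * kappa * H0.
Hypothesis gap0 : Q x0 - Q xs <= H0.
Hypothesis filtered_le : forall k, (k <= K)%N -> norm2 (filtered W alpha mu xi k) <= eta.
Hypothesis eps_ge0 : 0 <= eps.

(** As long as the gap is at most H0, the squared gradient is at least 2 kappa times
    the gap, be it by Q_gap or because the gradient exceeds eps. *)
Lemma tracking_gap k : (k <= K)%N ->
  Q (ndgd f W alpha x0 xi k - filtered W alpha mu xi k) - Q xs <=
  (1 - alpha * kappa) ^+ k * H0 + ((L + mu) * eta) ^+ 2 / (2 * kappa).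
Proof.
have := kappa_gt0 => k0.
pose E k := Q (ndgd f W alpha x0 xi k - filtered W alpha mu xi k) - Q xs.
pose u := ((L + mu) * eta) ^+ 2; rewrite -/(E k) -/u.
have rho0 : 0 <= 1 - alpha * kappa by rewrite subr_ge0.
have uH : u <= 2 * kappa * H0 by exact: eta_small.
have uH' : u / (2 * kappa) <= H0 by rewrite ler_pdivrMr ?mulr_gt0// mulrC.
suff : (k <= K)%N -> E k <= H0 /\ E k <= (1 - alpha * kappa) ^+ k * H0 + u / (2 * kappa).
  by move=> h /h[].
have H00 : 0 <= H0 by apply: le_trans gap0; rewrite subr_ge0.
elim: k => [_|k IH kK].
  rewrite /E /= subr0; split => //; rewrite expr0 mul1r.
  apply: le_trans gap0 _; rewrite lerDl divr_ge0 ?sqr_ge0//.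
  by rewrite mulr_ge0// ltW.
have [EH Ek] := IH (ltnW kK).
have step : E k.+1 <= (1 - alpha * kappa) * E k + alpha / 2 * u.
  rewrite /E (ndgdS f_smooth W_mix alpha_gt0) /=.
  have := filtered_le (ltnW kK).
  move: EH; rewrite /E; move: (ndgd _ _ _ _ _ k) (filtered _ _ _ _ k) => x z EH zeta.
  have [v vz ->] := tracking_step x z (stack (xi k)).
  have := descent_perturbed (x - z) v; set y := x - z in EH *.
  have vu : norm2 v ^+ 2 <= u.
    have Lm : 0 <= L + mu by rewrite addr_ge0// ltW.
    have Le : 0 <= (L + mu) * eta by rewrite mulr_ge0// (le_trans (norm2_ge0 _) zeta).
    rewrite /u ler_pXn2r ?nnegrE ?norm2_ge0//.
    by apply: le_trans vz _; rewrite ler_wpM2l.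
  have gE : 2 * kappa * (Q y - Q xs) <= norm2 (g y) ^+ 2.
    have y0 : 0 <= Q y - Q xs by rewrite subr_ge0.
    have [gy|gy] := ltP (norm2 (g y)) eps.
      have := Q_gap gy; rewrite ler_pdivlMr// => h; apply: le_trans h.
      by rewrite mulrC ler_wpM2l.
    apply: (@le_trans _ _ (eps ^+ 2)); last by rewrite ler_pXn2r ?nnegrE ?norm2_ge0.
    by apply: le_trans kappa_eps; rewrite ler_wpM2l// mulr_ge0// ltW.
  have a2 : 0 <= alpha / 2 by rewrite divr_ge0// ltW.
  have := ler_wpM2l a2 vu; have := ler_wpM2l a2 gE.
  by move: (norm2 (g y) ^+ 2) (norm2 v ^+ 2) => s t; lra.
split.
  have := ler_wpM2l rho0 EH.
  have := ler_wpM2l (divr_ge0 (ltW alpha_gt0) (ler0n _ 2)) uH.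
  by move: step; lra.
have e1 : (1 - alpha * kappa) * (u / (2 * kappa)) = u / (2 * kappa) - alpha / 2 * u.
  by field; rewrite gt_eqF.
have := ler_wpM2l rho0 Ek; rewrite [leRHS]mulrDr e1 mulrA -exprS.
by move: step; lra.
Qed.

End Tracking.

(** * Choice of the constants *)

Section Constants.
Variable R : realType.
Implicit Types (S q alpha zeta : R).

Lemma pow_step S k : 16 <= S -> 16 * S ^+ k <= S ^+ k.+1.
Proof. by move=> hS; rewrite exprS ler_wpM2r// exprn_ge0//; lra. Qed.

Lemma pow_ge1 S k : 16 <= S -> 1 <= S ^+ k.
Proof. by move=> hS; apply: exprn_ege1; lra. Qed.

Lemma pow_mono S j k : 16 <= S -> (j <= k)%N -> S ^+ j <= S ^+ k.
Proof. by move=> hS; apply: ler_weXn2l; lra. Qed.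

(** As expR (- Lam) <= alpha zeta, two copies of Lam in the exponent absorb
    alpha^-2, and the others absorb S^12. *)
Lemma tail_le S alpha zeta Lam (M : R) : 16 <= S -> 0 < alpha -> 0 < zeta < 1 ->
  ln (alpha^-1 * zeta^-1) <= Lam -> 1 <= Lam -> 0 <= M <= S ^+ 12 * alpha ^- 2 ->
  M * expR (- ((S ^+ 12 + 2) * Lam)) <= zeta.
Proof.
move=> hS a0 /andP[z0 z1] lnL L1 /andP[M0 MS].
have S0 : 0 < S ^+ 12 by rewrite exprn_gt0//; lra.
have az : 0 < alpha^-1 * zeta^-1 by rewrite mulr_gt0// invr_gt0.
have e1 : expR (- Lam) <= alpha * zeta.
  rewrite -lef_pV2 ?posrE ?mulr_gt0 ?expR_gt0// invfM -expRN opprK.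
  by rewrite -[leLHS]lnK ?posrE// ler_expR.
have e2 : expR (- (S ^+ 12 * Lam)) <= (S ^+ 12)^-1.
  rewrite expRN lef_pV2 ?posrE ?expR_gt0//.
  apply: le_trans (_ : _ <= S ^+ 12 * Lam) _; first by rewrite ler_peMr// ltW.
  by apply: le_trans (expR_ge1Dx _); rewrite lerDr.
have -> : expR (- ((S ^+ 12 + 2) * Lam)) =
    expR (- (S ^+ 12 * Lam)) * (expR (- Lam) * expR (- Lam)).
  by rewrite -!expRD; congr expR; ring.
have e3 : expR (- Lam) * expR (- Lam) <= (alpha * zeta) ^+ 2.
  by rewrite -expr2 ler_pXn2r ?nnegrE ?expR_ge0// mulr_ge0// ltW.
apply: (@le_trans _ _ (S ^+ 12 * alpha ^- 2 * ((S ^+ 12)^-1 * (alpha * zeta) ^+ 2))).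
  by apply: ler_pM => //; apply: ler_pM => //; apply: mulr_ge0; exact: expR_ge0.
rewrite [leLHS](_ : _ = zeta * zeta); first by rewrite ler_piMl// ltW.
by field; rewrite !gt_eqF//; lra.
Qed.

Lemma geom_le S alpha (K : nat) : 16 <= S -> 0 < alpha -> alpha <= S ->
  S ^+ 7 * alpha ^- 2 <= K%:R -> (1 - alpha * S ^- 7) ^+ K <= alpha.
Proof.
move=> hS a0 aS hK.
have S7 : 0 < S ^+ 7 by rewrite exprn_gt0//; lra.
have x0 : 0 <= 1 - alpha * S ^- 7.
  rewrite subr_ge0 ler_pdivrMr// mul1r (le_trans aS)//.
  by rewrite -[leLHS]expr1; exact: pow_mono.
have aK : alpha^-1 <= alpha * S ^- 7 * K%:R.
  have := ler_wpM2l (_ : 0 <= alpha * S ^- 7) hK.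
  rewrite divr_ge0 ?(ltW a0) ?(ltW S7)// => /(_ isT); apply: le_trans.
  rewrite [leRHS](_ : _ = alpha^-1)//; field; rewrite !gt_eqF//; lra.
apply: (@le_trans _ _ (expR (- (alpha * S ^- 7 * K%:R)))).
  rewrite -[X in expR X]mulNr expRM_natr.
  by apply: lerXn2r; rewrite ?nnegrE ?expR_ge0// expR_ge1Dx.
rewrite expRN -[leRHS]invrK lef_pV2 ?posrE ?expR_gt0 ?invr_gt0//.
by apply: le_trans aK _; apply: le_trans (expR_ge1Dx _); rewrite lerDr.
Qed.

End Constants.

Section Distance.
Variables (R : realType) (n : nat).
Implicit Types (x y : 'rV[R]_n) (Y : set 'rV[R]_n).

Lemma dist_set1 x y : dist x [set y] = (norm2 (x - y))%:E.
Proof. by rewrite /dist image_set1 ereal_inf1. Qed.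

Lemma dist_triangle x y Y (a b : R) : norm2 (x - y) <= a -> (dist y Y <= b%:E)%E ->
  (dist x Y <= (b + a)%:E)%E.
Proof.
move=> xy yY; rewrite EFinD -leeBlDr//; apply: le_trans yY.
apply/ereal_infP => _ [z Yz <-]; rewrite leeBlDr// -EFinD.
apply: (@le_trans _ _ (norm2 (x - z))%:E); first by apply: ereal_inf_lbound; exists z.
by rewrite lee_fin; have := norm2_dist x y z; lra.
Qed.

End Distance.

Section Estimate.
Variables (R : realType) (m n : nat) (f : 'I_m -> 'rV[R]_n -> R).
Variables (e : rel 'I_m) (W : 'M[R]_m) (L alpha : R).
Hypotheses (m_gt0 : (0 < m)%N) (n_gt0 : (0 < n)%N).
Hypothesis f_smooth : forall i, smooth (f i).
Hypothesis W_mix : mixing_matrix e W.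
Hypothesis f_lip : forall i, lipschitz_grad (f i) L.
Hypothesis f_coercive : forall i, coercive (f i).
Variables (eps gamma mu delta zeta : R).
Hypotheses (eps_gt0 : 0 < eps) (gamma_gt0 : 0 < gamma) (mu_gt0 : 0 < mu <= L).
Hypothesis alpha_gt0 : 0 < alpha.
Hypotheses (alpha_le : alpha * L <= lambda_min W) (alpha_small : alpha * L <= 1 / 2).
Hypothesis regions : region1 f W alpha eps `|` region2 f alpha gamma `|`
  region3 f W alpha mu delta = [set: 'rV[R]_(m * n)].
Variables (d : measure_display) (T : measurableType d) (P : probability T R).
Variables (xi : nat -> 'I_m -> T -> 'rV[R]_n) (sigma B : R) (x0 : 'rV[R]_(m * n)).
Hypothesis xi_iid : iid P (fun ki : nat * 'I_m => xi ki.1 ki.2).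
Hypothesis xi_var : forall k i, zero_mean_var P (xi k i) sigma.
Hypothesis sigma_le : sigma ^+ 2 <= lambda_min W * eps ^+ 2 / (m * n)%:R.
Hypothesis Q_bounded : {ae P, forall w, forall k,
  `|Qfun f W alpha (ndgd f W alpha x0 (fun k i => xi k i w) k)| <= B}.
Hypothesis zeta01 : 0 < zeta < 1.
Variables (S Lam : R).
Hypotheses (S_ge : 16 <= S) (m_le : m%:R <= S) (n_le : n%:R <= S) (L_le : L <= S).
Hypotheses (Linv_le : L^-1 <= S) (eps_le : eps <= S) (epsinv_le : eps^-1 <= S).
Hypotheses (mu_le : mu <= S) (muinv_le : mu^-1 <= S) (sigma_S : `|sigma| <= S) (B_le : B <= S).
Hypotheses (Lam_ge1 : 1 <= Lam) (Lam_ge : ln (alpha^-1 * zeta^-1) <= Lam).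

Local Notation Q := (Qfun f W alpha).
Local Notation g := (resid f W alpha).
Let q := Num.sqrt (alpha * Lam).

(** S dominates all parameters and their inverses, and numeric constants are
    absorbed by one more power of S.  The powers are S^4 for the initial gap, S^6
    for the distance to xs wherever Q <= B, S^8 for the noise, S^-7 for the
    contraction rate per unit of alpha, S^16 q for the coordinates of the filtered
    noise and S^-3 q / alpha for the Chernoff parameter.  If S^25 q >= 1, the initial
    point is already close enough to xs; otherwise all errors are small. *)
Lemma ndgd_estimate : exists xs : 'rV[R]_(m * n), (forall x, g x = 0 <-> x = xs) /\
  exists K : nat, K%:R <= S ^+ 31 * alpha ^- 2 /\
  exists E : set T, [/\ measurable E, ((1 - zeta)%:E <= P E)%E &
    forall w, E w -> norm2 (ndgd f W alpha x0 (fun k i => xi k i w) K - xs) <= S ^+ 31 * q].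
Proof.
have [mu0 muL] := andP mu_gt0.
have L0 : 0 < L by exact: lt_le_trans muL.
have L_ge0 := ltW L0.
have S0 : 0 < S by move: S_ge; lra.
have S_ge' := S_ge.
have P0 k : 0 < S ^+ k by rewrite exprn_gt0.
have [xs [gxs xs_uniq Q_min Q_gap Q_dist]] := landscape m_gt0 n_gt0 f_smooth W_mix f_lip
  f_coercive L_ge0 alpha_gt0 eps_gt0 gamma_gt0 mu0 alpha_le regions.
exists xs; split; first by move=> x; split=> [/xs_uniq|->].
have Qxs := minimum_ge m_gt0 n_gt0 f_smooth W_mix f_lip L_ge0 alpha_gt0 eps_gt0 mu0
  alpha_le xi_iid xi_var sigma_le Q_bounded alpha_small Q_gap.
have epsS : 1 <= eps * S by rewrite -ler_pdivrMl ?mulr1.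
have muS : 1 <= mu * S by rewrite -ler_pdivrMl ?mulr1.
have LS : 1 <= L * S by rewrite -ler_pdivrMl ?mulr1.
have alphaS : alpha <= S.
  have -> : alpha = (alpha * L) * L^-1 by rewrite mulfK// gt_eqF.
  have := ler_wpM2r (_ : 0 <= L^-1) alpha_small; rewrite invr_ge0 => /(_ L_ge0).
  by move: Linv_le; lra.
have e2mu : eps ^+ 2 / mu <= S ^+ 3.
  rewrite (exprSr S 2); apply: ler_pM => //; rewrite ?sqr_ge0 ?invr_ge0 ?(ltW mu0)//.
  by apply: lerXn2r; rewrite // nnegrE ltW.
have H0 : 2 * B + eps ^+ 2 / mu <= S ^+ 4.
  have := pow_step 3 S_ge'; have := pow_mono S_ge' (isT : (1 <= 3)%N).
  by rewrite expr1; move: B_le e2mu; lra.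
have D_bound x : Q x <= B -> norm2 (x - xs) <= S ^+ 6.
  move=> QxB; have := Q_dist x (eps / 2).
  have -> : 0 < eps / 2 < eps by move: eps_gt0; lra.
  move=> /(_ isT) /le_trans; apply.
  have gap : 0 <= Q x - Q xs <= S ^+ 4.
    by rewrite subr_ge0 Q_min; move: QxB Qxs H0; lra.
  have [gap0 gap4] := andP gap.
  have h1 : (Q x - Q xs) * eps^-1 <= S ^+ 5.
    by rewrite (exprSr S 4); apply: ler_pM => //; rewrite invr_ge0 ltW.
  have h2 : eps * mu^-1 <= S ^+ 2.
    by rewrite expr2; apply: ler_pM => //; rewrite ?invr_ge0 ltW.
  have -> : (Q x - Q xs) / (eps / 2) + 2 * (eps / 2) / mu =
      2 * ((Q x - Q xs) * eps^-1) + eps * mu^-1 by field; rewrite !gt_eqF.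
  have := pow_step 5 S_ge'; have := pow_mono S_ge' (isT : (2 <= 5)%N).
  by have := P0 5%N; lra.
have xi_bdd k i a : {ae P, forall w, `|xi k i w 0 a| <= S ^+ 8}.
  have := noise_bounded m_gt0 f_smooth W_mix f_lip L_ge0 alpha_gt0 xi_iid Q_bounded
    gxs D_bound k i a.
  apply: filterS => w /le_trans; apply.
  have : L * S ^+ 6 <= S ^+ 7 by rewrite exprS ler_wpM2r ?(ltW (P0 6%N)).
  have := pow_step 7 S_ge'; have := pow_ge1 7 S_ge'; lra.
have Qx0 : Q x0 <= B.
  by have [w /(_ 0%N)] := ae_witness Q_bounded; apply: le_trans; exact: ler_norm.
have q0 : 0 < q by rewrite sqrtr_gt0 mulr_gt0// (lt_le_trans ltr01).
have q2 : q ^+ 2 = alpha * Lam by rewrite sqr_sqrtr// mulr_ge0 ?(ltW alpha_gt0)// (le_trans ler01).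
have [qbig|qsmall] := leP 1 (S ^+ 25 * q).
  exists 0%N; split; first by rewrite divr_ge0 ?ltW// exprn_gt0.
  exists setT; split => // [|w _].
    by rewrite probability_setT lee_fin; move: zeta01; lra.
  apply: le_trans (D_bound _ Qx0) _.
  rewrite (exprD S 6 25) -mulrA ler_peMr// ltW//.
have S25 : S ^+ 25 * q <= 1 by exact: ltW.
(* The lower powers of S times q are smaller by a factor 16. *)
have Sq j : (j <= 24)%N -> 16 * (S ^+ j * q) <= 1.
  move=> j24; apply: le_trans S25; rewrite mulrA ler_wpM2r ?(ltW q0)//.
  by apply: le_trans (pow_step j S_ge') _; apply: pow_mono.
have [K /andP[K1 K2]] : exists K : nat, S ^+ 7 * alpha ^- 2 <= K%:R <= S ^+ 7 * alpha ^- 2 + 1.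
  have X0 : 0 <= S ^+ 7 * alpha ^- 2.
    by rewrite mulr_ge0 ?(ltW (P0 7%N))// invr_ge0 exprn_ge0// ltW.
  have /andP[h1 h2] := truncn_itv X0; exists (Num.truncn (S ^+ 7 * alpha ^- 2)).+1.
  by rewrite (ltW h2)/= -natr1 lerD2r.
have a2 : 1 <= S ^+ 2 * alpha ^- 2.
  rewrite ler_pdivlMr ?exprn_gt0// mul1r.
  by apply: lerXn2r; rewrite // nnegrE ltW.
have ia2 : 0 < alpha ^- 2 by rewrite invr_gt0 exprn_gt0.
have K8 : K%:R + 1 <= S ^+ 8 * alpha ^- 2.
  apply: le_trans (_ : _ <= (S ^+ 7 + 2 * S ^+ 2) * alpha ^- 2) _; first by lra.
  rewrite ler_wpM2r ?(ltW ia2)//.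
  have := pow_step 7 S_ge'; have := pow_mono S_ge' (isT : (2 <= 7)%N).
  by have := P0 7%N; lra.
exists K; split.
  apply: (@le_trans _ _ (S ^+ 8 * alpha ^- 2)); first by lra.
  by rewrite ler_wpM2r ?(ltW ia2)//; apply: pow_mono.
have th0 : 0 <= S ^- 3 * q / alpha.
  by rewrite divr_ge0 ?(ltW alpha_gt0)// mulr_ge0 ?(ltW q0)// invr_ge0 ltW.
have thG : S ^- 3 * q / alpha * alpha * S ^+ 8 <= 1 / 2.
  have -> : S ^- 3 * q / alpha * alpha * S ^+ 8 = S ^+ 5 * q.
    by field; rewrite !gt_eqF.
  by have := Sq 5%N isT; have := mulr_gt0 (P0 5%N) q0; lra.
have alpha_mu : alpha * mu <= lambda_min W.
  by apply: le_trans alpha_le; rewrite ler_wpM2l// ltW.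
have [E [mE PE Ebdd]] := noise_event m_gt0 W_mix alpha_gt0 mu0 alpha_mu xi_iid xi_var
  xi_bdd (ltW (P0 8%N)) K (S ^+ 16 * q) th0 thG.
exists E; split => //.
  apply: le_trans PE; rewrite lee_fin lerD2l lerN2.
  rewrite mulrA; set M := _ * 2.
  have M12 : 0 <= M <= S ^+ 12 * alpha ^- 2.
    rewrite mulr_ge0//= /M !natrM -natr1.
    have mn : m%:R * n%:R <= S ^+ 2 by rewrite expr2; apply: ler_pM.
    have := ler_pM (_ : 0 <= K%:R + 1) (_ : 0 <= m%:R * n%:R) K8 mn.
    rewrite addr_ge0// mulr_ge0// => /(_ isT isT) h.
    have := ler_wpM2r (ltW ia2) (pow_step 10 S_ge').
    have := ler_wpM2r (ltW ia2) (pow_mono S_ge' (isT : (11 <= 12)%N)).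
    by have := mulr_gt0 (P0 10%N) ia2; move: h; move: (alpha ^- 2) => A; lra.
  apply: le_trans (tail_le S_ge alpha_gt0 zeta01 Lam_ge Lam_ge1 M12).
  have [M0 _] := andP M12; rewrite ler_wpM2l// ler_expR.
  have -> : - (S ^- 3 * q / alpha) * (S ^+ 16 * q) = - (S ^+ 13 * Lam).
    have -> : - (S ^- 3 * q / alpha) * (S ^+ 16 * q) = - (S ^+ 13 * (q ^+ 2 / alpha)).
      by field; rewrite !gt_eqF.
    by rewrite q2; congr (- (_ * _)); field; rewrite gt_eqF.
  have -> : 2 * (S ^- 3 * q / alpha) ^+ 2 * sigma ^+ 2 * (alpha / mu) =
      2 * S ^- 6 * (sigma ^+ 2 * mu^-1) * Lam.
    have -> : 2 * (S ^- 3 * q / alpha) ^+ 2 * sigma ^+ 2 * (alpha / mu) =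
        2 * S ^- 6 * (sigma ^+ 2 * mu^-1) * (q ^+ 2 / alpha) by field; rewrite !gt_eqF.
    by rewrite q2; congr (_ * _); field; rewrite gt_eqF.
  have s3 : 2 * S ^- 6 * (sigma ^+ 2 * mu^-1) <= 1.
    have h : sigma ^+ 2 * mu^-1 <= S ^+ 3.
      rewrite (exprSr S 2); apply: ler_pM => //; rewrite ?sqr_ge0 ?invr_ge0 ?(ltW mu0)//.
      rewrite -real_normK ?num_real//.
      by apply: lerXn2r; rewrite // nnegrE ltW.
    rewrite [2 * _ * _](_ : _ = 2 * (sigma ^+ 2 * mu^-1) / S ^+ 6); last by ring.
    rewrite ler_pdivrMr// mul1r.
    have := pow_step 3 S_ge'; have := pow_mono S_ge' (isT : (4 <= 6)%N).
    by have := P0 3%N; lra.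
  have Lam0 : 0 <= Lam by exact: le_trans ler01 Lam_ge1.
  have := ler_wpM2r Lam0 s3; have := ler_wpM2r Lam0 (pow_step 12 S_ge').
  have := ler_wpM2r Lam0 (pow_ge1 12 S_ge').
  by move: (_ * (sigma ^+ 2 * mu^-1)) => X; lra.
move=> w Ew.
pose noise k i := xi k i w.
have eta k : (k <= K)%N -> norm2 (filtered W alpha mu noise k) <= S ^+ 17 * q.
  move=> kK; apply: norm2_le; first by rewrite mulr_ge0 ?ltW.
  have h : forall j, `|filtered W alpha mu noise k 0 j| <= S ^+ 16 * q.
    move=> j; have [i [a ->]] := mxtens_indexP j.
    by have := Ebdd w Ew k i a kK; rewrite mxE.
  rewrite dotxx; apply: le_trans (norm2_le_coord h) _.
  rewrite (_ : (S ^+ 17 * q) ^+ 2 = S ^+ 2 * (S ^+ 16 * q) ^+ 2); last by ring.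
  by rewrite ler_wpM2r ?sqr_ge0// natrM expr2; apply: ler_pM.
have := @tracking_gap _ _ _ f e W L alpha mu m_gt0 f_smooth W_mix f_lip L_ge0 alpha_gt0
  mu0 alpha_le eps (S ^- 7) (S ^+ 4) (S ^+ 17 * q) xs x0 noise K Q_min Q_gap.
have i7 : 0 < S ^- 7 by rewrite invr_gt0.
have kmu : 2 * S ^- 7 <= mu.
  rewrite ler_pdivrMr//; have := ler_wpM2r (ltW (P0 6%N)) muS.
  have := pow_step 0 S_ge'; have := pow_mono S_ge' (isT : (1 <= 6)%N).
  by rewrite expr0; lra.
have keps : 2 * S ^- 7 * S ^+ 4 <= eps ^+ 2.
  have -> : 2 * S ^- 7 * S ^+ 4 = 2 / S ^+ 3 by field; rewrite gt_eqF.
  rewrite ler_pdivrMr//; have := ler_wpM2r (ltW S0) (exprn_ege1 2 epsS).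
  by move: S_ge'; lra.
have ak : alpha * S ^- 7 <= 1.
  rewrite ler_pdivrMr// mul1r (le_trans alphaS)//.
  by rewrite -[leLHS]expr1; exact: pow_mono.
have e0 : ((L + mu) * (S ^+ 17 * q)) ^+ 2 <= S ^+ 38 * q ^+ 2.
  rewrite (_ : S ^+ 38 * q ^+ 2 = (S ^+ 2 * (S ^+ 17 * q)) ^+ 2); last by ring.
  have q17 : 0 <= S ^+ 17 * q by rewrite mulr_ge0 ?ltW.
  have Lm0 : 0 <= L + mu by apply: addr_ge0 => //; exact: ltW.
  apply: lerXn2r; rewrite ?nnegrE; [exact: mulr_ge0| |].
    by apply: mulr_ge0 => //; exact: ltW.
  apply: ler_wpM2r => //; have := pow_step 1 S_ge'; rewrite expr1.
  by move: L_le mu_le S0; lra.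
have e1 : ((L + mu) * (S ^+ 17 * q)) ^+ 2 <= 2 * S ^- 7 * S ^+ 4.
  apply: le_trans e0 _.
  have -> : 2 * S ^- 7 * S ^+ 4 = 2 / S ^+ 3 by field; rewrite gt_eqF.
  rewrite ler_pdivlMr//.
  rewrite (_ : S ^+ 38 * q ^+ 2 * S ^+ 3 = (S ^+ 20 * q) * (S ^+ 21 * q)); last by ring.
  have q20 := mulr_gt0 (P0 20%N) q0; have q21 := mulr_gt0 (P0 21%N) q0.
  have h20 : S ^+ 20 * q <= 1 by have := Sq 20%N isT; lra.
  have h21 : S ^+ 21 * q <= 1 by have := Sq 21%N isT; lra.
  by have := ler_pM (ltW q20) (ltW q21) h20 h21; lra.
have g0 : Q x0 - Q xs <= S ^+ 4 by move: Qx0 Qxs H0; lra.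
move=> /(_ i7 kmu keps ak e1 g0 eta (ltW eps_gt0) K (leqnn K)).
set y := _ - filtered _ _ _ _ _ => gap.
have q20 : 0 < q ^+ 2 by rewrite exprn_gt0.
have Ebar : Q y - Q xs <= S ^+ 46 * q ^+ 2.
  apply: le_trans gap _.
  have alpha_q : alpha <= q ^+ 2 by rewrite q2 ler_peMr// ltW.
  have h1 : (1 - alpha * S ^- 7) ^+ K * S ^+ 4 <= q ^+ 2 * S ^+ 4.
    rewrite ler_wpM2r ?(ltW (P0 4%N))//; apply: le_trans alpha_q.
    exact: geom_le.
  have h2 : ((L + mu) * (S ^+ 17 * q)) ^+ 2 / (2 * S ^- 7) <= S ^+ 38 * q ^+ 2 * S ^+ 7.
    rewrite ler_pdivrMr; last by rewrite mulr_gt0.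
    rewrite (_ : S ^+ 38 * q ^+ 2 * S ^+ 7 * (2 * S ^- 7) = 2 * (S ^+ 38 * q ^+ 2)); last first.
      by field; rewrite gt_eqF.
    by have := mulr_gt0 (P0 38%N) q20; move: e0; lra.
  have := ler_wpM2r (ltW q20) (pow_step 45 S_ge').
  have := ler_wpM2r (ltW q20) (pow_mono S_ge' (isT : (4 <= 45)%N)).
  have := mulr_gt0 (P0 45%N) q20.
  rewrite (_ : S ^+ 38 * q ^+ 2 * S ^+ 7 = S ^+ 45 * q ^+ 2) in h2; last by ring.
  by move: h1 h2; lra.
(* The value of th that balances both terms of Q_dist up to a factor of order S. *)
have th : 0 < S ^+ 22 * q < eps.
  rewrite mulr_gt0//= -(ltr_pM2r S0); apply: lt_le_trans epsS.
  rewrite (_ : S ^+ 22 * q * S = S ^+ 23 * q); last by ring.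
  by have := Sq 23%N isT; have := mulr_gt0 (P0 23%N) q0; lra.
have := Q_dist y _ th.
have -> : ndgd f W alpha x0 noise K - xs = (y - xs) + filtered W alpha mu noise K.
  by rewrite /y; apply/rowP => j; rewrite !mxE; ring.
move=> hy; apply: le_trans (norm2D _ _) _.
have h1 : (Q y - Q xs) / (S ^+ 22 * q) <= S ^+ 24 * q.
  rewrite ler_pdivrMr; last by rewrite mulr_gt0.
  by rewrite (_ : S ^+ 24 * q * (S ^+ 22 * q) = S ^+ 46 * q ^+ 2); last by ring.
have h2 : 2 * (S ^+ 22 * q) / mu <= 2 * (S ^+ 23 * q).
  rewrite (_ : 2 * (S ^+ 23 * q) = 2 * (S ^+ 22 * q) * S); last by ring.
  by rewrite ler_wpM2l// !mulr_ge0// ltW.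
have h3 := eta K (leqnn K).
have := ler_wpM2r (ltW q0) (pow_step 30 S_ge').
have := ler_wpM2r (ltW q0) (pow_mono S_ge' (isT : (24 <= 30)%N)).
have := ler_wpM2r (ltW q0) (pow_mono S_ge' (isT : (23 <= 30)%N)).
have := ler_wpM2r (ltW q0) (pow_mono S_ge' (isT : (17 <= 30)%N)).
have := mulr_gt0 (P0 30%N) q0.
by move: hy h1 h2 h3; lra.
Qed.

End Estimate.

(** * The theorem *)

Section Hidden.
Variable R : realType.

Lemma add_inv_ge2 (t : R) : 0 < t -> 2 <= `|t| + `|t^-1|.
Proof.
move=> t0; rewrite !gtr0_norm ?invr_gt0//.
rewrite -(ler_pM2r t0) [leRHS]mulrDl mulVf ?gt_eqF//.
by have := sqr_ge0 (t - 1); rewrite expr2; lra.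
Qed.

Lemma mem_parameters (s : seq R) (t : R) : t \in s ->
  `|t| <= 1 + \sum_(u <- s) (`|u| + `|u^-1|) /\
  `|t^-1| <= 1 + \sum_(u <- s) (`|u| + `|u^-1|).
Proof.
move=> ts; rewrite (big_rem t)//=; set X := \sum_(u <- _) _.
have X0 : 0 <= X by rewrite sumr_ge0// => u _; rewrite addr_ge0.
by have := normr_ge0 t; have := normr_ge0 t^-1; split; lra.
Qed.

Lemma sqrt2_le : Num.sqrt 2 - 1 <= 1 / 2 :> R.
Proof.
have : Num.sqrt 2 <= Num.sqrt ((3 / 2) ^+ 2) :> R by rewrite ler_wsqrtr//; lra.
by rewrite sqrtr_sqr ger0_norm//; lra.
Qed.

End Hidden.

Theorem mainTheorem1 (R : realType) :
  exists (c : R) (p : nat),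
  forall (m n : nat) (hm : (0 < m)%N) (hn : (0 < n)%N)
    (f : 'I_m -> 'rV[R]_n -> R) (fsmooth : forall i, smooth (f i))
    (e : rel 'I_m) (esym : symmetric e)
    (W : 'M[R]_m) (hW : mixing_matrix e W)
    (Lg LH : 'I_m -> R),
  let LFg := \big[Num.max/0]_i Lg i in
  let LFH := \big[Num.max/0]_i LH i in
  forall
    (A1 : forall x, grad (sum_obj f) x = 0 ->
      0 < lambda_min (hess (sum_obj f) x) \/
      lambda_min (hess (sum_obj f) x) < 0)
    (A2 : forall i, lipschitz_grad (f i) (Lg i))
    (A3 : forall i, lipschitz_hess (f i) (LH i))
    (A4 : forall i, coercive (f i))
    (A5 : forall i j, connect e i j)
    (Delta1 zeta : R) (Delta1_gt0 : 0 < Delta1) (zeta01 : 0 < zeta < 1)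
    (abar : R) (habar : is_threshold f W Delta1 abar)
    (eps gamma mu delta alpha : R)
    (heps : 0 < eps) (hgamma : 0 < gamma <= LFg) (hmu : 0 < mu <= LFg)
    (hdelta : 0 < delta) (halpha : 0 < alpha <= alpha_hat W LFg abar zeta)
    (hregions : region1 f W alpha eps `|` region2 f alpha gamma `|`
                region3 f W alpha mu delta = [set: 'rV[R]_(m * n)])
    (d : measure_display) (T : measurableType d) (P : probability T R)
    (xi : nat -> 'I_m -> T -> 'rV[R]_n)
    (hiid : iid P (fun ki : nat * 'I_m => xi ki.1 ki.2))
    (sigma : R) (sigma_ge0 : 0 <= sigma)
    (hxi : forall k i, zero_mean_var P (xi k i) sigma)
    (hsigma : sigma ^+ 2 <= lambda_min W * eps ^+ 2 / (m * n)%:R)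
    (x0 : 'rV[R]_(m * n)),
  let x (k : nat) (w : T) := ndgd f W alpha x0 (fun k i => xi k i w) k in
  forall (B : R)
    (hbounded : {ae P, forall w, forall k, `|Qfun f W alpha (x k w)| <= B}),
  let Xf := local_minimizers (sum_obj f) in
  let XQ := local_minimizers (Qfun f W alpha) in
  let hidden := poly_factor c p [:: m%:R; n%:R; LFg; LFH; lambda_min W;
    Delta1; eps; gamma; mu; delta; sigma; B] in
  exists (K : nat) (Delta2 : R),
    [/\ K%:R <= hidden * (alpha ^- 2 * Num.max 1 (ln zeta^-1)),
        Delta2 <= hidden *
          Num.sqrt (alpha * Num.max 1 (ln (alpha^-1 * zeta^-1))) &
        exists E : set T,
          [/\ measurable E, (P E >= (1 - zeta)%:E)%E &
              forall w, E w ->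
              [/\ (dist (x K w) XQ <= Delta2%:E)%E,
                  exists2 y, XQ y & (norm2 (x K w - y))%:E = dist (x K w) XQ,
                  forall y, XQ y ->
                    (norm2 (x K w - y))%:E = dist (x K w) XQ ->
                    forall i, (dist (block y i) Xf <= Delta1%:E)%E &
                  forall i,
                    (dist (block (x K w) i) Xf <= (Delta1 + Delta2)%:E)%E]]].
Proof.
exists 1, 31%N.
move=> m n hm hn f fsmooth e esym W hW Lg LH LFg LFH A1 A2 A3 A4 A5 Delta1 zeta D1_gt0 zeta01
  abar habar eps gamma mu delta alpha heps hgamma hmu hdelta halpha hregions d T P xi hiid
  sigma sigma_ge0 hxi hsigma x0 x B hbounded Xf XQ hidden.
have [gamma0 _] := andP hgamma; have [mu0 muL] := andP hmu.
have L0 : 0 < LFg by exact: lt_le_trans muL.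
have flip i : lipschitz_grad (f i) LFg.
  move=> u v; apply: le_trans (A2 i u v) _; rewrite ler_wpM2r ?norm2_ge0//.
  exact: le_bigmax.
have [alpha0] := andP halpha; rewrite /alpha_hat !le_min => /and3P[al1 al2 al3].
have alpha_small : alpha * LFg <= 1 / 2.
  by apply: le_trans (sqrt2_le R); rewrite -ler_pdivlMr.
have Max1 : 1 <= Num.max 1 (ln zeta^-1) by rewrite le_max lexx.
have alpha_le : alpha * LFg <= lambda_min W.
  have LM0 : 0 < LFg * Num.max 1 (ln zeta^-1) by rewrite mulr_gt0// (lt_le_trans ltr01).
  move: al3; rewrite ler_pdivlMr//; apply: le_trans; rewrite mulrA ler_peMr//.
  by rewrite mulr_ge0// ltW.
have lam0 : 0 < lambda_min W by apply: lt_le_trans alpha_le; rewrite mulr_gt0.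
pose s := [:: m%:R; n%:R; LFg; LFH; lambda_min W; Delta1; eps; gamma; mu; delta; sigma; B].
pose S := 1 + \sum_(u <- s) (`|u| + `|u^-1|).
have hiddenE : hidden = S ^+ 31 by rewrite /hidden /poly_factor mul1r.
(* Nine of the parameters are positive, and t + 1 / t >= 2 for each of them. *)
have S16 : 16 <= S.
  have m0 : 0 < m%:R :> R by rewrite ltr0n.
  have n0 : 0 < n%:R :> R by rewrite ltr0n.
  rewrite /S /s !big_cons big_nil.
  have := add_inv_ge2 m0; have := add_inv_ge2 n0; have := add_inv_ge2 L0.
  have := add_inv_ge2 lam0; have := add_inv_ge2 D1_gt0; have := add_inv_ge2 heps.
  have := add_inv_ge2 gamma0; have := add_inv_ge2 mu0; have := add_inv_ge2 hdelta.
  have := normr_ge0 LFH; have := normr_ge0 LFH^-1; have := normr_ge0 sigma.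
  have := normr_ge0 sigma^-1; have := normr_ge0 B; have := normr_ge0 B^-1.
  lra.
have le_S t : t \in s -> t <= S.
  by move=> /mem_parameters[h _]; exact: le_trans (ler_norm _) h.
have inv_le_S t : t \in s -> t^-1 <= S.
  by move=> /mem_parameters[_ h]; exact: le_trans (ler_norm _) h.
pose Lam := Num.max 1 (ln (alpha^-1 * zeta^-1)).
have Lam1 : 1 <= Lam by rewrite le_max lexx.
have Lam_ge : ln (alpha^-1 * zeta^-1) <= Lam by rewrite le_max lexx orbT.
have [xs [xsP [K [K_le [E [mE PE Ex]]]]]] : exists xs, (forall y, resid f W alpha y = 0 <-> y = xs) /\
    exists K : nat, K%:R <= S ^+ 31 * alpha ^- 2 /\
    exists E : set T, [/\ measurable E, ((1 - zeta)%:E <= P E)%E &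
    forall w, E w -> norm2 (x K w - xs) <= S ^+ 31 * Num.sqrt (alpha * Lam)].
  apply: (ndgd_estimate hm hn fsmooth hW flip A4 heps gamma0 hmu alpha0 alpha_le alpha_small
    hregions hiid hxi hsigma hbounded zeta01 S16) => //.
  all: try (by apply: le_S; rewrite !inE eqxx ?orbT).
  all: try (by apply: inv_le_S; rewrite !inE eqxx ?orbT).
  by have [|h _] := @mem_parameters R s sigma; [rewrite !inE eqxx ?orbT|].
have XQE : XQ = [set xs].
  apply/seteqP; split => y.
    by move=> /(local_minimizers_Q hm hn fsmooth hW flip (ltW L0) alpha0 heps gamma0 mu0
      alpha_le hregions)/xsP.
  by move=> ->; apply/(local_minimizers_Q hm hn fsmooth hW flip (ltW L0) alpha0 heps gamma0 mu0
      alpha_le hregions)/xsP.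
have S31 : 0 < S ^+ 31 by rewrite exprn_gt0//; lra.
have near_f y : XQ y -> forall i, (dist (block y i) Xf <= Delta1%:E)%E.
  have aa : 0 < alpha <= abar by apply/andP; split.
  by move=> yQ i; have [_ h] := habar; exact: (h alpha aa y yQ i).
move: hidden hiddenE => hid ->.
exists K, (S ^+ 31 * Num.sqrt (alpha * Lam)); split.
- apply: le_trans K_le _; rewrite ler_wpM2l ?(ltW S31)//.
  by rewrite ler_peMr// invr_ge0 exprn_ge0// ltW.
- exact: lexx.
exists E; split => // w Ew; have xw := Ex w Ew.
split.
- by rewrite XQE dist_set1 lee_fin.
- by exists xs; rewrite XQE// dist_set1.
- by move=> y yQ _; exact: near_f.
move=> i; apply: (@dist_triangle _ _ _ (block xs i)).
  by rewrite -blockB; exact: le_trans (norm2_block_le _ _) xw.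
by apply: near_f; rewrite XQE.
Qed.
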